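(* Let $\Omega\subset\mathbb{R}^3$ be a bounded connected open set with $C^{1,1}$ boundary $\Gamma$, let $\theta>0$, $\alpha<A_1$ and $\eta\ge c_{\alpha,\theta}$, and let $\lambda_n,u_n^\Omega,u_n^\Gamma$ ($n\in\mathbb{N}$) and $T\mathcal{H}^{-1/2}(\Gamma)$ be as described in the context. Assume that $0\notin\Sigma=\{\lambda_n:n\in\mathbb{N}\}$. Let $F\in T\mathcal{H}^{-1/2}(\Gamma)$ be represented as $$F=\sum_{n=1}^\infty c_n\bar u_n^\Gamma,$$ where $\left(c_n|\lambda_n-\eta|^{-1/2}\right)_{n\in\mathbb{N}}\in\ell^2$. Then the solution $u\in X_T(\Omega)$ of the problem $$\langle u,\varphi\rangle^0_{\alpha,\theta}=-\langle F,\bar\varphi\rangle\qquad\text{for all }\varphi\in X_T(\Omega)$$ is given by $$u=\sum_{n=1}^\infty\left(\frac{\sqrt{|\lambda_n-\eta|}}{\lambda_n}c_n\right)\bar u_n^\Omega.$$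
   Context: Functions are complex-valued; $a\cdot b=\sum_i a_ib_i$ (no conjugation), bars denote complex conjugation; $\nu$ is the unit outer normal to $\Gamma$, $d\sigma$ the surface measure; $\mathbb{N}=\{1,2,\dots\}$. $X_T(\Omega)=\{u\in(L^2(\Omega))^3:\operatorname{curl}u\in(L^2(\Omega))^3,\ \operatorname{div}u\in L^2(\Omega),\ \nu\cdot u=0\text{ on }\Gamma\}$ with norm $\|u\|^2=\|u\|^2_{L^2}+\|\operatorname{curl}u\|^2_{L^2}+\|\operatorname{div}u\|^2_{L^2}$; for $C^{1,1}$ boundary it equals $\{u\in(H^1(\Omega))^3:\nu\cdot u=0\text{ on }\Gamma\}$ with continuous embedding into $(H^1(\Omega))^3$. $TL^2(\Gamma)=\{f\in(L^2(\Gamma))^3:\nu\cdot f=0\text{ on }\Gamma\}$. $\pi_Tu=\nu\times(u\times\nu)$ is the tangential components trace on $\Gamma$, which coincides with the usual trace for $u\in X_T(\Omega)$. $A_1=\inf\left\{\frac{\int_\Omega|\operatorname{curl}u|^2dx+\theta\int_\Omega|\operatorname{div}u|^2dx}{\int_\Omega|u|^2dx}:u\in(H^1_0(\Omega))^3,u\ne0\right\}$. For $\eta\ge0$ let $\langle u,v\rangle^{\eta}_{\alpha,\theta}=\int_\Omega\operatorname{curl}u\cdot\operatorname{curl}\bar v\,dx-\alpha\int_\Omega u\cdot\bar v\,dx+\theta\int_\Omega\operatorname{div}u\operatorname{div}\bar v\,dx+\eta\int_\Gamma u\cdot\bar v\,d\sigma$; $\langle\cdot,\cdot\rangle^0_{\alpha,\theta}$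 is the case $\eta=0$. $c_{\alpha,\theta}\ge0$ is a fixed constant such that for every $\eta\ge c_{\alpha,\theta}$ the form $\langle u,u\rangle^\eta_{\alpha,\theta}$ is coercive on $X_T(\Omega)$ (it exists when $\alpha<A_1$); then $\langle\cdot,\cdot\rangle^\eta_{\alpha,\theta}$ is a scalar product on $X_T(\Omega)$. $\eta\ge c_{\alpha,\theta}$ is fixed. $\mathcal{H}(\Omega)$ is the orthogonal complement of $(H^1_0(\Omega))^3$ in $X_T(\Omega)$ with respect to $\langle\cdot,\cdot\rangle^\eta_{\alpha,\theta}$. The Steklov eigenvalues are the $\lambda\in\mathbb{R}$ for which there is $u\in X_T(\Omega)\setminus\{0\}$ with $\int_\Omega\operatorname{curl}u\cdot\operatorname{curl}\varphi\,dx-\alpha\int_\Omega u\cdot\varphi\,dx+\theta\int_\Omega\operatorname{div}u\operatorname{div}\varphi\,dx=-\lambda\int_\Gamma u\cdot\varphi\,d\sigma$ for all $\varphi\in X_T(\Omega)$. They have finite multiplicity and form a sequence $\lambda_n$, $n\in\mathbb{N}$ (repeated according to multiplicity), with $\lambda_n<\eta$ and $\lambda_n\to-\infty$. $u_n^\Omega$, $n\in\mathbb{N}$, is a Hilbert basis of $\mathcal{H}(\Omega)$ consisting of corresponding eigenfunctions, normalized by $\langle u_n^\Omega,u_m^\Omega\rangle^\eta_{\alpha,\theta}=\delta_{nm}$. Set $u_n^\Gamma:=\sqrt{|\lambda_n-\eta|}\,\pi_Tu_n^\Omega$; then $u_n^\Gamma$, $n\in\mathbb{N}$, is an orthonormal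 basis of $TL^2(\Gamma)$ (with scalar product $\int_\Gamma f\cdot\bar g\,d\sigma$). Put $\bar u_n^\Gamma:=\overline{u_n^\Gamma}$, $\bar u_n^\Omega:=\overline{u_n^\Omega}$. For $s>0$, $T\mathcal{H}^s(\Gamma):=\left\{f=\sum_{n=1}^\infty d_nu_n^\Gamma:\ \|f\|_{s,\Gamma}:=\left(\sum_{n=1}^\infty|d_n|^2|\lambda_n-\eta|^{2s}\right)^{1/2}<\infty\right\}$, and $T\mathcal{H}^{-s}(\Gamma)$ is its dual. Each $F\in T\mathcal{H}^{-s}(\Gamma)$ is identified with a sequence $(c_n)$ with $\sum_n|c_n|^2|\lambda_n-\eta|^{-2s}<\infty$, acting by $\langle F,f\rangle=\sum_{n=1}^\infty c_nd_n$ for $f=\sum_nd_nu_n^\Gamma\in T\mathcal{H}^s(\Gamma)$ (so $\langle F,u_n^\Gamma\rangle=c_n$), and one writes formally $F=\sum_{n=1}^\infty c_n\bar u_n^\Gamma$. In the problem above, $\langle F,\bar\varphi\rangle$ denotes the action of $F$ on the trace of $\bar\varphi$ on $\Gamma$, which belongs to $T\mathcal{H}^{1/2}(\Gamma)$. *)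

(* Defs.v *)
From HB Require Import structures.
From mathcomp Require Import all_boot all_order all_algebra.
From mathcomp Require Import all_classical all_reals all_analysis.
From mathcomp Require Import complex.

Set Implicit Arguments.
Unset Strict Implicit.
Unset Printing Implicit Defensive.
Import Order.TTheory GRing.Theory Num.Theory.
Import numFieldNormedType.Exports.
Local Open Scope classical_set_scope.
Local Open Scope ring_scope.
Local Open Scope complex_scope.

(* Points are triples, so that the product topology, the product Borel
   sigma-algebra and the product measure all apply.  Values of vector fields
   are row vectors of complex numbers. *)
Definition pt (R : realType) : Type := (R * R * R)%type.
Definition vfield (R : realType) : Type := pt R -> 'rV[R[i]]_3.

(* [lebesgue_measure] lives on the alias [measurableTypeR R]; [leb1] is the
   same function on [R] itself, whose measurable sets are the same. *)
Definition leb1 (R : realType) : set R -> \bar R := @lebesgue_measure R.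

Section leb1.
Variable R : realType.

Let leb1_0 : leb1 (set0 : set R) = 0%E.
Proof. exact: (measure0 (@lebesgue_measure R)). Qed.
Let leb1_ge0 (A : set R) : (0 <= leb1 A)%E.
Proof. exact: (measure_ge0 (@lebesgue_measure R)). Qed.
Let leb1_semi_sigma_additive : semi_sigma_additive (@leb1 R).
Proof. exact: (@measure_semi_sigma_additive _ _ _ (@lebesgue_measure R)). Qed.
HB.instance Definition _ := isMeasure.Build _ R R (@leb1 R)
  leb1_0 leb1_ge0 leb1_semi_sigma_additive.

Let leb1_sigma_finite : sigma_finite setT (@leb1 R).
Proof. exact: (@sigma_finiteT _ _ _ (@lebesgue_measure R)). Qed.
HB.instance Definition _ := @Measure_isSigmaFinite.Build _ R R (@leb1 R)
  leb1_sigma_finite.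
End leb1.

Definition leb3 (R : realType) : set (pt R) -> \bar R :=
  ((@leb1 R \x @leb1 R) \x @leb1 R)%E.

Section defs.
Variable R : realType.
Local Notation C := R[i].
Local Notation pt := (pt R).
Local Notation vfield := (vfield R).
Implicit Types (Om : set pt) (mu : set pt -> \bar R) (D : set pt)
  (x y v : pt) (u w phi : vfield) (f g d : pt -> C) (psi : pt -> R).

Definition coord x (k : 'I_3) : R :=
  match val k with 0%N => x.1.1 | 1%N => x.1.2 | _ => x.2 end.
Definition basis (k : 'I_3) : pt :=
  ((k == 0%N :> nat)%:R, (k == 1%N :> nat)%:R, (k == 2%N :> nat)%:R).
Definition dotp x y : R := \sum_k coord x k * coord y k.
(* The Euclidean norm; the library norm on a product is the sup norm. *)
Definition enorm x : R := Num.sqrt (dotp x x).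

Definition sqmod (z : C) : R := complex.Re z ^+ 2 + complex.Im z ^+ 2.
Definition sqnorm (a : 'rV[C]_3) : R := \sum_k sqmod (a 0 k).
Definition cdot (a b : 'rV[C]_3) : C := \sum_k a 0 k * b 0 k.
Definition cross (a b : 'rV[C]_3) : 'rV[C]_3 :=
  \row_k (a 0 (ordS k) * b 0 (ordS (ordS k))
          - a 0 (ordS (ordS k)) * b 0 (ordS k)).
Definition cvec x : 'rV[C]_3 := \row_k (coord x k)%:C.
Definition conjf u : vfield := fun x => map_mx (@conjc R) (u x).

(* [mu] is a bare set function, so that the same integral serves Lebesgue
   measure and two-dimensional Hausdorff measure. *)
Definition rint mu D (h : pt -> R) : R := fine (\int[mu]_(x in D) (h x)%:E)%E.
Definition cint mu D f : C :=
  rint mu D (fun x => complex.Re (f x)) +i* rint mu D (fun x => complex.Im (f x)).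

Definition L2 mu D f : Prop :=
  [/\ measurable_fun D (fun x => complex.Re (f x)),
      measurable_fun D (fun x => complex.Im (f x)) &
      mu.-integrable D (fun x => (sqmod (f x))%:E)].
Definition L2v mu D u : Prop := forall k, L2 mu D (fun x => u x 0 k).

Definition psum (a : nat -> C) (s : nat -> vfield) (N : nat) : vfield :=
  fun x => \sum_(n < N) a n *: s n x.
Definition L2v_cvg mu D (s : nat -> vfield) u : Prop :=
  rint mu D (fun x => sqnorm (s N x - u x)) @[N --> \oo] --> (0 : R).

Definition partial (k : 'I_3) psi : pt -> R := fun x => 'D_(basis k) psi x.

Fixpoint Cr (m : nat) psi : Prop :=
  continuous psi /\
  if m is m'.+1 then
    forall k, (forall x, derivable psi x (basis k)) /\ Cr m' (partial k psi)
  else True.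

Definition test_fun Om psi : Prop :=
  (forall m, Cr m psi) /\
  exists2 K : set pt, compact K /\ K `<=` Om & forall x, ~ K x -> psi x = 0.

Definition bdry Om : set pt := closure Om `&` ~` interior Om.

Definition C11_fun (h : R * R -> R) : Prop :=
  (forall p, differentiable h p) /\
  exists L : R, forall p q,
    `| 'D_((1, 0) : R * R) h p - 'D_((1, 0) : R * R) h q | <= L * `| p - q | /\
    `| 'D_((0, 1) : R * R) h p - 'D_((0, 1) : R * R) h q | <= L * `| p - q |.

(* Near each boundary point, in some orthonormal frame, the open set is the
   strict subgraph of a C^{1,1} function. *)
Definition C11_domain Om : Prop :=
  forall x, bdry Om x ->
  exists (r : R) (e : 'I_3 -> pt) (h : R * R -> R),
    [/\ 0 < r, forall j k, dotp (e j) (e k) = (j == k)%:R, C11_fun h &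
        forall y, enorm (y - x) < r ->
          (Om y <->
           dotp y (e (inord 2)) < h (dotp y (e (inord 0)), dotp y (e (inord 1))))].

Definition is_outer_normal Om x v : Prop :=
  enorm v = 1 /\
  forall eps : R, 0 < eps -> exists2 del : R, 0 < del &
    forall y, enorm (y - x) < del ->
      (dotp (y - x) v < - (eps * enorm (y - x)) -> Om y) /\
      (eps * enorm (y - x) < dotp (y - x) v -> ~ Om y).
Definition normal Om x : 'rV[C]_3 := cvec (xget 0 [set v | is_outer_normal Om x v]).

(* Two-dimensional Hausdorff measure; on the Borel subsets of a C^1 surface it
   is the surface measure. *)
Definition sqdiam (A : set pt) : \bar R :=
  ereal_sup ([set 0%E] `|`
    [set z | exists x y, [/\ A x, A y & z = (enorm (x - y) ^+ 2)%:E]]).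
Definition hausdorff2_delta (del : R) (A : set pt) : \bar R :=
  ereal_inf [set (\sum_(0 <= k <oo) (pi / 4)%:E * sqdiam (B k))%E | B in
    [set B : nat -> set pt | A `<=` \bigcup_k B k /\
       forall k, (sqdiam (B k) <= (del ^+ 2)%:E)%E]].
Definition hausdorff2 (A : set pt) : \bar R :=
  ereal_sup [set hausdorff2_delta del A | del in [set del : R | 0 < del]].

Definition is_weak_partial Om (k : 'I_3) f g : Prop :=
  forall psi, test_fun Om psi ->
    cint (@leb3 R) Om (fun x => (psi x)%:C * g x) =
    - cint (@leb3 R) Om (fun x => (partial k psi x)%:C * f x).

Definition is_weak_curl Om u w : Prop :=
  forall psi, test_fun Om psi -> forall k,
    cint (@leb3 R) Om (fun x => (psi x)%:C * w x 0 k) =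
    - cint (@leb3 R) Om (fun x =>
        (partial (ordS k) psi x)%:C * u x 0 (ordS (ordS k))
        - (partial (ordS (ordS k)) psi x)%:C * u x 0 (ordS k)).

Definition is_weak_div Om u d : Prop :=
  forall psi, test_fun Om psi ->
    cint (@leb3 R) Om (fun x => (psi x)%:C * d x) =
    - cint (@leb3 R) Om (fun x => \sum_k (partial k psi x)%:C * u x 0 k).

(* The square integrable weak curl and weak divergence: unique up to a null
   set, and 0 by convention when there is none. *)
Definition curl Om u : vfield :=
  xget (fun=> 0) [set w | L2v (@leb3 R) Om w /\ is_weak_curl Om u w].
Definition div Om u : pt -> C :=
  xget (fun=> 0) [set d | L2 (@leb3 R) Om d /\ is_weak_div Om u d].

Definition ae_eq_on Om u w : Prop :=
  {ae @leb3 R, forall x, Om x -> u x = w x}.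

(* The normal trace of a field u in H(div), an element of H^{-1/2}, is given by
   <nu . u, psi> = \int_Om (u . grad psi + psi div u); the smooth psi
   compactly supported in R^3 are dense in H^1(Om). *)
Definition zero_normal_trace Om u : Prop :=
  forall psi, test_fun setT psi ->
    cint (@leb3 R) Om (fun x =>
      \sum_k (partial k psi x)%:C * u x 0 k + (psi x)%:C * div Om u x) = 0.

Definition XT Om u : Prop :=
  [/\ L2v (@leb3 R) Om u,
      exists w, L2v (@leb3 R) Om w /\ is_weak_curl Om u w,
      exists d, L2 (@leb3 R) Om d /\ is_weak_div Om u d &
      zero_normal_trace Om u].

Definition XTnorm Om u : R :=
  Num.sqrt (rint (@leb3 R) Om (fun x => sqnorm (u x))
            + rint (@leb3 R) Om (fun x => sqnorm (curl Om u x))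
            + rint (@leb3 R) Om (fun x => sqmod (div Om u x))).
Definition XT_cvg Om (s : nat -> vfield) u : Prop :=
  XTnorm Om (fun x => s N x - u x) @[N --> \oo] --> (0 : R).

(* The closure of the complex test functions in the H^1 norm; G is the weak
   gradient of f. *)
Definition H10 Om f : Prop :=
  exists G : 'I_3 -> pt -> C,
  [/\ L2 (@leb3 R) Om f,
      forall k, L2 (@leb3 R) Om (G k) /\ is_weak_partial Om k f (G k) &
      exists p q : nat -> pt -> R,
      [/\ forall N, test_fun Om (p N) /\ test_fun Om (q N),
          rint (@leb3 R) Om (fun x => sqmod ((p N x +i* q N x) - f x))
            @[N --> \oo] --> (0 : R) &
          forall k, rint (@leb3 R) Om (fun x =>
              sqmod ((partial k (p N) x +i* partial k (q N) x) - G k x))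
            @[N --> \oo] --> (0 : R)]].
Definition H10v Om u : Prop := forall k, H10 Om (fun x => u x 0 k).

(* The trace on the boundary of a field in (H^1(Om))^3, as the square integrable
   g for which Green's formula
     \int_Om (u_j d_k psi + psi d_k u_j) = \int_bdry g_j psi nu_k
   holds for all smooth compactly supported psi on R^3; since |nu| = 1 it determines g almost everywhere. *)
Definition is_trace Om u (g : vfield) : Prop :=
  L2v hausdorff2 (bdry Om) g /\
  exists2 G : 'I_3 -> vfield,
    L2v (@leb3 R) Om u /\
    forall k, L2v (@leb3 R) Om (G k) /\
      forall j, is_weak_partial Om k (fun x => u x 0 j) (fun x => G k x 0 j) &
    forall psi, test_fun setT psi -> forall j k,
      cint (@leb3 R) Om (fun x =>
        (partial k psi x)%:C * u x 0 j + (psi x)%:C * G k x 0 j) =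
      cint hausdorff2 (bdry Om) (fun x => (psi x)%:C * normal Om x 0 k * g x 0 j).
Definition trace Om u : vfield := xget (fun=> 0) [set g | is_trace Om u g].

Definition piT Om u : vfield :=
  fun x => cross (normal Om x) (cross (trace Om u x) (normal Om x)).

Definition TL2 Om (g : vfield) : Prop :=
  L2v hausdorff2 (bdry Om) g /\
  {ae hausdorff2, forall x, bdry Om x -> cdot (normal Om x) (g x) = 0}.
Definition TL2_inner Om (g h : vfield) : C :=
  cint hausdorff2 (bdry Om) (fun x => cdot (g x) (conjf h x)).

Definition vol_form Om (alpha theta : R) u phi : C :=
  cint (@leb3 R) Om (fun x => cdot (curl Om u x) (curl Om phi x))
  - alpha%:C * cint (@leb3 R) Om (fun x => cdot (u x) (phi x))
  + theta%:C * cint (@leb3 R) Om (fun x => div Om u x * div Om phi x).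
Definition bdry_form Om u phi : C :=
  cint hausdorff2 (bdry Om) (fun x => cdot (trace Om u x) (trace Om phi x)).

Definition sform Om (alpha theta eta : R) u w : C :=
  vol_form Om alpha theta u (conjf w) + eta%:C * bdry_form Om u (conjf w).

Definition coercive Om (alpha theta eta : R) : Prop :=
  exists2 k : R, 0 < k & forall u, XT Om u ->
    k * XTnorm Om u ^+ 2 <= complex.Re (sform Om alpha theta eta u u).

Definition A1 Om (theta : R) : R :=
  inf [set t : R | exists u, [/\ H10v Om u, ~ ae_eq_on Om u (fun=> 0) &
    t = (rint (@leb3 R) Om (fun x => sqnorm (curl Om u x))
         + theta * rint (@leb3 R) Om (fun x => sqmod (div Om u x)))
        / rint (@leb3 R) Om (fun x => sqnorm (u x))]].

Definition steklov_eigenfun Om (alpha theta lambda : R) u : Prop :=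
  [/\ XT Om u, ~ ae_eq_on Om u (fun=> 0) &
      forall phi, XT Om phi ->
        vol_form Om alpha theta u phi = - lambda%:C * bdry_form Om u phi].

Definition Hspace Om (alpha theta eta : R) u : Prop :=
  XT Om u /\ forall w, H10v Om w -> sform Om alpha theta eta u w = 0.

(* The Steklov eigenvalues lam_n, each eigenvalue being repeated according to
   its multiplicity (its eigenspace is spanned by the u_n with lam_n equal to
   it), and the Hilbert basis u_n of eigenfunctions. *)
Definition steklov_basis Om (alpha theta eta : R)
    (lam : nat -> R) (u : nat -> vfield) : Prop :=
  [/\ forall n, steklov_eigenfun Om alpha theta (lam n) (u n),
      forall lambda w, steklov_eigenfun Om alpha theta lambda w ->
        exists (N : nat) (a : nat -> C),
          ae_eq_on Om w (fun x => \sum_(n < N | lam n == lambda) a n *: u n x),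
      forall n, lam n < eta,
      lam n @[n --> \oo] --> -oo &
      [/\ forall n, Hspace Om alpha theta eta (u n),
          forall n m, sform Om alpha theta eta (u n) (u m) = (n == m)%:R &
          forall w, Hspace Om alpha theta eta w ->
            XT_cvg Om (psum (fun n => sform Om alpha theta eta w (u n)) u) w]].

Definition uGamma Om (eta : R) (lam : nat -> R) (u : nat -> vfield)
    (n : nat) : vfield :=
  fun x => (Num.sqrt `|lam n - eta|)%:C *: piT Om (u n) x.

Definition TL2_orthonormal_basis Om (b : nat -> vfield) : Prop :=
  [/\ forall n, TL2 Om (b n),
      forall n m, TL2_inner Om (b n) (b m) = (n == m)%:R &
      forall g : vfield, TL2 Om g ->
        L2v_cvg hausdorff2 (bdry Om) (psum (fun n => TL2_inner Om g (b n)) b) g].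

Definition ell2 (a : nat -> C) : Prop := cvgn (series (fun n => sqmod (a n))).

(* The condition \sum_n |a_n|^2 |lam_n - eta|^{2s} < oo.  For s > 0 these are
   the coefficients of the elements of TH^s; those for - s represent the
   elements of the dual TH^{-s}. *)
Definition TH_coef (eta : R) (lam : nat -> R) (s : R) (a : nat -> C) : Prop :=
  ell2 (fun n => a n * (`|lam n - eta| `^ s)%:C).

(* [TH_acts ... s c g z]: g = \sum_n d_n u_n^Gamma belongs to TH^s, and the
   functional represented by c takes the value z = \sum_n c_n d_n at g. *)
Definition TH_acts Om (eta : R) (lam : nat -> R) (u : nat -> vfield) (s : R)
    (c : nat -> C) (g : vfield) (z : C) : Prop :=
  exists d : nat -> C,
  [/\ TH_coef eta lam s d,
      L2v_cvg hausdorff2 (bdry Om) (psum d (uGamma Om eta lam u)) g &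
      sqmod (\sum_(n < N) c n * d n - z) @[N --> \oo] --> (0 : R)].

(* <v, phi>^0_{alpha, theta} = - <F, conj phi> for all phi in X_T, where F is
   represented by c: [TH_acts] includes that the trace of conj phi lies in TH^{1/2}. *)
Definition is_solution Om (alpha theta eta : R) (lam : nat -> R)
    (u : nat -> vfield) (c : nat -> C) (v : vfield) : Prop :=
  XT Om v /\
  forall phi, XT Om phi ->
    TH_acts Om eta lam u 2^-1 c (trace Om (conjf phi))
      (- sform Om alpha theta 0 v phi).

End defs.

(* Main.v *)
(* Write g_n = eta - lambda_n > 0 and d_n(psi) for the n-th coefficient of the trace of
   psi in X_T on the orthonormal basis u_n^Gamma.  Since pi_T u_n is the trace of u_n, one
   has d_n(psi) = sqrt g_n \int_Gamma psi . conj u_n, and the eigenvalue equation gives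
   <psi, u_n>^eta = sqrt g_n d_n(psi) and vol (conj u_n, psi) = - lambda_n / sqrt g_n d_n(psi),
   where vol is the form with eta = 0.  The first identity and Bessel's inequality for
   <., .>^eta put the trace of psi in TH^{1/2}.  The coefficients
   b_n = sqrt g_n / lambda_n c_n are square summable because g_n / lambda_n is bounded, so
   that \sum_n b_n conj u_n is Cauchy for <., .>^eta, and converges to some v in X_T
   because X_T is complete.  The second identity gives vol (v, psi) = - \sum_n c_n d_n(psi).
   If w is another solution, vol (w - v, .) = 0, and w - v would be an eigenfunction for
   the eigenvalue 0 unless it vanishes.

   The surface integrals require the boundary to have finite Hausdorff measure and a Borel
   outer normal, which is read off in local charts; both traces and weak derivatives are
   unique by the fundamental lemma of the calculus of variations.  That every field in
   X_T has a trace does not need the embedding of X_T in H^1: it follows from the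
   existence of the eigenfunction u_0 with lambda_0 <> 0. *)
Require Import Defs.
From mathcomp Require Import all_boot all_order all_algebra.
From mathcomp Require Import all_classical all_reals all_analysis.
From mathcomp Require Import complex.
From HB Require Import structures.
From mathcomp Require Import measurable_realfun ring lra.
Import Order.TTheory GRing.Theory Num.Theory.
Import numFieldNormedType.Exports.
Local Open Scope classical_set_scope.
Local Open Scope ring_scope.
Local Open Scope complex_scope.

Set Implicit Arguments.
Unset Strict Implicit.
Unset Printing Implicit Defensive.

(** * Complex-valued integrals and L^2 *)

(** The proof draws on the completeness of two systems. That of [uGamma] in [TL2] turns the inner
    products of a trace with [uGamma n] into the expansion that [TH_acts] asks for. That of the list
    of eigenvalues turns [lam n <> 0] into uniqueness. For <psi, u_n>^eta one has Bessel's
    inequality and not Parseval's identity, because psi may have a component in H^1_0; the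
    inequality already bounds the series that defines TH^{1/2}.

    A technical obstacle shapes the development. [curl], [div] and [trace] select one
    representative, with default value 0, so they are linear and compatible with conjugation only
    almost everywhere, and only through uniqueness. Uniqueness of traces is what brings in the
    geometry of the boundary. The integrals [rint] and [cint] are finite parts, so that
    integrability has to accompany each algebraic step; on a bounded set of finite measure it
    follows from square integrability. *)

Section Integral.
Variables (R : realType) (mu : {measure set (pt R) -> \bar R}) (D : set (pt R)).
Hypothesis mD : measurable D.
Local Notation C := R[i].
Implicit Types (h : pt R -> R) (f g : pt R -> C).

Definition intg (h : pt R -> R) : Prop := mu.-integrable D (EFin \o h).

Lemma intg_meas h : intg h -> measurable_fun D h.
Proof. by move/measurable_int/measurable_EFinP. Qed.

Lemma intgD h1 h2 : intg h1 -> intg h2 -> intg (fun x => h1 x + h2 x).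
Proof. by move=> i1 i2; exact: (integrableD mD i1 i2). Qed.

Lemma intgZ (a : R) h : intg h -> intg (fun x => a * h x).
Proof. by move=> i1; exact: (integrableZl mD a i1). Qed.

Lemma intgB h1 h2 : intg h1 -> intg h2 -> intg (fun x => h1 x - h2 x).
Proof. by move=> i1 i2; exact: (integrableB mD i1 i2). Qed.

Lemma intg0 : intg (fun=> 0).
Proof. exact: integrable0. Qed.

Lemma intg_sum (I : Type) (s : seq I) (P : pred I) (h : I -> pt R -> R) :
  (forall i, P i -> intg (h i)) -> intg (fun x => \sum_(i <- s | P i) h i x).
Proof.
move=> ih; elim: s => [|i s ihs].
  by rewrite (_ : (fun _ => _) = fun=> 0);
    [exact: intg0 | apply/funext => x; rewrite big_nil].
case Pi : (P i).
- rewrite (_ : (fun _ => _) = fun x => h i x + \sum_(i <- s | P i) h i x).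
    by apply: intgD => //; apply: ih.
  by apply/funext => x; rewrite big_cons Pi.
- rewrite (_ : (fun _ => _) = fun x => \sum_(i <- s | P i) h i x) //.
  by apply/funext => x; rewrite big_cons Pi.
Qed.

Lemma intg_le h1 h2 : measurable_fun D h1 ->
  (forall x, D x -> `|h1 x| <= h2 x) -> intg h2 -> intg h1.
Proof.
move=> m1 le12; apply: le_integrable => //; first exact/measurable_EFinP.
move=> x Dx /=; rewrite lee_fin; apply: (le_trans (le12 x Dx)).
exact: ler_norm.
Qed.

Lemma rintE h : intg h -> (rint mu D h)%:E = (\int[mu]_(x in D) (h x)%:E)%E.
Proof. by move=> ih; rewrite /rint fineK//; exact: integrable_fin_num. Qed.

Lemma rintD h1 h2 : intg h1 -> intg h2 ->
  rint mu D (fun x => h1 x + h2 x) = rint mu D h1 + rint mu D h2.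
Proof. by move=> i1 i2; exact: (RintegralD mD i1 i2). Qed.

Lemma rintB h1 h2 : intg h1 -> intg h2 ->
  rint mu D (fun x => h1 x - h2 x) = rint mu D h1 - rint mu D h2.
Proof. by move=> i1 i2; exact: (RintegralB mD i1 i2). Qed.

Lemma rintZ (a : R) h : intg h -> rint mu D (fun x => a * h x) = a * rint mu D h.
Proof. by move=> i1; exact: (RintegralZl a mD i1). Qed.

Lemma rint0 : rint mu D (fun=> 0) = 0.
Proof. by rewrite /rint integral0. Qed.

Lemma rintN h : intg h -> rint mu D (fun x => - h x) = - rint mu D h.
Proof.
move=> ih; rewrite -mulN1r -rintZ//; congr (rint _ _ _).
by apply/funext => x; rewrite mulN1r.
Qed.

Lemma rint_ge0 h : (forall x, D x -> 0 <= h x) -> 0 <= rint mu D h.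
Proof. by move=> h0; rewrite fine_ge0// integral_ge0. Qed.

Lemma rint_sum (I : Type) (s : seq I) (P : pred I) (h : I -> pt R -> R) :
  (forall i, P i -> intg (h i)) ->
  rint mu D (fun x => \sum_(i <- s | P i) h i x) =
  \sum_(i <- s | P i) rint mu D (h i).
Proof.
move=> ih; elim: s => [|i s ihs].
  by rewrite big_nil -[RHS]rint0; congr (rint _ _ _); apply/funext => x;
    rewrite big_nil.
rewrite big_cons; case Pi : (P i).
- rewrite -ihs -rintD//; [|exact: ih|exact: intg_sum].
  by congr (rint _ _ _); apply/funext => x; rewrite big_cons Pi.
- by rewrite -ihs; congr (rint _ _ _); apply/funext => x; rewrite big_cons Pi.
Qed.

Lemma ae_rint h1 h2 : measurable_fun D h1 -> measurable_fun D h2 ->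
  {ae mu, forall x, D x -> h1 x = h2 x} -> rint mu D h1 = rint mu D h2.
Proof.
move=> m1 m2 e; rewrite /rint; congr fine; apply: ae_eq_integral => //;
  try exact/measurable_EFinP.
by apply: filterS e => x /[swap] Dx ->.
Qed.

Definition cmeas f := measurable_fun D (fun x => complex.Re (f x)) /\
  measurable_fun D (fun x => complex.Im (f x)).
Definition cintg f := intg (fun x => complex.Re (f x)) /\
  intg (fun x => complex.Im (f x)).

Lemma cintg_meas f : cintg f -> cmeas f.
Proof. by move=> [/intg_meas ? /intg_meas ?]. Qed.

Lemma ReD (a b : C) : complex.Re (a + b) = complex.Re a + complex.Re b.
Proof. by case: a b => [? ?] [? ?]. Qed.
Lemma ImD (a b : C) : complex.Im (a + b) = complex.Im a + complex.Im b.
Proof. by case: a b => [? ?] [? ?]. Qed.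
Lemma ReN (a : C) : complex.Re (- a) = - complex.Re a.
Proof. by case: a. Qed.
Lemma ImN (a : C) : complex.Im (- a) = - complex.Im a.
Proof. by case: a. Qed.
Lemma ReM (a b : C) : complex.Re (a * b) =
  complex.Re a * complex.Re b - complex.Im a * complex.Im b.
Proof. by case: a b => [? ?] [? ?]. Qed.
Lemma ImM (a b : C) : complex.Im (a * b) =
  complex.Re a * complex.Im b + complex.Im a * complex.Re b.
Proof. by case: a b => [? ?] [? ?]. Qed.
Lemma Re_conj (a : C) : complex.Re (conjc a) = complex.Re a.
Proof. by case: a. Qed.
Lemma Im_conj (a : C) : complex.Im (conjc a) = - complex.Im a.
Proof. by case: a. Qed.
Definition ReImE := (ReD, ImD, ReN, ImN, ReM, ImM, Re_conj, Im_conj).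

Lemma eqC (a b : C) : complex.Re a = complex.Re b ->
  complex.Im a = complex.Im b -> a = b.
Proof. by case: a b => [? ?] [? ?] /= -> ->. Qed.

Lemma cmeasD f g : cmeas f -> cmeas g -> cmeas (fun x => f x + g x).
Proof.
move=> [f1 f2] [g1 g2]; split.
- by under eq_fun do rewrite ReD; exact: measurable_funD.
- by under eq_fun do rewrite ImD; exact: measurable_funD.
Qed.

Lemma cmeasM f g : cmeas f -> cmeas g -> cmeas (fun x => f x * g x).
Proof.
move=> [f1 f2] [g1 g2]; split.
- by under eq_fun do rewrite ReM; apply: measurable_funB; exact: measurable_funM.
- by under eq_fun do rewrite ImM; apply: measurable_funD; exact: measurable_funM.
Qed.

Lemma cmeas_cst (a : C) : cmeas (fun=> a).
Proof. by split; exact: measurable_cst. Qed.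

Lemma cmeasN f : cmeas f -> cmeas (fun x => - f x).
Proof.
move=> mf; rewrite (_ : (fun _ => _) = fun x => -1 * f x).
  by apply: cmeasM => //; exact: cmeas_cst.
by apply/funext => x; rewrite mulN1r.
Qed.

Lemma cmeas_conj f : cmeas f -> cmeas (fun x => conjc (f x)).
Proof.
move=> [f1 f2]; split.
- by under eq_fun do rewrite Re_conj.
- by under eq_fun do rewrite Im_conj; exact: measurableT_comp.
Qed.

Lemma cintgD f g : cintg f -> cintg g -> cintg (fun x => f x + g x).
Proof.
move=> [f1 f2] [g1 g2]; split.
- by under eq_fun do rewrite ReD; exact: intgD.
- by under eq_fun do rewrite ImD; exact: intgD.
Qed.

Lemma cintgZ (a : C) f : cintg f -> cintg (fun x => a * f x).
Proof.
move=> [f1 f2]; split.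
- by under eq_fun do rewrite ReM; apply: intgB; exact: intgZ.
- by under eq_fun do rewrite ImM; apply: intgD; exact: intgZ.
Qed.

Lemma cintgN f : cintg f -> cintg (fun x => - f x).
Proof.
by move=> /(cintgZ (-1)); rewrite (_ : (fun x => -1 * f x) = fun x => - f x)//;
  apply/funext => x; rewrite mulN1r.
Qed.

Lemma cintg0 : cintg (fun=> 0).
Proof. by split; exact: intg0. Qed.

Lemma cintg_sum (I : Type) (s : seq I) (P : pred I) (h : I -> pt R -> C) :
  (forall i, P i -> cintg (h i)) -> cintg (fun x => \sum_(i <- s | P i) h i x).
Proof.
move=> ih; elim: s => [|i s ihs].
  by rewrite (_ : (fun _ => _) = fun=> 0);
    [exact: cintg0 | apply/funext => x; rewrite big_nil].
case Pi : (P i).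
- rewrite (_ : (fun _ => _) = fun x => h i x + \sum_(i <- s | P i) h i x).
    by apply: cintgD => //; apply: ih.
  by apply/funext => x; rewrite big_cons Pi.
- rewrite (_ : (fun _ => _) = fun x => \sum_(i <- s | P i) h i x) //.
  by apply/funext => x; rewrite big_cons Pi.
Qed.

Lemma cintD f g : cintg f -> cintg g ->
  cint mu D (fun x => f x + g x) = cint mu D f + cint mu D g.
Proof.
move=> [f1 f2] [g1 g2]; apply: eqC; rewrite !ReImE /= -rintD//;
  by congr (rint _ _ _); apply/funext => x; rewrite !ReImE.
Qed.

Lemma cintZ (a : C) f : cintg f ->
  cint mu D (fun x => a * f x) = a * cint mu D f.
Proof.
move=> [f1 f2]; apply: eqC; rewrite !ReImE /= -!rintZ// -?rintD -?rintB//;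
  try exact: intgZ; by congr (rint _ _ _); apply/funext => x; rewrite !ReImE.
Qed.

Lemma cint0 : cint mu D (fun=> 0) = 0.
Proof. by apply: eqC; rewrite /= rint0. Qed.

Lemma cintN f : cintg f -> cint mu D (fun x => - f x) = - cint mu D f.
Proof.
move=> fi; rewrite -mulN1r -cintZ//; congr (cint _ _ _).
by apply/funext => x; rewrite mulN1r.
Qed.

Lemma cintB f g : cintg f -> cintg g ->
  cint mu D (fun x => f x - g x) = cint mu D f - cint mu D g.
Proof. by move=> fi gi; rewrite cintD//; [rewrite cintN|exact: cintgN]. Qed.

Lemma cint_conj f : cintg f ->
  cint mu D (fun x => conjc (f x)) = conjc (cint mu D f).
Proof.
move=> [f1 f2]; apply: eqC; rewrite !ReImE /= -?rintN//;
  by congr (rint _ _ _); apply/funext => x; rewrite !ReImE.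
Qed.

Lemma cint_sum (I : Type) (s : seq I) (P : pred I) (h : I -> pt R -> C) :
  (forall i, P i -> cintg (h i)) ->
  cint mu D (fun x => \sum_(i <- s | P i) h i x) =
  \sum_(i <- s | P i) cint mu D (h i).
Proof.
move=> ih; elim: s => [|i s ihs].
  by rewrite big_nil -[RHS]cint0; congr (cint _ _ _); apply/funext => x;
    rewrite big_nil.
rewrite big_cons; case Pi : (P i).
- rewrite -ihs -cintD//; [|exact: ih|exact: cintg_sum].
  by congr (cint _ _ _); apply/funext => x; rewrite big_cons Pi.
- by rewrite -ihs; congr (cint _ _ _); apply/funext => x; rewrite big_cons Pi.
Qed.

Lemma ae_cint f g : cmeas f -> cmeas g ->
  {ae mu, forall x, D x -> f x = g x} -> cint mu D f = cint mu D g.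
Proof.
move=> [f1 f2] [g1 g2] e; congr (_ +i* _); apply: ae_rint => //;
  by apply: filterS e => x /[swap] Dx ->.
Qed.

Lemma sqmod_ge0 (z : C) : 0 <= sqmod z.
Proof. by rewrite addr_ge0 ?sqr_ge0. Qed.

Lemma sqmodM (a b : C) : sqmod (a * b) = sqmod a * sqmod b.
Proof. by rewrite /sqmod !ReImE; ring. Qed.

Lemma sqmodN (a : C) : sqmod (- a) = sqmod a.
Proof. by rewrite /sqmod !ReImE !sqrrN. Qed.

Lemma sqmod_conj (a : C) : sqmod (conjc a) = sqmod a.
Proof. by rewrite /sqmod !ReImE !sqrrN. Qed.

Lemma sqmodD_le (a b : C) : sqmod (a + b) <= 2 * (sqmod a + sqmod b).
Proof.
case: a b => [a b] [c d]; rewrite /sqmod /=.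
have := sqr_ge0 (a - c); have := sqr_ge0 (b - d); nra.
Qed.

Lemma measurable_sqmod f : cmeas f -> measurable_fun D (fun x => sqmod (f x)).
Proof.
move=> [f1 f2]; apply: measurable_funD;
  apply: (@measurable_comp _ _ _ _ _ _ setT (fun y : R => y ^+ 2)) => //;
  exact: exprn_measurable.
Qed.

Lemma L2P f : L2 mu D f <-> cmeas f /\ intg (fun x => sqmod (f x)).
Proof. by split=> [[]|[[]]]. Qed.

Lemma L2_meas f : L2 mu D f -> cmeas f. Proof. by case. Qed.
Lemma L2_sq f : L2 mu D f -> intg (fun x => sqmod (f x)). Proof. by case. Qed.

Lemma L2D f g : L2 mu D f -> L2 mu D g -> L2 mu D (fun x => f x + g x).
Proof.
move=> /L2P[mf fi] /L2P[mg gi]; apply/L2P; split; first exact: cmeasD.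
apply: (@intg_le _ (fun x => 2 * (sqmod (f x) + sqmod (g x)))).
- by apply: measurable_sqmod; exact: cmeasD.
- by move=> x _; rewrite ger0_norm ?sqmod_ge0// sqmodD_le.
- by apply: intgZ; exact: intgD.
Qed.

Lemma L2Z (a : C) f : L2 mu D f -> L2 mu D (fun x => a * f x).
Proof.
move=> /L2P[mf fi]; apply/L2P; split; first exact: (cmeasM (cmeas_cst a)).
by under eq_fun do rewrite sqmodM; exact: intgZ.
Qed.

Lemma L2N f : L2 mu D f -> L2 mu D (fun x => - f x).
Proof.
by move=> /(L2Z (-1)); rewrite (_ : (fun x => -1 * f x) = fun x => - f x)//;
  apply/funext => x; rewrite mulN1r.
Qed.

Lemma L2B f g : L2 mu D f -> L2 mu D g -> L2 mu D (fun x => f x - g x).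
Proof. by move=> fi /L2N; exact: L2D. Qed.

Lemma L2_conj f : L2 mu D f -> L2 mu D (fun x => conjc (f x)).
Proof.
move=> /L2P[mf fi]; apply/L2P; split; first exact: cmeas_conj.
by under eq_fun do rewrite sqmod_conj.
Qed.

(** The real and imaginary parts of [f g] are both dominated by [|f|^2 + |g|^2]; each inequality is
    a sum of two squares. *)
Lemma L2_mul f g : L2 mu D f -> L2 mu D g -> cintg (fun x => f x * g x).
Proof.
move=> /L2P[mf fi] /L2P[mg gi]; have [m1 m2] := cmeasM mf mg.
split; apply: (intg_le _ _ (intgD fi gi)) => // x _.
- rewrite ReM /sqmod; move: (f x) (g x) => [a b] [c d] /=.
  rewrite ler_norml; apply/andP; split.
  + have := sqr_ge0 (a + c); have := sqr_ge0 (b - d); nra.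
  + have := sqr_ge0 (a - c); have := sqr_ge0 (b + d); nra.
- rewrite ImM /sqmod; move: (f x) (g x) => [a b] [c d] /=.
  rewrite ler_norml; apply/andP; split.
  + have := sqr_ge0 (a + d); have := sqr_ge0 (b + c); nra.
  + have := sqr_ge0 (a - d); have := sqr_ge0 (b - c); nra.
Qed.

(* The nonnegativity of [\int |f - t g^*|^2] for a suitable complex [t]. *)
Lemma cauchy_schwarz f g : L2 mu D f -> L2 mu D g ->
  sqmod (cint mu D (fun x => f x * g x)) <=
  rint mu D (fun x => sqmod (f x)) * rint mu D (fun x => sqmod (g x)).
Proof.
move=> Lf Lg; set z := cint _ _ _; set F := rint _ _ _; set G := rint _ _ _.
have key (t : C) : 0 <= F - 2 * complex.Re (conjc t * z) + sqmod t * G.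
  have Lh : L2 mu D (fun x => f x - t * conjc (g x)).
    by apply: L2B => //; apply: L2Z; exact: L2_conj.
  have : 0 <= rint mu D (fun x => sqmod (f x - t * conjc (g x))).
    by apply: rint_ge0 => x _; exact: sqmod_ge0.
  have i1 := L2_mul Lf Lg.
  have [i2 i3] := cintgZ (conjc t) i1.
  have -> : (fun x => sqmod (f x - t * conjc (g x))) = fun x =>
      (sqmod (f x) - 2 * complex.Re (conjc t * (f x * g x))) +
      sqmod t * sqmod (g x).
    by apply/funext => x; rewrite /sqmod !ReImE; ring.
  rewrite rintD; first last.
  - by apply: intgZ; exact: L2_sq.
  - by apply: intgB; [exact: L2_sq|exact: intgZ].
  rewrite rintB; [|exact: L2_sq|exact: intgZ].
  rewrite (rintZ 2 i2) (rintZ (sqmod t) (L2_sq Lg)).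
  by rewrite -/F -/G -[z in conjc t * z]/z -(cintZ (conjc t) i1).
have F0 : 0 <= F by apply: rint_ge0 => x _; exact: sqmod_ge0.
have G0 : 0 <= G by apply: rint_ge0 => x _; exact: sqmod_ge0.
have Rez (s : R) : complex.Re (conjc (s%:C * z) * z) = s * sqmod z.
  by rewrite /sqmod !ReImE /=; ring.
have sqz (s : R) : sqmod (s%:C * z) = s ^+ 2 * sqmod z.
  by rewrite sqmodM /sqmod /= expr0n addr0.
have Z0 := sqmod_ge0 z.
have [G00|Gn0] := eqVneq G 0.
  have [->|zn0] := eqVneq (sqmod z) 0; first by rewrite mulr_ge0.
  (* With [G = 0] the quadratic in [t] is affine; this value of [t] gives [0 <= F - 2 (F + 1)],
     which is absurd. *)
  have := key (((F + 1) / sqmod z)%:C * z).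
  rewrite Rez sqz G00 mulr0 addr0 mulfVK//; lra.
(* The minimum of the quadratic is at [t = z / G], with value [F - |z|^2 / G]. *)
have := key ((G^-1)%:C * z); rewrite Rez sqz.
rewrite (_ : _ + _ = F - G^-1 * sqmod z); last by field.
rewrite subr_ge0 mulrC ler_pdivrMr ?lt_def ?Gn0//.
Qed.

End Integral.

(** * Completeness of L^2 (Riesz-Fischer) *)

Section RieszFischer.
Variable R : realType.

Lemma cvg_geometric_increments (v : nat -> R) (M : R) :
  (forall k, `|v k.+1 - v k| <= M * (2^-1) ^+ k) -> cvgn v.
Proof.
move=> vM.
have cs : cvgn (series (fun k => v k.+1 - v k)).
  apply: normed_cvg; apply: (@series_le_cvg _ _ (geometric M 2^-1)) => //.
  - by move=> n; exact: normr_ge0.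
  - by move=> n; exact: le_trans (vM n).
  - by apply: is_cvg_geometric_series; rewrite ger0_norm ?invr_ge0// invf_lt1 ?ltr1n.
rewrite (_ : v = fun n => v 0%N + series (fun k => v k.+1 - v k) n).
  by apply: is_cvgD => //; exact: is_cvg_cst.
by apply/funext => n; rewrite /series /= telescope_sumr// addrC subrK.
Qed.

Lemma cvg_sqmodB (z b : R[i]) (a : nat -> R[i]) :
  complex.Re (a k) @[k --> \oo] --> complex.Re b ->
  complex.Im (a k) @[k --> \oo] --> complex.Im b ->
  sqmod (z - a k) @[k --> \oo] --> sqmod (z - b).
Proof.
move=> c1 c2; rewrite /sqmod !ReImE.
under eq_fun do rewrite !ReImE.
by apply: cvgD; rewrite expr2; under eq_fun do rewrite expr2;
  apply: cvgM; (apply: cvgB; first exact: cvg_cst).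
Qed.

Variables (mu : {measure set (pt R) -> \bar R}) (D : set (pt R)).
Hypothesis mD : measurable D.
Local Notation C := R[i].
Local Notation I f := (rint mu D (fun x => sqmod (f x))).

Lemma integral_sqmodE (f : pt R -> C) : L2 mu D f ->
  (\int[mu]_(x in D) (sqmod (f x))%:E)%E = (I f)%:E.
Proof. by move=> Lf; rewrite rintE//; exact: L2_sq. Qed.

(* Increments of square norm at most [8^-k] make [\sum_k 4^k |h_(k+1) - h_k|^2]
   finite a.e., hence [h_k] convergent a.e. *)
Lemma fast_cauchy_cvg (h : nat -> pt R -> C) :
  (forall k, L2 mu D (h k)) ->
  (forall k, I (fun x => h k.+1 x - h k x) <= (8^-1) ^+ k) ->
  exists E : set (pt R), [/\ measurable E, E `<=` D,
    mu.-negligible (D `\` E) &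
    forall x, E x -> cvgn (fun k => complex.Re (h k x)) /\
                     cvgn (fun k => complex.Im (h k x))].
Proof.
move=> Lh hI.
have Ld k : L2 mu D (fun x => h k.+1 x - h k x) by exact: L2B.
pose w k x := (4 ^+ k * sqmod (h k.+1 x - h k x))%:E.
have w0 k x : (0 <= w k x)%E by rewrite lee_fin mulr_ge0 ?exprn_ge0 ?sqmod_ge0.
have mw k : measurable_fun D (w k).
  apply/measurable_EFinP; apply: measurable_funM => //.
  by apply: measurable_sqmod => //; exact: (L2_meas (Ld k)).
pose W x := (\sum_(0 <= k <oo) w k x)%E.
have mW : measurable_fun D W.
  by apply: (ge0_emeasurable_sum (P := xpredT)).
have intW : (\int[mu]_(x in D) W x <= 2%:E)%E.
  rewrite integral_nneseries//.
  apply: lime_le; first by apply: is_cvg_nneseries => n _ _; exact: integral_ge0.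
  apply: nearW => n.
  apply: (@le_trans _ _ (\sum_(0 <= k < n) ((2^-1) ^+ k)%:E)%E).
    apply: lee_sum => k _; rewrite /w.
    have -> : (\int[mu]_(x in D) (4 ^+ k * sqmod (h k.+1 x - h k x))%:E)%E =
        (4 ^+ k * I (fun x => h k.+1 x - h k x))%:E.
      rewrite -(rintZ mD (4 ^+ k) (L2_sq (Ld k))) rintE//.
      by apply: intgZ => //; exact: L2_sq.
    rewrite lee_fin; apply: (@le_trans _ _ (4 ^+ k * (8^-1) ^+ k)).
      by rewrite ler_wpM2l ?exprn_ge0.
    by rewrite -exprMn; apply: lerXn2r; rewrite ?nnegrE; lra.
  rewrite sumEFin lee_fin.
  have -> : \sum_(0 <= k < n) (2^-1 : R) ^+ k = 2 - 2 * (2^-1) ^+ n.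
    elim: n => [|n IH]; first by rewrite big_geq// expr0; lra.
    by rewrite big_nat_recr//= IH exprS; field.
  by rewrite gerBl mulr_ge0 ?exprn_ge0 ?invr_ge0.
have iW : mu.-integrable D W.
  apply/integrableP; split => //.
  rewrite (eq_integral W); last first.
    by move=> x _; rewrite gee0_abs// nneseries_ge0.
  exact: le_lt_trans intW (ltry _).
exists (D `&` [set x | W x \is a fin_num]); split.
- exact: emeasurable_fin_num.
- by move=> x [].
- have := integrable_ae mD iW.
  apply: negligibleS => x /= [Dx nE] /(_ Dx) Wfin; exact: nE.
- move=> x [Dx /= Wx].
  have wle k : (w k x <= W x)%E.
    have := @nneseries_lim_ge R (w ^~ x) xpredT 0%N k.+1 (fun n _ _ => w0 n x).
    apply: le_trans; rewrite big_nat_recr//= leeDr//.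
    by rewrite sume_ge0.
  (* The summand 1 ensures [Mx <= Mx ^ 2]: the bound by [W x] becomes a bound by a square, of which
     the root can be taken. *)
  pose Mx := 1 + fine (W x).
  have M1 : 1 <= Mx.
    by rewrite lerDl fine_ge0// (le_trans (w0 0%N x)).
  have bnd k : sqmod (h k.+1 x - h k x) <= (Mx * (2^-1) ^+ k) ^+ 2.
    have : 4 ^+ k * sqmod (h k.+1 x - h k x) <= Mx ^+ 2.
      have := wle k; rewrite -(fineK Wx) lee_fin => /le_trans; apply.
      apply: (@le_trans _ _ Mx); first by rewrite lerDr.
      by rewrite expr2 ler_peMl// (le_trans ler01).
    have p4 : 0 < 4 ^+ k :> R by rewrite exprn_gt0.
    rewrite exprMn -exprM mulnC exprM mulrC -ler_pdivlMr// => /le_trans; apply.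
    rewrite -exprVn (_ : 2^-1 ^+ 2 = 4^-1 :> R)//.
    by rewrite expr2 -invfM -natrM.
  have sq (a b : R) : 0 <= b -> a ^+ 2 <= b ^+ 2 -> `|a| <= b.
    by move=> b0; rewrite -(real_normK (num_real a)) ler_sqr ?nnegrE.
  have Mk k : 0 <= Mx * (2^-1) ^+ k.
    by rewrite mulr_ge0 ?exprn_ge0 ?invr_ge0// (le_trans ler01).
  split; apply: (@cvg_geometric_increments _ Mx) => k; apply: sq => //;
    apply: le_trans (bnd k); rewrite /sqmod !ReImE ?lerDl ?lerDr ?sqr_ge0//.
Qed.

(** A subsequence with fast decreasing increments converges almost everywhere, and Fatou's lemma
    bounds the distance from each late [f m] to its limit. *)
Lemma L2_complete (f : nat -> pt R -> C) :
  (forall n, L2 mu D (f n)) ->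
  (forall e, 0 < e -> exists N, forall m n, (N <= m)%N -> (N <= n)%N ->
     I (fun x => f m x - f n x) <= e) ->
  exists2 g, L2 mu D g & I (fun x => f n x - g x) @[n --> \oo] --> (0 : R).
Proof.
move=> Lf cauchy.
have /choice[N NP] k : exists N, forall m n, (N <= m)%N -> (N <= n)%N ->
    I (fun x => f m x - f n x) <= (8^-1) ^+ k.
  by apply: cauchy; rewrite exprn_gt0 ?invr_gt0.
(* Adding up the thresholds makes the extracted indices monotone and keeps [n_ k] above [N k]. *)
pose n_ k := (\sum_(i < k.+1) N i)%N.
have Nn k : (N k <= n_ k)%N by rewrite /n_ big_ord_recr/= leq_addl.
have n_S k : (n_ k <= n_ k.+1)%N by rewrite /n_ [in leqRHS]big_ord_recr leq_addr.
have nd i j : (i <= j)%N -> (n_ i <= n_ j)%N.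
  by elim: j => [|j IH]; rewrite leq_eqVlt => /orP[/eqP->//|] //; rewrite ltnS;
    move=> /IH /leq_trans; apply.
pose h k := f (n_ k).
have Lh k : L2 mu D (h k) by exact: Lf.
have [k|E [mE ED nE Ecvg]] := fast_cauchy_cvg Lh.
  by apply: NP; [exact: leq_trans (n_S k)|].
(* Cut off outside [E], the sequence converges at every point of [D], so that its limit is
   measurable. *)
pose h' k x : C := (\1_E x)%:C * h k x.
have mh' k : cmeas D (h' k).
  apply: cmeasM => //; last exact: L2_meas.
  split => /=; first exact: measurable_indic.
  exact: measurable_cst.
pose g x : C := limn (fun k => complex.Re (h' k x)) +i*
                limn (fun k => complex.Im (h' k x)).
have cvgh x : D x -> complex.Re (h' k x) @[k --> \oo] --> complex.Re (g x) /\
    complex.Im (h' k x) @[k --> \oo] --> complex.Im (g x).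
  move=> Dx; rewrite /g /=.
  suff : cvgn (fun k => complex.Re (h' k x)) /\ cvgn (fun k => complex.Im (h' k x)).
    by move=> [].
  rewrite /h' indicE; have [/[!inE] Ex|_] := boolP (x \in E).
    have [c1 c2] := Ecvg x Ex; split.
    - by under eq_fun do rewrite mul1r.
    - by under eq_fun do rewrite mul1r.
  by split; under eq_fun do rewrite mul0r; exact: is_cvg_cst.
have mg : cmeas D g.
  split.
  - apply: (measurable_fun_cvg (h := fun k x => complex.Re (h' k x))).
      by move=> m; have [] := mh' m.
    by move=> x /cvgh[].
  - apply: (measurable_fun_cvg (h := fun k x => complex.Im (h' k x))).
      by move=> m; have [] := mh' m.
    by move=> x /cvgh[].
have hh' k : {ae mu, forall x, D x -> h' k x = h k x}.
  apply: negligibleS nE => x /= /not_implyP[Dx ne]; split => // Ex; apply: ne.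
  by rewrite /h' indicE mem_set// mul1r.
(* The integral is kept in the extended reals: [f m - g] is not yet known to be square integrable,
   and this bound is what proves it. *)
have fatou_bound k m : (n_ k <= m)%N ->
    (\int[mu]_(x in D) (sqmod (f m x - g x))%:E <= ((8^-1) ^+ k)%:E)%E.
  move=> km; pose F j x := (sqmod (f m x - h' j x))%:E.
  have mF j : cmeas D (fun x => f m x - h' j x).
    by apply: cmeasD => //; [exact: L2_meas|exact: cmeasN].
  have mFj j : measurable_fun D (F j).
    by apply/measurable_EFinP; exact: measurable_sqmod.
  have Flim x : D x -> F ^~ x @ \oo --> (sqmod (f m x - g x))%:E.
    move=> Dx; have [c1 c2] := cvgh x Dx.
    apply: cvg_EFin; first by apply: nearW.
    exact: cvg_sqmodB.
  have -> : (\int[mu]_(x in D) (sqmod (f m x - g x))%:E =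
      \int[mu]_(x in D) limn_einf (F ^~ x))%E.
    by apply: eq_integral => x; rewrite inE => /Flim/cvg_limn_einf_sup[-> _].
  apply: le_trans (fatou mu mD mFj _) _.
    by move=> j x Dx; rewrite lee_fin sqmod_ge0.
  rewrite limn_einf_lim; apply: lime_le; first exact: is_cvg_einfs.
  exists k => // j /= kj; apply: le_trans.
    by apply: ereal_inf_lbound; exists j => /=.
  rewrite /F (_ : (\int[mu]_(x in D) _)%E = (I (fun x => f m x - h j x))%:E).
    rewrite lee_fin; apply: NP.
    - exact: leq_trans (Nn k) km.
    - exact: leq_trans (Nn k) (nd _ _ kj).
  rewrite -integral_sqmodE; last exact: L2B.
  apply: ge0_ae_eq_integral => //.
  - exact: mFj.
  - apply/measurable_EFinP; apply: measurable_sqmod => //.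
    by apply: L2_meas; apply: L2B.
  - by move=> x _; rewrite lee_fin sqmod_ge0.
  - by move=> x _; rewrite lee_fin sqmod_ge0.
  - by apply: filterS (hh' j) => x + Dx => /(_ Dx) ->.
have mfg m : cmeas D (fun x => f m x - g x).
  by apply: cmeasD => //; [exact: L2_meas|exact: cmeasN].
have Lfg k m : (n_ k <= m)%N -> L2 mu D (fun x => f m x - g x).
  move=> km; apply/L2P; split => //; apply/integrableP; split.
    by apply/measurable_EFinP; exact: measurable_sqmod.
  under eq_integral do rewrite /= ger0_norm ?sqmod_ge0//.
  exact: le_lt_trans (fatou_bound k m km) (ltry _).
have Lg : L2 mu D g.
  rewrite (_ : g = fun x => f (n_ 0%N) x - (f (n_ 0%N) x - g x)).
    by apply: L2B => //; exact: (Lfg 0%N).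
  by apply/funext => x; rewrite opprB addrC subrK.
exists g => //.
have bound k m : (n_ k <= m)%N -> I (fun x => f m x - g x) <= (8^-1) ^+ k.
  move=> km; rewrite -lee_fin -integral_sqmodE; last exact: (Lfg k).
  exact: fatou_bound.
apply/cvgrPdist_le => e e0.
have : (fun k => (8^-1 : R) ^+ k) @ \oo --> (0 : R).
  by apply: cvg_expr; rewrite ger0_norm ?invr_ge0// invf_lt1// ltr1n.
move=> /cvgrPdist_le/(_ e e0)[k _ /(_ k (leqnn k))/=].
rewrite sub0r normrN ger0_norm ?exprn_ge0 ?invr_ge0// => ke.
exists (n_ k) => // m /= km; rewrite sub0r normrN ger0_norm.
  exact: le_trans (bound k m km) ke.
by apply: rint_ge0 => x _; exact: sqmod_ge0.
Qed.

End RieszFischer.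

(** * Open sets and the fundamental lemma of the calculus of variations *)

Section Boxes.
Variable R : realType.
Implicit Types (a b x : pt R) (U : set (pt R)).

Definition box a b : set (pt R) := [set x |
  [/\ a.1.1 < x.1.1 < b.1.1, a.1.2 < x.1.2 < b.1.2 & a.2 < x.2 < b.2]].
Definition cbox a b : set (pt R) := [set x |
  [/\ a.1.1 <= x.1.1 <= b.1.1, a.1.2 <= x.1.2 <= b.1.2 & a.2 <= x.2 <= b.2]].

Lemma box_cbox a b : box a b `<=` cbox a b.
Proof.
by move=> x [/andP[? ?] /andP[? ?] /andP[? ?]]; split; apply/andP; split; exact: ltW.
Qed.

Lemma boxE a b : box a b = (`]a.1.1, b.1.1[ `*` `]a.1.2, b.1.2[) `*` `]a.2, b.2[.
Proof.
apply/seteqP; split=> [x [p1 p2 p3]|x /= [[]]]; last first.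
  by rewrite !in_itv.
by split => /=; [split|]; rewrite /= in_itv.
Qed.

Lemma cboxE a b : cbox a b = (`[a.1.1, b.1.1] `*` `[a.1.2, b.1.2]) `*` `[a.2, b.2].
Proof.
apply/seteqP; split=> [x [p1 p2 p3]|x /= [[]]]; last first.
  by rewrite !in_itv.
by split => /=; [split|]; rewrite /= in_itv.
Qed.

Lemma measurable_box a b : measurable (box a b).
Proof. by rewrite boxE; apply: measurableX => //; exact: measurableX. Qed.

Lemma compact_cbox a b : compact (cbox a b).
Proof.
rewrite cboxE; apply: compact_setX; last exact: segment_compact.
by apply: compact_setX; exact: segment_compact.
Qed.

Lemma boxI a b c d : box a b `&` box c d =
  box (Num.max a.1.1 c.1.1, Num.max a.1.2 c.1.2, Num.max a.2 c.2)
      (Num.min b.1.1 d.1.1, Num.min b.1.2 d.1.2, Num.min b.2 d.2).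
Proof.
apply/seteqP; split=> x /=; rewrite /box /= !gt_max !lt_min.
  move=> [[/andP[-> ->] /andP[-> ->] /andP[-> ->]]].
  by move=> [/andP[-> ->] /andP[-> ->] /andP[-> ->]].
move=> [/andP[/andP[-> ->] /andP[-> ->]] /andP[/andP[-> ->] /andP[-> ->]]].
by move=> /andP[/andP[-> ->] /andP[-> ->]].
Qed.

Definition rpt (q : rat * rat * rat) : pt R := (ratr q.1.1, ratr q.1.2, ratr q.2).

(** Rational corners keep the family of boxes countable; the inclusion of the closed box leaves room
    for a bump with compact support in [U]. *)
Lemma open_rat_box U x : open U -> U x ->
  exists q : (rat * rat * rat) * (rat * rat * rat),
    box (rpt q.1) (rpt q.2) x /\ cbox (rpt q.1) (rpt q.2) `<=` U.
Proof.
rewrite openE => oU /oU /nbhs_ballP[e /= e0 eU].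
have lr (y : R) : exists q : rat * rat, y - e < ratr q.1 < y /\ y < ratr q.2 < y + e.
  have /rat_in_itvoo[q1] : y - e < y by rewrite gtrBl.
  have /rat_in_itvoo[q2] : y < y + e by rewrite ltrDl.
  by rewrite !in_itv /= => h2 h1; exists (q1, q2).
have [[q1 r1] /= [/andP[? ?] /andP[? ?]]] := lr x.1.1.
have [[q2 r2] /= [/andP[? ?] /andP[? ?]]] := lr x.1.2.
have [[q3 r3] /= [/andP[? ?] /andP[? ?]]] := lr x.2.
exists ((q1, q2, q3), (r1, r2, r3)); split.
  by split; apply/andP; split.
move=> y [/= /andP[? ?] /andP[? ?] /andP[? ?]]; apply: eU.
by split; [split|]; rewrite /ball /= ltr_distl; apply/andP; split; lra.
Qed.

Lemma open_bigcup_box U : open U ->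
  U = \bigcup_(q in [set q : (rat * rat * rat) * (rat * rat * rat) |
                     cbox (rpt q.1) (rpt q.2) `<=` U]) box (rpt q.1) (rpt q.2).
Proof.
move=> oU; apply/seteqP; split => [x /(open_rat_box oU)[q [? ?]]|x [q qU]].
  by exists q.
by move=> /box_cbox; exact: qU.
Qed.

Lemma open_measurable3 U : open U -> measurable U.
Proof.
move=> /open_bigcup_box ->; rewrite bigcup_mkcond.
apply: countable_bigcupT_measurable => // q.
by case: ifP => // _; exact: measurable_box.
Qed.

Lemma closed_measurable3 U : closed U -> measurable U.
Proof.
by move=> /closed_openC/open_measurable3/measurableC; rewrite setCK.
Qed.

Lemma continuous_measurable3 (f : pt R -> R) : continuous f ->
  measurable_fun setT f.
Proof.
move=> /continuousP cf; apply: (measurability _ (RGenOpens.measurableE R)).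
move=> _ [_ [a [b ->] <-]]; rewrite setTI; apply: open_measurable3.
exact: (cf _ (interval_open _ _)).
Qed.

(** Boxes are stable under intersection, which permits Dynkin induction over Borel sets. A
    half-space [x_k > c] is a countable union of boxes, so the coordinates are measurable for the
    generated sigma-algebra. *)
Lemma measurable3E : @measurable _ (pt R) =
  <<s [set B : set (pt R) | exists a b, B = box a b] >>.
Proof.
apply/seteqP; split; last first.
  apply: smallest_sub; first exact: sigma_algebra_measurable.
  by move=> _ [a [b ->]]; exact: measurable_box.
set G := [set B | _].
have bigbox (P : nat -> set (pt R)) : (forall n, exists a b, P n = box a b) ->
    measurable (\bigcup_n (P n : set (g_sigma_algebraType G))).
  by move=> Pb; apply: bigcup_measurable => n _; apply: sub_sigma_algebra; exact: Pb.
have arch (x : pt R) : exists n : nat,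
    [/\ - n%:R < x.1.1 < n%:R, - n%:R < x.1.2 < n%:R & - n%:R < x.2 < n%:R].
  exists (Num.truncn (`|x.1.1| + `|x.1.2| + `|x.2|)).+1.
  have := Num.Theory.truncnS_gt (`|x.1.1| + `|x.1.2| + `|x.2|).
  set N := _%:R => hN.
  have ? := normr_ge0 x.1.1; have ? := normr_ge0 x.1.2; have ? := normr_ge0 x.2.
  by split; rewrite -ltr_norml; lra.
have m1 : measurable_fun setT (fun x : g_sigma_algebraType G => x.1.1 : R).
  apply: (measurability _ (RGenOInfty.measurableE R)) => _ [_ [c ->] <-].
  rewrite setTI (_ : _ @^-1` _ = \bigcup_n box (c, - n%:R, - n%:R) (n%:R, n%:R, n%:R)).
    by apply: bigbox => n; exists (c, - n%:R, - n%:R), (n%:R, n%:R, n%:R).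
  apply/seteqP; split => [x /=|x [n _] [/andP[cx _] _ _]] /=; rewrite in_itv/= andbT//.
  move=> cx; have [n [/andP[? ?] ? ?]] := arch x.
  by exists n => //; split => //=; apply/andP.
have m2 : measurable_fun setT (fun x : g_sigma_algebraType G => x.1.2 : R).
  apply: (measurability _ (RGenOInfty.measurableE R)) => _ [_ [c ->] <-].
  rewrite setTI (_ : _ @^-1` _ = \bigcup_n box (- n%:R, c, - n%:R) (n%:R, n%:R, n%:R)).
    by apply: bigbox => n; exists (- n%:R, c, - n%:R), (n%:R, n%:R, n%:R).
  apply/seteqP; split => [x /=|x [n _] [_ /andP[cx _] _]] /=; rewrite in_itv/= andbT//.
  move=> cx; have [n [? /andP[? ?] ?]] := arch x.
  by exists n => //; split => //=; apply/andP.
have m3 : measurable_fun setT (fun x : g_sigma_algebraType G => x.2 : R).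
  apply: (measurability _ (RGenOInfty.measurableE R)) => _ [_ [c ->] <-].
  rewrite setTI (_ : _ @^-1` _ = \bigcup_n box (- n%:R, - n%:R, c) (n%:R, n%:R, n%:R)).
    by apply: bigbox => n; exists (- n%:R, - n%:R, c), (n%:R, n%:R, n%:R).
  apply/seteqP; split => [x /=|x [n _] [_ _ /andP[cx _]]] /=; rewrite in_itv/= andbT//.
  move=> cx; have [n [? ? /andP[? ?]]] := arch x.
  by exists n => //; split => //=; apply/andP.
have mid : measurable_fun setT (fun x : g_sigma_algebraType G => (x : pt R)).
  apply/measurable_fun_pairP; split => //.
  by apply/measurable_fun_pairP; split.
by move=> A mA; have := mid measurableT A mA; rewrite setTI.
Qed.

End Boxes.

(** * Smooth functions flat at the origin *)

Section Smooth1D.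
Variable R : realType.
Implicit Types (P : {poly R}) (p q : R -> R).

(** The polynomial factor closes the family under differentiation: the derivative of
    [P(1/x) e^(-1/x)] has the same form with [X^2 (P - P')] in place of [P]. Smoothness of [flat 1]
    is then an induction over all [P]. *)
Definition flat P (x : R) : R := if 0 < x then P.[x^-1] * expR (- x^-1) else 0.

Lemma horner_le P : exists2 C : R, 0 <= C &
  forall y, 1 <= y -> `|P.[y]| <= C * y ^+ (size P).
Proof.
exists (\sum_(i < size P) `|P`_i|); first exact: sumr_ge0.
move=> y y1; rewrite horner_coef mulr_suml.
apply: le_trans (ler_norm_sum _ _ _) _; apply: ler_sum => i _.
rewrite normrM normrX ler_wpM2l// (ger0_norm (le_trans ler01 y1)).
by rewrite ler_weXn2l// ltnW.
Qed.

(** The quadratic bound makes the difference quotient at 0 vanish. It comes from [e^y >= y^m / m!]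
    at [y = 1/h], where [m] exceeds the size of [P] by 2. *)
Lemma flat_le P : exists2 C : R, 0 <= C &
  forall h, `|h| <= 1 -> `|flat P h| <= C * h ^+ 2.
Proof.
have [C C0 CP] := horner_le P; pose n := (size P).+1.
exists (C * (n.+1)`!%:R); first by rewrite mulr_ge0.
move=> h h1; rewrite /flat; case: ifPn => [h0|_]; last first.
  by rewrite normr0 mulr_ge0 ?sqr_ge0// mulr_ge0.
have hn0 : h != 0 by rewrite gt_eqF.
have hV1 : 1 <= h^-1 by rewrite invf_ge1// -(ger0_norm (ltW h0)).
rewrite normrM (ger0_norm (expR_ge0 _)) expRN.
have e1 : h^-1 ^+ n.+1 / (n.+1)`!%:R <= expR h^-1.
  apply: le_trans (expR_ge1Dxn n _); first by rewrite lerDr.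
  by rewrite invr_ge0 ltW.
have f0 : 0 < (n.+1)`!%:R :> R by rewrite ltr0n fact_gt0.
have e2 : (expR h^-1)^-1 <= (n.+1)`!%:R * h ^+ n.+1.
  rewrite -[leRHS]invrK lef_pV2 ?posrE ?expR_gt0//.
    by rewrite invfM mulrC -exprVn.
  by rewrite invr_gt0 mulr_gt0// exprn_gt0.
apply: (@le_trans _ _ (C * h^-1 ^+ size P * ((n.+1)`!%:R * h ^+ n.+1))).
  by apply: ler_pM; rewrite ?invr_ge0 ?expR_ge0//; exact: CP.
rewrite le_eqVlt; apply/orP; left; apply/eqP.
rewrite /n -[in h ^+ _]addn2 exprD exprVn.
have := expf_neq0 (size P) hn0; move: (h ^+ size P) => z zn0.
by field.
Qed.

Lemma is_derive_flat P (x : R) :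
  is_derive x 1 (flat P) (flat ('X^2 * (P - P^`())) x).
Proof.
have [x0|x0|<-] := ltgtP 0 x.
- have xn0 : x != 0 by rewrite gt_eqF.
  apply: (@near_eq_is_derive R R^o R^o (fun y => P.[y^-1] * expR (- y^-1))).
    near=> y; rewrite /flat ifT//; near: y; exact: lt_nbhsr.
  rewrite /flat x0.
  have dV : is_derive x 1 (fun y : R => y^-1) (- x ^- 2).
    have := @is_deriveV R id x 1 1 xn0 (is_derive_id _ _).
    by rewrite /GRing.scale /= mulr1.
  have dP : is_derive x^-1 1 (horner P) (P^`()).[x^-1] by exact: is_derive_poly.
  have d1 := is_derive1_comp dP dV.
  have d2 := @is_derive1_comp R expR (fun y => - y^-1) x _ _
    (is_derive_expR (- x^-1)) (is_deriveN dV).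
  apply: (is_derive_eq (is_deriveM d1 d2)).
  rewrite /= !hornerE /= /GRing.scale /= exprVn.
  by ring.
- apply: (@near_eq_is_derive R R^o R^o (fun=> 0)).
    near=> y; rewrite /flat ifF//; apply/negbTE; rewrite -leNgt ltW//.
    near: y; exact: lt_nbhsl.
  by rewrite /flat ltNge (ltW x0)/=; exact: is_derive_cst.
- have [C C0 CP] := flat_le P.
  have f0 : flat P 0 = 0 by rewrite /flat ltxx.
  have cv : h^-1 *: ((flat P \o shift 0) (h *: (1 : R)) - flat P 0) @[h --> 0^'] -->
      (0 : R).
    apply/cvgr0Pnorm_le => e e0.
    near=> h; rewrite f0 subr0 /= addr0 /GRing.scale /= mulr1 normrM normfV.
    have hn0 : h != 0 by near: h; exact: nbhs_dnbhs_neq.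
    have h1 : `|h| <= 1.
      near: h; exact: dnbhs0_le.
    rewrite ler_pdivrMl ?normr_gt0//; apply: le_trans (CP _ h1) _.
    rewrite -(real_normK (num_real h)) expr2 mulrA mulrC ler_wpM2l//.
    have : `|h| <= e / (C + 1).
      near: h; apply: dnbhs0_le; rewrite divr_gt0//; lra.
    rewrite ler_pdivlMr; last lra.
    apply: le_trans; rewrite mulrC ler_wpM2l//; lra.
  split; first by apply/cvg_ex; exists 0.
  by rewrite /flat ltxx; apply/cvg_lim.
Unshelve. all: by end_near. Qed.

End Smooth1D.

(** * Bumps on boxes as test functions *)

Section TestFunctions.
Variable R : realType.
Implicit Types (p q r : R -> R).

Fixpoint smooth (n : nat) p : Prop :=
  if n is n'.+1 then
    exists p', (forall x : R, is_derive x 1 p (p' x)) /\ smooth n' p'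
  else continuous p.

Lemma is_derive_continuous p p' : (forall x : R, is_derive x 1 p (p' x)) ->
  continuous p.
Proof.
move=> dp x; apply: differentiable_continuous.
by apply/derivable1_diffP; have [] := dp x.
Qed.

Lemma smoothW n p : smooth n.+1 p -> smooth n p.
Proof.
elim: n p => [|n IH] p [p' [dp sp]]; first exact: is_derive_continuous dp.
by exists p'; split => //; exact: IH.
Qed.

Lemma smooth_continuous n p : smooth n p -> continuous p.
Proof. by elim: n p => [//|n IH] p /smoothW/IH. Qed.

Lemma smoothD n p q : smooth n p -> smooth n q -> smooth n (fun x => p x + q x).
Proof.
elim: n p q => [|n IH] p q /=; first by move=> cp cq x; apply: cvgD; [exact: cp|exact: cq].
move=> [p' [dp sp]] [q' [dq sq]]; exists (fun x => p' x + q' x).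
by split=> [x|]; [exact: is_deriveD|exact: IH].
Qed.

Lemma smoothM n p q : smooth n p -> smooth n q -> smooth n (fun x => p x * q x).
Proof.
elim: n p q => [|n IH] p q /=.
  by move=> cp cq x; apply: cvgM; [exact: cp|exact: cq].
move=> sp1 sq1; have sp := smoothW sp1; have sq := smoothW sq1.
move: sp1 sq1 => [p' [dp sp']] [q' [dq sq']].
exists (fun x => p x * q' x + q x * p' x); split=> [x|].
  exact: (is_deriveM (dp x) (dq x)).
by apply: smoothD; exact: IH.
Qed.

Lemma smooth_affine n p (a b : R) : smooth n p -> smooth n (fun x => p (a * x + b)).
Proof.
have daff (x : R) : is_derive x 1 (fun x => a * x + b) a.
  have : is_derive x 1 (a *: (id : R -> R) + cst b) (a *: (1 : R) + 0).
    by apply: is_deriveD.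
  by rewrite /GRing.scale /= mulr1 addr0.
elim: n p => [|n IH] p /=.
  move=> cp x; apply: (@continuous_comp _ _ _ (fun x => a * x + b) p).
    exact: (is_derive_continuous daff).
  exact: cp.
move=> [p' [dp sp]]; exists (fun x => p' (a * x + b) * a); split => [x|].
  exact: (@is_derive1_comp R p (fun x => a * x + b)).
apply: smoothM; first exact: IH.
elim: n {IH sp} => [|n IH] /=; first exact: cst_continuous.
exists (fun=> 0); split => [x|]; first exact: is_derive_cst.
elim: n {IH} => [|n IH] /=; first exact: cst_continuous.
by exists (fun=> 0); split => // x; exact: is_derive_cst.
Qed.

Lemma smooth_flat n P : smooth n (@flat R P).
Proof.
elim: n P => [|n IH] P /=; first exact: is_derive_continuous (is_derive_flat P).
by exists (flat ('X^2 * (P - P^`()))); split => //; exact: is_derive_flat.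
Qed.

Lemma continuous_c11 : continuous (fun x : pt R => x.1.1).
Proof.
move=> x; exact: (@continuous_comp (pt R) (R * R)%type R fst fst x cvg_fst cvg_fst).
Qed.

Lemma continuous_c12 : continuous (fun x : pt R => x.1.2).
Proof.
move=> x; exact: (@continuous_comp (pt R) (R * R)%type R fst snd x cvg_fst cvg_snd).
Qed.

Lemma continuous_c2 : continuous (fun x : pt R => x.2).
Proof. by move=> x; exact: cvg_snd. Qed.

Lemma continuous_tensor p q r : continuous p -> continuous q -> continuous r ->
  continuous (fun x : pt R => p x.1.1 * q x.1.2 * r x.2).
Proof.
move=> cp cq cr x; apply: cvgM; last first.
  by apply: (@continuous_comp _ _ _ (fun y : pt R => y.2) r);
    [exact: continuous_c2|exact: cr].
apply: cvgM.
  by apply: (@continuous_comp _ _ _ (fun y : pt R => y.1.1) p);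
    [exact: continuous_c11|exact: cp].
by apply: (@continuous_comp _ _ _ (fun y : pt R => y.1.2) q);
  [exact: continuous_c12|exact: cq].
Qed.

Lemma shiftE (h : R) (k : 'I_3) (x : pt R) :
  ((h *: Defs.basis R k + x).1.1 = h * (k == 0%N :> nat)%:R + x.1.1) *
  ((h *: Defs.basis R k + x).1.2 = h * (k == 1%N :> nat)%:R + x.1.2) *
  ((h *: Defs.basis R k + x).2 = h * (k == 2%N :> nat)%:R + x.2).
Proof. by []. Qed.

Lemma is_derive_tensor p q r p' q' r' (x : pt R) (k : 'I_3) :
  (forall y : R, is_derive y 1 p (p' y)) -> (forall y : R, is_derive y 1 q (q' y)) ->
  (forall y : R, is_derive y 1 r (r' y)) ->
  is_derive x (Defs.basis R k) (fun x : pt R => p x.1.1 * q x.1.2 * r x.2)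
    (match val k with
     | 0%N => p' x.1.1 * q x.1.2 * r x.2
     | 1%N => p x.1.1 * q' x.1.2 * r x.2
     | _ => p x.1.1 * q x.1.2 * r' x.2 end).
Proof.
(* Along a basis vector only one factor [s] varies; [c] is the product of the two others. *)
have aux (s s' : R -> R) (y c : R) (f : pt R -> R) :
    (forall y : R, is_derive y 1 s (s' y)) ->
    (forall h : R, f (h *: Defs.basis R k + x) - f x = (s (h + y) - s y) * c) ->
    is_derive x (Defs.basis R k) f (s' y * c).
  move=> ds hf.
  have cv : h^-1 *: ((f \o shift x) (h *: Defs.basis R k) - f x) @[h --> 0^'] --> s' y * c.
    have [/= dy <-] := ds y.
    rewrite (_ : (fun h => _) = fun h => h^-1 *: ((s \o shift y) (h *: (1 : R)) - s y) * c).
      by apply: cvgM; [exact: dy|exact: cvg_cst].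
    apply/funext => h /=; rewrite hf /GRing.scale /= mulr1.
    by rewrite mulrA.
  by split; [apply/cvg_ex; eexists; exact: cv|exact/cvg_lim].
move=> dp dq dr; case: k aux => -[|[|[|//]]] k3 aux /=.
- have := aux p p' x.1.1 (q x.1.2 * r x.2) _ dp; rewrite mulrA; apply => h.
  by rewrite !shiftE /= !mulr0 !add0r mulr1; ring.
- have H := aux q q' x.1.2 (p x.1.1 * r x.2)
    (fun x : pt R => p x.1.1 * q x.1.2 * r x.2) dq.
  apply: is_derive_eq (H _) _; last by ring.
  by move=> h; rewrite !shiftE /= !mulr0 !add0r mulr1; ring.
- have H := aux r r' x.2 (p x.1.1 * q x.1.2)
    (fun x : pt R => p x.1.1 * q x.1.2 * r x.2) dr.
  apply: is_derive_eq (H _) _; last by ring.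
  by move=> h; rewrite !shiftE /= !mulr0 !add0r mulr1; ring.
Qed.

Lemma Cr_tensor m p q r : smooth m p -> smooth m q -> smooth m r ->
  Cr m (fun x : pt R => p x.1.1 * q x.1.2 * r x.2).
Proof.
elim: m p q r => [|m IH] p q r sp sq sr.
  by split => //; apply: continuous_tensor; exact: (smooth_continuous (n := 0)).
split; first by apply: continuous_tensor; exact: (smooth_continuous (n := m.+1)).
have sp0 := smoothW sp; have sq0 := smoothW sq; have sr0 := smoothW sr.
move: sp sq sr => [p' [dp sp']] [q' [dq sq']] [r' [dr sr']] k; split.
  by move=> x; have [] := is_derive_tensor x k dp dq dr.
have -> : partial k (fun x : pt R => p x.1.1 * q x.1.2 * r x.2) =
    (match val k with
     | 0%N => fun x : pt R => p' x.1.1 * q x.1.2 * r x.2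
     | 1%N => fun x : pt R => p x.1.1 * q' x.1.2 * r x.2
     | _ => fun x : pt R => p x.1.1 * q x.1.2 * r' x.2 end).
  apply/funext => x; rewrite /partial.
  have [_ ->] := is_derive_tensor x k dp dq dr.
  by case: k => -[|[|[|//]]].
by case: k => -[|[|[|//]]] /= _; exact: IH.
Qed.

(** The parameter [n] sharpens the bump: as it grows, the values tend to the indicator of []a, b[]
    within [[0, 1]]. The arguments are spelled out as affine functions of [x] for the sake of
    [smooth_affine]. *)
Definition bump1 (n : nat) (a b x : R) : R :=
  flat 1 (n%:R * x + - (n%:R * a)) * flat 1 ((- n%:R) * x + n%:R * b).
Definition bump (n : nat) (a b x : pt R) : R :=
  bump1 n a.1.1 b.1.1 x.1.1 * bump1 n a.1.2 b.1.2 x.1.2 * bump1 n a.2 b.2 x.2.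

Lemma smooth_bump1 m n (a b : R) : smooth m (bump1 n a b).
Proof. by apply: smoothM; apply: smooth_affine; exact: smooth_flat. Qed.

Lemma flat1_ge0 (x : R) : 0 <= flat 1 x.
Proof. by rewrite /flat; case: ifP => // _; rewrite hornerC mul1r expR_ge0. Qed.

Lemma flat1_le1 (x : R) : flat 1 x <= 1.
Proof.
rewrite /flat; case: ifPn => // x0; rewrite hornerC mul1r.
by rewrite -expR0 ler_expR oppr_le0 invr_ge0 ltW.
Qed.

Lemma bump1_01 n (a b x : R) : 0 <= bump1 n a b x <= 1.
Proof.
by rewrite mulr_ge0 ?flat1_ge0//= mulr_ile1 ?flat1_ge0 ?flat1_le1.
Qed.

Lemma bump_01 n (a b x : pt R) : 0 <= bump n a b x <= 1.
Proof.
have /andP[? ?] := bump1_01 n a.1.1 b.1.1 x.1.1.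
have /andP[? ?] := bump1_01 n a.1.2 b.1.2 x.1.2.
have /andP[? ?] := bump1_01 n a.2 b.2 x.2.
have h12 : 0 <= bump1 n a.1.1 b.1.1 x.1.1 * bump1 n a.1.2 b.1.2 x.1.2 by exact: mulr_ge0.
apply/andP; split; first exact: mulr_ge0.
by apply: mulr_ile1 => //; exact: mulr_ile1.
Qed.

Lemma bump1_out n (a b x : R) : ~~ (a < x < b) -> bump1 n a b x = 0.
Proof.
rewrite negb_and -!leNgt => /orP[xa|bx]; rewrite /bump1 /flat.
- rewrite ltNge (_ : _ + _ <= 0) ?mul0r//.
  by rewrite -mulrBr mulr_ge0_le0// subr_le0.
- rewrite [X in _ * (if X then _ else _)]ltNge (_ : _ + _ <= 0) ?mulr0//.
  by rewrite mulNr addrC -mulrBr mulr_ge0_le0// subr_le0.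
Qed.

Lemma bump_out n (a b x : pt R) : ~ box a b x -> bump n a b x = 0.
Proof.
move=> nb; rewrite /bump.
have [h1|/bump1_out->] := boolP (a.1.1 < x.1.1 < b.1.1); last by rewrite !mul0r.
have [h2|/bump1_out->] := boolP (a.1.2 < x.1.2 < b.1.2); last by rewrite mulr0 mul0r.
have [h3|/bump1_out->] := boolP (a.2 < x.2 < b.2); last by rewrite mulr0.
by case: nb.
Qed.

Lemma flat1_cvg (c : R) : 0 < c -> flat 1 (n%:R * c) @[n --> \oo] --> (1 : R).
Proof.
move=> c0; rewrite -(cvg_shiftS (fun n => flat 1 (n%:R * c))).
have e1 : expR (- 0) = 1 :> R by rewrite oppr0 expR0.
suff : flat 1 (n.+1%:R * c) @[n --> \oo] --> expR (- 0 : R) by rewrite e1.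
rewrite (_ : (fun n => _) = fun n => expR (- (n.+1%:R^-1 * c^-1))).
  apply: continuous_cvg; first exact: continuous_expR.
  apply: cvgN; rewrite -(mul0r c^-1); apply: cvgM; last exact: cvg_cst.
  exact: cvg_harmonic.
by apply/funext => n; rewrite /flat mulr_gt0// hornerC mul1r invfM.
Qed.

Lemma bump1_cvg (a b x : R) : a < x < b -> bump1 n a b x @[n --> \oo] --> (1 : R).
Proof.
move=> /andP[ax xb].
have -> : bump1 ^~ a ^~ b ^~ x = fun n => flat 1 (n%:R * (x - a)) * flat 1 (n%:R * (b - x)).
  by apply/funext => n; rewrite /bump1; congr (flat 1 _ * flat 1 _); ring.
have := cvgM (flat1_cvg (c := x - a) _) (flat1_cvg (c := b - x) _).
by rewrite mulr1 !subr_gt0; apply.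
Qed.

Lemma bump_cvg (a b x : pt R) : box a b x -> bump n a b x @[n --> \oo] --> (1 : R).
Proof.
move=> [h1 h2 h3].
have := cvgM (cvgM (bump1_cvg h1) (bump1_cvg h2)) (bump1_cvg h3).
by rewrite (mulr1 1) (mulr1 1); apply.
Qed.

Lemma test_fun_bump (U : set (pt R)) n (a b : pt R) : cbox a b `<=` U ->
  test_fun U (bump n a b).
Proof.
move=> abU; split.
  by move=> m; apply: (@Cr_tensor m (bump1 n a.1.1 b.1.1) (bump1 n a.1.2 b.1.2)
    (bump1 n a.2 b.2)); exact: smooth_bump1.
exists (cbox a b); first by split => //; exact: compact_cbox.
by move=> x nx; apply: bump_out => /box_cbox.
Qed.

End TestFunctions.

(** * The fundamental lemma of the calculus of variations *)

Section FundamentalLemma.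
Variables (R : realType) (mu : {measure set (pt R) -> \bar R}).
Implicit Types (D U : set (pt R)) (f : pt R -> R) (psi : pt R -> R).

Lemma test_fun_continuous U psi : test_fun U psi -> continuous psi.
Proof. by move=> [/(_ 0%N)[]]. Qed.

Lemma test_fun_partial_continuous U psi k : test_fun U psi ->
  continuous (partial k psi).
Proof. by move=> [/(_ 1%N)[_ /(_ k)[_ []]]]. Qed.

Lemma test_funS U U' psi : U `<=` U' -> test_fun U psi -> test_fun U' psi.
Proof.
move=> UU' [sm [K [cK KU] K0]]; split => //; exists K => //; split => //.
exact: subset_trans KU UU'.
Qed.

Lemma continuous_bounded_cbox f (a b : pt R) : continuous f ->
  exists M, forall x, cbox a b x -> `|f x| <= M.
Proof.
move=> cf.
have : compact (f @` cbox a b).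
  by apply: continuous_compact; [exact: continuous_subspaceT|exact: compact_cbox].
move=> /compact_bounded[M [Mr H]]; exists (M + 1) => x bx.
by apply: (H (M + 1)); [rewrite ltrDl|exists x].
Qed.

(** The bumps tend to the indicator of the open box and are at most 1, so the test equations pass to
    the limit by dominated convergence with bound [|f|]. *)
Lemma bump_integral0 D U f (a b : pt R) : measurable D ->
  cbox a b `<=` U -> intg mu D f ->
  (forall psi, test_fun U psi -> rint mu D (fun x => psi x * f x) = 0) ->
  (\int[mu]_(x in D `&` box a b) (f x)%:E)%E = 0%E.
Proof.
move=> mD abU fi f0.
have mf := intg_meas fi.
pose F n x := (bump n a b x * f x)%:E.
have mb n : measurable_fun D (bump n a b).
  apply: measurable_funTS; apply: continuous_measurable3.
  by apply: (test_fun_continuous (U := U)); exact: test_fun_bump.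
have mF n : measurable_fun D (F n).
  by apply/measurable_EFinP; apply: measurable_funM.
pose f1 := (EFin \o f) \_ (box a b).
have mf1 : measurable_fun D f1.
  apply/(measurable_restrict _ (measurable_box a b) mD).
  by apply: measurable_funS (mD) _ _ => //; exact/measurable_EFinP.
have Fle n x : D x -> (`|F n x| <= `|f x|%:E)%E.
  move=> _; rewrite /F /= lee_fin normrM.
  have /andP[b0 b1] := bump_01 n a b x.
  by rewrite (ger0_norm b0) ler_piMl.
have Fcvg x : D x -> F ^~ x @ \oo --> f1 x.
  move=> Dx; rewrite /f1 /F patchE; case: ifPn => [/[!inE] bx|].
    apply: cvg_EFin; first exact: nearW.
    have := cvgM (bump_cvg bx) (cvg_cst (f x)).
    by rewrite mul1r; apply.
  move=> /negP; rewrite inE => nbx.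
  by under eq_fun do rewrite bump_out// mul0r; exact: cvg_cst.
have iabs : mu.-integrable D (fun x => `|f x|%:E) by exact: integrable_norm.
have [_ _] := dominated_convergence mD mF mf1 (aeW _ Fcvg) iabs
  (aeW _ (fun x n Dx => Fle n x Dx)).
have -> : [sequence (\int[mu]_(x in D) F n x)%E]_n = fun=> 0%E.
  apply/funext => n /=.
  have bt := test_fun_bump n abU.
  rewrite /F -rintE//; first by rewrite f0.
  apply: (intg_le mD _ _ iabs); first exact: measurable_funM.
  by move=> x Dx; have := Fle n x Dx; rewrite lee_fin.
rewrite integral_mkcondr => c0.
have := cvg_unique _ c0 (cvg_cst 0%E).
by move=> ->.
Qed.

(** Sets with vanishing integral form a Dynkin system; containing all boxes, it contains all Borel
    sets, and an integrable function with zero integral over each of them is zero almost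
    everywhere. *)
Lemma box_integral0 D f (a b : pt R) : measurable D -> intg mu D f ->
  (forall c d, (\int[mu]_(x in D `&` (box a b `&` box c d)) (f x)%:E)%E = 0%E) ->
  {ae mu, forall x, (D `&` box a b) x -> f x = 0}.
Proof.
move=> mD fi f0; set E := D `&` box a b.
have mE : measurable E by apply: measurableI => //; exact: measurable_box.
have fE : mu.-integrable E (EFin \o f) by apply: (integrableS mD mE _ fi) => x [].
have PA A : measurable A -> (\int[mu]_(x in E `&` A) (f x)%:E)%E = 0%E.
  rewrite measurable3E; move: A; apply: (dynkin_induction (measurable3E R)).
  - move=> _ _ [c [d ->]] [c' [d' ->]]; rewrite boxI.
    by eexists; eexists.
  - by rewrite setIT; have := f0 a b; rewrite setIid.
  - by move=> _ [c [d ->]]; rewrite -setIA.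
  - move=> S mS iS.
    have mES : measurable (E `&` S) by exact: measurableI.
    have mEC : measurable (E `&` ~` S) by apply: measurableI => //; exact: measurableC.
    have : (\int[mu]_(x in (E `&` S) `|` (E `&` ~` S)) (f x)%:E)%E = 0%E.
      by rewrite -setIUr setUCr setIT; have := f0 a b; rewrite setIid.
    rewrite integral_setU //=.
    + by rewrite iS add0e.
    + rewrite -setIUr setUCr setIT.
      exact: measurable_int fE.
    + by apply/disj_setPS => x [[_ Sx] [_ nSx]].
  - move=> F mF tF iF; rewrite setI_bigcupr integral_bigcup.
    + by rewrite eseries0// => i _ _; exact: iF.
    + apply/trivIsetP => i j _ _ ij; move/trivIsetP: tF => /(_ i j Logic.I Logic.I ij) e.
      by rewrite setIACA setIid e setI0.
    + by move=> k; exact: measurableI.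
    + rewrite -setI_bigcupr; apply: (integrableS mE _ _ fE); last by move=> x [].
      by apply: measurableI => //; exact: bigcup_measurable.
have := integral_ae_eq mE fE (measurable_cst (0%E : \bar R)).
move=> /(_ _)/= H; have : ae_eq mu E (EFin \o f) (cst 0%E).
  apply: H => A AE mA; rewrite integral0 -(PA A mA).
  by congr (integral _ _ _); apply/esym/setIidr.
by apply: filterS => x h Ex; have [] := h Ex.
Qed.

(** [D] and [U] are separate because two cases are wanted: Lebesgue measure on the open set, with
    [D = U], and Hausdorff measure on its boundary, where [U] is the whole space. *)
Lemma du_bois_reymond D U f : measurable D -> open U -> D `<=` U -> intg mu D f ->
  (forall psi, test_fun U psi -> rint mu D (fun x => psi x * f x) = 0) ->
  {ae mu, forall x, D x -> f x = 0}.
Proof.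
move=> mD oU DU fi f0.
pose I := ((rat * rat * rat) * (rat * rat * rat))%type.
have aeq (q : I) : cbox (rpt R q.1) (rpt R q.2) `<=` U ->
    {ae mu, forall x, (D `&` box (rpt R q.1) (rpt R q.2)) x -> f x = 0}.
  move=> qU; apply: box_integral0 => // c d; rewrite boxI.
  apply: (bump_integral0 (U := U)) => //.
  move=> x [/= p1 p2 p3]; apply: qU; split.
  - by move: p1; rewrite ge_max le_min => /andP[/andP[-> _] /andP[-> _]].
  - by move: p2; rewrite ge_max le_min => /andP[/andP[-> _] /andP[-> _]].
  - by move: p3; rewrite ge_max le_min => /andP[/andP[-> _] /andP[-> _]].
pose N n : set (pt R) := if @unpickle I n is Some q then
  if `[< cbox (rpt R q.1) (rpt R q.2) `<=` U >] then
    ~` [set x | (D `&` box (rpt R q.1) (rpt R q.2)) x -> f x = 0] else set0 else set0.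
have : mu.-negligible (\bigcup_n N n).
  apply: negligible_bigcup => n; rewrite /N.
  case: (unpickle n) => [q|]; last exact: negligible_set0.
  by case: asboolP => [/aeq//|_]; exact: negligible_set0.
apply: negligibleS => x /= /not_implyP[Dx fx].
have [q [bx qU]] := open_rat_box oU (DU x Dx).
exists (pickle (q : I)); first by [].
rewrite /N pickleK.
by case: asboolP => // _ /=; apply/not_implyP.
Qed.

Lemma du_bois_reymondC D U (f : pt R -> R[i]) :
  measurable D -> open U -> D `<=` U -> cintg mu D f ->
  (forall psi, test_fun U psi -> cint mu D (fun x => (psi x)%:C * f x) = 0) ->
  {ae mu, forall x, D x -> f x = 0}.
Proof.
move=> mD oU DU [f1 f2] f0.
have h1 : {ae mu, forall x, D x -> complex.Re (f x) = 0}.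
  apply: (du_bois_reymond mD oU DU f1) => psi tpsi.
  have /(congr1 (@complex.Re R)) /= := f0 psi tpsi.
  by under eq_fun do rewrite ReM /= mul0r subr0.
have h2 : {ae mu, forall x, D x -> complex.Im (f x) = 0}.
  apply: (du_bois_reymond mD oU DU f2) => psi tpsi.
  have /(congr1 (@complex.Im R)) /= := f0 psi tpsi.
  by under eq_fun do rewrite ImM /= mul0r addr0.
by apply: filterS2 h1 h2 => x r1 r2 Dx; apply: eqC; [exact: r1|exact: r2].
Qed.

End FundamentalLemma.

(** * Two-dimensional Hausdorff measure *)

Section MetricOuterMeasure.
Variables (R : realType) (T : Type) (mu : {outer_measure set T -> \bar R}).
Variable f : T -> R.
Local Open Scope ereal_scope.

Hypothesis sep : forall (A B : set T) (a b : R), (a < b)%R ->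
  (forall x, A x -> (f x <= a)%R) -> (forall x, B x -> (b <= f x)%R) ->
  mu A + mu B <= mu (A `|` B).

Let s (n : nat) : R := (n.+1%:R^-1)%R.
Let s_lt n : (s n.+1 < s n)%R.
Proof. by rewrite ltf_pV2 ?posrE ?ltr0n// ltr_nat. Qed.

Let shell (X : set T) (c : R) (n : nat) :=
  X `&` [set x | (c - s n <= f x)%R /\ (f x < c - s n.+1)%R].

Let le_s m p : (m <= p)%N -> (s p <= s m)%R.
Proof. by move=> mp; rewrite lef_pV2 ?posrE ?ltr0n// ler_nat ltnS. Qed.

(** Two shells of the same parity are kept apart by the shell between them, so that [sep] adds up
    their measures. *)
Lemma sum_separated_shells (X : set T) (c : R) (o N : nat) :
  \sum_(i < N.+1) mu (shell X c (o + i.*2)) <=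
  mu (X `&` [set x | (f x <= c - s (o + N.*2).+1)%R]).
Proof.
elim: N => [|N IH].
  rewrite big_ord_recr /= big_ord0 add0e addn0; apply: le_outer_measure.
  by move=> x [Xx [_ /ltW]].
rewrite big_ord_recr/=; apply: le_trans (leeD2r _ IH) _.
rewrite doubleS !addnS.
apply: (@le_trans _ _ (mu ((X `&` [set x | (f x <= c - s (o + N.*2).+1)%R]) `|`
                            shell X c (o + N.*2).+2))).
  apply: (@sep _ _ (c - s (o + N.*2).+1)%R (c - s (o + N.*2).+2)%R).
  - by rewrite ltrD2l ltrN2.
  - by move=> x [].
  - by move=> x [_ []].
apply: le_outer_measure => x [[Xx fx]|[Xx [_ fx]]]; split => //=.
- apply: le_trans fx _; rewrite /= lerD2l lerN2.
  by apply: le_s; rewrite ltnS ltnW.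
- exact: ltW.
Qed.

(** Caratheodory's argument for metric outer measures. The part of [X] where [f <= c - s n] is
    separated from the part where [f >= c]; what lies between is covered by shells, whose measures
    have a finite sum (at most [mu X] for each parity), so that the tail tends to 0. *)
Lemma halfspace_caratheodory (c : R) : mu.-caratheodory [set x | (f x < c)%R].
Proof.
apply: le_caratheodory_measurable => X.
have [->|Xoo] := eqVneq (mu X) +oo; first by rewrite leey.
have Xfin : mu X \is a fin_num.
  by rewrite ge0_fin_numE ?outer_measure_ge0// lt_neqAle Xoo leey.
have half o : \sum_(0 <= i <oo) mu (shell X c (o + i.*2)) <= mu X.
  apply: lime_le; first by apply: is_cvg_nneseries => n _ _; exact: outer_measure_ge0.
  apply: nearW => -[|n]; first by rewrite big_geq// outer_measure_ge0.
  rewrite big_mkord; apply: le_trans (sum_separated_shells X c o n) _.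
  by apply: le_outer_measure => x [].
have total n : \sum_(0 <= i < n) mu (shell X c i) <= mu X + mu X.
  apply: (@le_trans _ _ (\sum_(0 <= i < n.*2) mu (shell X c i))).
    apply: lee_sum_nneg_natr => // [i _ _|]; first exact: outer_measure_ge0.
    by rewrite -addnn leq_addr.
  have -> : \sum_(0 <= i < n.*2) mu (shell X c i) =
      \sum_(0 <= i < n) mu (shell X c (0 + i.*2)) +
      \sum_(0 <= i < n) mu (shell X c (1 + i.*2)).
    elim: n => [|n IH]; first by rewrite !big_geq// adde0.
    rewrite doubleS !big_nat_recr//= IH -!addeA; congr (_ + _).
    by rewrite addeCA.
  apply: leeD; [apply: le_trans (half 0%N)|apply: le_trans (half 1%N)].
  - apply: (nneseries_lim_ge (P := xpredT)) => k _ _; exact: outer_measure_ge0.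
  - apply: (nneseries_lim_ge (P := xpredT)) => k _ _; exact: outer_measure_ge0.
have sumfin : \sum_(0 <= i <oo) mu (shell X c i) < +oo.
  apply: (@le_lt_trans _ _ (mu X + mu X)).
    apply: lime_le; first by apply: is_cvg_nneseries => n _ _; exact: outer_measure_ge0.
    exact: nearW.
  by rewrite -ge0_fin_numE ?adde_ge0 ?outer_measure_ge0// fin_numD Xfin.
have cover n : mu (X `&` [set x | (f x < c)%R]) <=
    mu (X `&` [set x | (f x <= c - s n)%R]) + \sum_(n <= i <oo) mu (shell X c i).
  apply: le_trans; last first.
    by apply: leeD2l; exact: outer_measure_sigma_subadditive_tail.
  apply: le_trans (outer_measureU2 _ _ _); apply: le_outer_measure => x [Xx /= fx].
  have [?|fn] := leP (f x) (c - s n)%R; first by left.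
  have [m cm] : exists m, (f x < c - s m)%R.
    have cf : (0 < c - f x)%R by rewrite subr_gt0.
    exists (Num.truncn (c - f x)^-1); rewrite ltrBrDr -ltrBrDl.
    rewrite -[ltRHS]invrK ltf_pV2 ?posrE ?invr_gt0// ?ltr0n//.
    exact: truncnS_gt.
  (* The least such [m] is one more than the index of the shell that contains [x]. *)
  have : exists m, (f x < c - s m)%R && (n < m)%N.
    exists m; rewrite cm /= ltnNge; apply/negP => mn.
    have := lt_trans fn cm; rewrite ltrD2l ltrN2 ltNge.
    by rewrite le_s.
  move=> /ex_minnP[[|p] /andP[pc np] pmin] //.
  right; exists p; first by move=> /=; apply/negP; rewrite -leqNgt -ltnS.
  split=> //=; split => //.
  have [np'|] := ltnP n p; last first.
    move: np; rewrite ltnS => np pn; have -> : p = n by apply/eqP; rewrite eqn_leq pn np.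
    exact: ltW.
  rewrite leNgt; apply/negP => h.
  by have := pmin p; rewrite h np' ltnn => /(_ isT).
have bound n : mu (X `&` [set x | (f x < c)%R]) + mu (X `&` ~` [set x | (f x < c)%R]) <=
    mu X + \sum_(n <= i <oo) mu (shell X c i).
  apply: le_trans (leeD2r _ (cover n)) _.
  rewrite addeAC; apply: leeD2r.
  apply: (@le_trans _ _ (mu ((X `&` [set x | (f x <= c - s n)%R]) `|`
     (X `&` ~` [set x | (f x < c)%R])))).
    apply: (@sep _ _ (c - s n)%R c).
    - by rewrite ltrBlDr ltrDl invr_gt0 ltr0n.
    - by move=> x [].
    - by move=> x [_ /negP]; rewrite -leNgt.
  by apply: le_outer_measure => x [[]|[]].
have tail := nneseries_tail_cvg sumfin (fun i _ => outer_measure_ge0 mu _).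
have tail' : (fun n => mu X + \sum_(n <= i <oo) mu (shell X c i)) @ \oo --> mu X.
  rewrite -[X in _ --> X]adde0.
  by apply: cvgeD => //; [rewrite fin_num_adde_defr|exact: cvg_cst].
rewrite -[leRHS](cvg_lim _ tail')//; apply: lime_ge; last exact: nearW.
by apply/cvg_ex; exists (mu X).
Qed.

End MetricOuterMeasure.


(** * Hausdorff measure as a Borel measure *)

Section Hausdorff.
Variable R : realType.
Implicit Types (A B : set (pt R)) (x y : pt R).
Local Notation coord := Defs.coord.

Lemma sum3 (V : nmodType) (F : 'I_3 -> V) :
  \sum_k F k = F (inord 0) + F (inord 1) + F (inord 2).
Proof.
rewrite !big_ord_recl big_ord0 addr0 addrA.
by congr (F _ + F _ + F _); apply/val_inj => /=; rewrite inordK.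
Qed.

Lemma coordE (x : pt R) :
  (coord x (inord 0) = x.1.1) * (coord x (inord 1) = x.1.2) *
  (coord x (inord 2) = x.2).
Proof.
have e j : (j < 3)%N -> val (inord j : 'I_3) = j by exact: inordK.
by rewrite /Defs.coord !e.
Qed.

Lemma dotpE x y : dotp x y = x.1.1 * y.1.1 + x.1.2 * y.1.2 + x.2 * y.2.
Proof. by rewrite /dotp sum3 !coordE. Qed.

Lemma enorm2E x : enorm x ^+ 2 = x.1.1 ^+ 2 + x.1.2 ^+ 2 + x.2 ^+ 2.
Proof.
rewrite /enorm sqr_sqrtr dotpE -!expr2//.
by rewrite !addr_ge0 ?sqr_ge0.
Qed.

Lemma coord_le_enorm k x : `|coord x k| <= enorm x.
Proof.
rewrite -ler_sqr ?nnegrE ?sqrtr_ge0// enorm2E real_normK ?num_real//.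
have [? ? ?] := And3 (sqr_ge0 x.1.1) (sqr_ge0 x.1.2) (sqr_ge0 x.2).
by case: k => -[|[|[|//]]] k3; rewrite /coord /=; lra.
Qed.

Lemma coordB k x y : coord (x - y) k = coord x k - coord y k.
Proof. by case: k => -[|[|[|//]]] k3. Qed.

Local Open Scope ereal_scope.

Lemma sqdiam_ge0 A : 0 <= sqdiam A.
Proof. by apply: ereal_sup_ubound; left. Qed.

Lemma sqdiam0 : sqdiam (set0 : set (pt R)) = 0.
Proof.
apply/eqP; rewrite eq_le sqdiam_ge0 andbT; apply: ge_ereal_sup.
by move=> z [->//|[x [y []]]].
Qed.

Lemma sqdiam_ge A x y : A x -> A y -> (enorm (x - y) ^+ 2)%:E <= sqdiam A.
Proof. by move=> Ax Ay; apply: ereal_sup_ubound; right; exists x, y. Qed.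

Lemma sqdiam_le A (M : R) : (0 <= M)%R ->
  (forall x y, A x -> A y -> (enorm (x - y) ^+ 2 <= M)%R) -> sqdiam A <= M%:E.
Proof.
move=> M0 AM; apply: ge_ereal_sup => z [->|[x [y [Ax Ay ->]]]].
  by rewrite lee_fin.
by rewrite lee_fin AM.
Qed.

Let pi4_ge0 : (0 <= pi / 4 :> R)%R.
Proof. by rewrite divr_ge0// pi_ge0. Qed.

(* Every set is measurable in this type, so that [mu_ext] is the infimum over
   all countable covers. *)
Let all_sets := g_sigma_algebraType [set: set (pt R)].

(** The restriction on diameters is encoded as an infinite cost. This makes [hausdorff2_delta] an
    instance of [mu_ext], which supplies monotonicity and countable subadditivity. *)
Let small (del : R) (B : set all_sets) : \bar R :=
  if sqdiam (B : set (pt R)) <= (del ^+ 2)%:E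
  then (pi / 4)%:E * sqdiam (B : set (pt R)) else +oo.

Let small_ge0 del B : 0 <= small del B.
Proof.
rewrite /small; case: ifP => _; last by rewrite leey.
by rewrite mule_ge0 ?lee_fin// sqdiam_ge0.
Qed.

Let small0 del : small del set0 = 0.
Proof. by rewrite /small sqdiam0 lee_fin sqr_ge0 mule0. Qed.

Lemma hausdorff2_delta_mu_ext del A :
  hausdorff2_delta del A = mu_ext (small del) (A : set all_sets).
Proof.
apply/eqP; rewrite eq_le; apply/andP; split.
- apply: le_ereal_inf_tmp => _ [B [_ AB] <-].
  have [small_B|] := pselect (forall k, sqdiam (B k : set (pt R)) <= (del ^+ 2)%:E).
    apply: ereal_inf_lbound; exists B => //.
    by apply: eq_eseriesr => k _; rewrite /small small_B.
  move=> /existsNP[k /negP nk].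
  rewrite (eseries_pinfty (k := k)) ?leey//.
    by move=> i _; rewrite gt_eqF// (lt_le_trans _ (small_ge0 _ _)).
  by rewrite /small (negbTE nk).
- apply: le_ereal_inf_tmp => _ [B [AB Bdel] <-].
  apply: ereal_inf_lbound; exists B.
    by split => // k; exact: sub_sigma_algebra.
  by apply: eq_eseriesr => k _; rewrite /small Bdel.
Qed.

Lemma hausdorff2_delta_ge0 del A : 0 <= hausdorff2_delta del A.
Proof. by rewrite hausdorff2_delta_mu_ext; exact: mu_ext_ge0. Qed.

Lemma hausdorff2_delta_le del A : (0 < del)%R -> hausdorff2_delta del A <= hausdorff2 A.
Proof. by move=> d0; apply: ereal_sup_ubound; exists del. Qed.

Lemma hausdorff2_deltaS (del del' : R) A : (0 < del)%R -> (del <= del')%R ->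
  hausdorff2_delta del' A <= hausdorff2_delta del A.
Proof.
move=> d0 dd'; apply: ereal_inf_le_tmp => z [B [AB Bdel] <-]; exists B => //; split => // k.
apply: le_trans (Bdel k) _; rewrite lee_fin ler_sqr ?nnegrE//; first exact: ltW.
by rewrite (le_trans (ltW d0)).
Qed.

Lemma hausdorff2_0 : hausdorff2 (set0 : set (pt R)) = 0.
Proof.
apply/eqP; rewrite eq_le; apply/andP; split.
  apply: ge_ereal_sup => _ [del _ <-]; rewrite hausdorff2_delta_mu_ext.
  by rewrite mu_ext0.
by apply: le_trans (hausdorff2_delta_le _ ltr01); exact: hausdorff2_delta_ge0.
Qed.

Lemma hausdorff2_ge0 A : 0 <= hausdorff2 A.
Proof. by apply: le_trans (hausdorff2_delta_le _ ltr01); exact: hausdorff2_delta_ge0. Qed.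

Lemma le_hausdorff2 : {homo @hausdorff2 R : A B / A `<=` B >-> A <= B}.
Proof.
move=> A B AB; apply: ge_ereal_sup => _ [del d0 <-].
apply: le_trans (hausdorff2_delta_le B d0).
by rewrite !hausdorff2_delta_mu_ext; exact: le_mu_ext.
Qed.

Lemma hausdorff2_sigma_subadditive : sigma_subadditive (@hausdorff2 R).
Proof.
move=> F; apply: ge_ereal_sup => _ [del d0 <-].
rewrite hausdorff2_delta_mu_ext.
apply: (le_trans (@mu_ext_sigma_subadditive _ all_sets R _ (small_ge0 del) F)).
apply: lee_nneseries => [i _ _|i _]; first by apply: mu_ext_ge0; exact: small_ge0.
by rewrite -hausdorff2_delta_mu_ext; exact: hausdorff2_delta_le.
Qed.

HB.instance Definition _ := isOuterMeasure.Build R (pt R) (@hausdorff2 R)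
  hausdorff2_0 hausdorff2_ge0 le_hausdorff2 hausdorff2_sigma_subadditive.

(** Covering sets of diameter smaller than the gap [b - a] meet at most one of [A] and [B], so every
    cover of the union splits into a cover of [A] and a cover of [B]. *)
Lemma hausdorff2_delta_sep (k : 'I_3) (del a b : R) A B : (a < b)%R ->
  (del ^+ 2 < (b - a) ^+ 2)%R ->
  (forall x, A x -> (coord x k <= a)%R) -> (forall x, B x -> (b <= coord x k)%R) ->
  hausdorff2_delta del A + hausdorff2_delta del B <= hausdorff2_delta del (A `|` B).
Proof.
move=> ab dab Aa Bb; apply: le_ereal_inf_tmp => _ [C [ABC Cdel] <-].
pose meets (D : set (pt R)) n := if `[< (C n) `&` D !=set0 >] then C n else set0.
have meets_sub D n : sqdiam (meets D n) <= sqdiam (C n).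
  by rewrite /meets; case: ifP => // _; rewrite sqdiam0 sqdiam_ge0.
have mle D : D `<=` A `|` B ->
    hausdorff2_delta del D <= \sum_(0 <= n <oo) (pi / 4)%:E * sqdiam (meets D n).
  move=> DAB; apply: ereal_inf_lbound; exists (meets D) => //; split.
    move=> x Dx; have [n _ Cx] := ABC x (DAB x Dx); exists n => //.
    by rewrite /meets; case: asboolP => // -[]; exists x.
  by move=> n; apply: le_trans (meets_sub D n) (Cdel n).
apply: le_trans (leeD (mle A _) (mle B _)) _; [exact: subsetUl|exact: subsetUr|].
rewrite -nneseriesD; first last.
- by move=> i _ _; rewrite mule_ge0 ?lee_fin// sqdiam_ge0.
- by move=> i _ _; rewrite mule_ge0 ?lee_fin// sqdiam_ge0.
apply: lee_nneseries => [i _ _|i _].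
  by rewrite adde_ge0// mule_ge0 ?lee_fin// sqdiam_ge0.
have [[x [Cx Ax]]|nA] := pselect (C i `&` A !=set0); last first.
  rewrite {1}/meets; case: asboolP => // _; rewrite sqdiam0 mule0 add0e.
  by rewrite lee_wpmul2l ?lee_fin.
have [[y [Cy By]]|nB] := pselect (C i `&` B !=set0); last first.
  rewrite [X in _ + _ * sqdiam X]/meets; case: asboolP => // _.
  by rewrite sqdiam0 mule0 adde0 lee_wpmul2l ?lee_fin.
exfalso; have := le_trans (sqdiam_ge Cy Cx) (Cdel i); rewrite lee_fin leNgt => /negP; apply.
apply: lt_le_trans dab _.
have xa := Aa x Ax; have yb := Bb y By.
rewrite ler_sqr ?nnegrE ?sqrtr_ge0//; last by rewrite subr_ge0 ltW.
apply: le_trans (coord_le_enorm k _); rewrite coordB; apply: le_trans (ler_norm _).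
lra.
Qed.

Lemma hausdorff2_sep (k : 'I_3) A B (a b : R) : (a < b)%R ->
  (forall x, A x -> (coord x k <= a)%R) -> (forall x, B x -> (b <= coord x k)%R) ->
  hausdorff2 A + hausdorff2 B <= hausdorff2 (A `|` B).
Proof.
move=> ab Aa Bb.
(* The radii are independent because the two suprema on the left are taken one after the other. *)
have key d1 d2 : (0 < d1)%R -> (0 < d2)%R ->
    hausdorff2_delta d1 A + hausdorff2_delta d2 B <= hausdorff2 (A `|` B).
  move=> d10 d20; pose d : R := (Num.min (Num.min d1 d2) ((b - a) / 2))%R.
  have d0 : (0 < d)%R by rewrite !lt_min d10 d20/= divr_gt0 ?subr_gt0.
  have dd1 : (d <= d1)%R by rewrite !ge_min lexx.
  have dd2 : (d <= d2)%R by rewrite !ge_min lexx orbT.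
  have dab : (d <= (b - a) / 2)%R by rewrite !ge_min lexx orbT.
  apply: le_trans (hausdorff2_delta_le _ d0).
  apply: le_trans (leeD (hausdorff2_deltaS A d0 dd1) (hausdorff2_deltaS B d0 dd2)) _.
  apply: hausdorff2_delta_sep Aa Bb => //.
  rewrite ltr_sqr ?nnegrE; [lra|exact: ltW|lra].
have [->|hAB] := eqVneq (hausdorff2 (A `|` B)) +oo; first by rewrite leey.
have hfin : hausdorff2 (A `|` B) \is a fin_num.
  by rewrite ge0_fin_numE ?hausdorff2_ge0// lt_neqAle hAB leey.
have finA : hausdorff2 A \is a fin_num.
  rewrite ge0_fin_numE ?hausdorff2_ge0//.
  apply: le_lt_trans (le_hausdorff2 (@subsetUl _ A B)) _.
  by rewrite -ge0_fin_numE ?hausdorff2_ge0.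
have step d2 : (0 < d2)%R -> hausdorff2 A + hausdorff2_delta d2 B <= hausdorff2 (A `|` B).
  move=> d20.
  have finB : hausdorff2_delta d2 B \is a fin_num.
    rewrite ge0_fin_numE ?hausdorff2_delta_ge0//.
    apply: le_lt_trans (hausdorff2_delta_le B d20) _.
    apply: le_lt_trans (le_hausdorff2 (@subsetUr _ A B)) _.
    by rewrite -ge0_fin_numE ?hausdorff2_ge0.
  rewrite -leeBrDr//; apply: ge_ereal_sup => _ [d1 d10 <-].
  by rewrite leeBrDr// key.
rewrite addeC -leeBrDr//; apply: ge_ereal_sup => _ [d2 d20 <-].
by rewrite leeBrDr// addeC step.
Qed.

Lemma hausdorff2_sepN (k : 'I_3) A B (a b : R) : (a < b)%R ->
  (forall x, A x -> (- coord x k <= a)%R) -> (forall x, B x -> (b <= - coord x k)%R) ->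
  hausdorff2 A + hausdorff2 B <= hausdorff2 (A `|` B).
Proof.
move=> ab Aa Bb; rewrite addeC setUC; apply: (@hausdorff2_sep k _ _ (- b) (- a)).
- by rewrite ltrN2.
- by move=> x /Bb; rewrite lerNr.
- by move=> x /Aa; rewrite lerNl.
Qed.

Lemma measurable_hausdorff2_caratheodory (A : set (pt R)) : measurable A ->
  (@hausdorff2 R).-caratheodory A.
Proof.
move=> mA; suff : @measurable _ (caratheodory_type (@hausdorff2 R)) A by [].
move: mA; rewrite measurable3E; move: A; apply: smallest_sub.
  exact: sigma_algebra_measurable.
move=> _ [a [b ->]].
have lo k c : @measurable _ (caratheodory_type (@hausdorff2 R))
    [set x : pt R | (coord x k < c)%R].
  have H := @halfspace_caratheodory R (pt R) (@hausdorff2 R) (fun x => coord x k).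
  by apply: H => A B a' b'; exact: hausdorff2_sep.
have hi k c : @measurable _ (caratheodory_type (@hausdorff2 R))
    [set x : pt R | (c < coord x k)%R].
  rewrite (_ : [set x | _] = [set x : pt R | (- coord x k < - c)%R]).
    have H := @halfspace_caratheodory R (pt R) (@hausdorff2 R) (fun x => - coord x k)%R.
    by apply: H => A B a' b'; exact: hausdorff2_sepN.
  by apply/seteqP; split => x /=; rewrite ltrN2.
rewrite (_ : box a b =
  ([set x : pt R | a.1.1 < coord x (inord 0)] `&` [set x : pt R | coord x (inord 0) < b.1.1]) `&`
  (([set x : pt R | a.1.2 < coord x (inord 1)] `&` [set x : pt R | coord x (inord 1) < b.1.2]) `&`
  ([set x : pt R | a.2 < coord x (inord 2)] `&` [set x : pt R | coord x (inord 2) < b.2])))%R.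
  by do 2 (apply: measurableI; first by apply: measurableI; [exact: hi|exact: lo]);
    apply: measurableI; [exact: hi|exact: lo].
apply/seteqP; split => x /=; rewrite !coordE.
  by move=> [/andP[? ?] /andP[? ?] /andP[? ?]].
by move=> [[? ?] [[? ?] [? ?]]]; split; apply/andP.
Qed.

Lemma hausdorff2_semi_sigma_additive : semi_sigma_additive (@hausdorff2 R).
Proof.
move=> F mF tF mU.
exact: (@caratheodory_measure_sigma_additive R (pt R) (@hausdorff2 R) F
  (fun n => measurable_hausdorff2_caratheodory (mF n)) tF
  (measurable_hausdorff2_caratheodory mU)).
Qed.

HB.instance Definition _ := isMeasure.Build _ (pt R) R (@hausdorff2 R)
  hausdorff2_0 hausdorff2_ge0 hausdorff2_semi_sigma_additive.

End Hausdorff.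

(** * The boundary of a C^{1,1} domain *)

Section Frames.
Variable R : realType.
Implicit Types (x y z v : pt R).
Local Notation coord := Defs.coord.

Lemma coordD k x y : coord (x + y) k = coord x k + coord y k.
Proof. by case: k => -[|[|[|//]]] k3. Qed.

Lemma coordZ k (a : R) x : coord (a *: x) k = a * coord x k.
Proof. by case: k => -[|[|[|//]]] k3. Qed.

Lemma dotpC x y : dotp x y = dotp y x.
Proof. by apply: eq_bigr => k _; rewrite mulrC. Qed.

Lemma dotpDl x y z : dotp (x + y) z = dotp x z + dotp y z.
Proof. by rewrite !dotpE /=; ring. Qed.

Lemma dotpBl x y z : dotp (x - y) z = dotp x z - dotp y z.
Proof. by rewrite !dotpE /=; ring. Qed.

Lemma dotpZl (a : R) x z : dotp (a *: x) z = a * dotp x z.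
Proof. by rewrite !dotpE /= /GRing.scale /=; ring. Qed.

Lemma enorm2_dotp x : enorm x ^+ 2 = dotp x x.
Proof. by rewrite enorm2E dotpE !expr2. Qed.

Lemma enorm_ge0 x : 0 <= enorm x. Proof. exact: sqrtr_ge0. Qed.

Lemma enorm_eq0 x : enorm x = 0 -> x = 0.
Proof.
move=> /(congr1 (fun t => t ^+ 2)); rewrite enorm2E expr0n /= => /eqP.
rewrite !paddr_eq0 ?addr_ge0 ?sqr_ge0// !sqrf_eq0 => /andP[/andP[/eqP h1 /eqP h2] /eqP h3].
by case: x h1 h2 h3 => [[a b] c] /= -> -> ->.
Qed.

Lemma enormZ (a : R) x : enorm (a *: x) = `|a| * enorm x.
Proof.
rewrite /enorm dotpZl dotpC dotpZl mulrA -expr2 sqrtrM ?sqr_ge0// sqrtr_sqr.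
by [].
Qed.

(** Orthonormality of the frame reads [E E^T = 1]; for a square matrix this implies [E^T E = 1],
    which is completeness. *)
Lemma orthonormal_parseval (e : 'I_3 -> pt R) x y :
  (forall j k, dotp (e j) (e k) = (j == k)%:R) ->
  dotp x y = \sum_j dotp x (e j) * dotp y (e j).
Proof.
move=> ee; pose E : 'M[R]_3 := \matrix_(j, k) coord (e j) k.
have EE : E *m E^T = 1%:M.
  apply/matrixP => j k; rewrite !mxE -ee; apply: eq_bigr => l _.
  by rewrite !mxE.
have EE' := mulmx1C EE.
have dE z : \row_j dotp z (e j) = (\row_k coord z k) *m E^T.
  by apply/rowP => j; rewrite !mxE; apply: eq_bigr => l _; rewrite !mxE.
transitivity (((\row_k coord x k) *m (\row_k coord y k)^T) 0 0).
  by rewrite mxE; apply: eq_bigr => k _; rewrite !mxE.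
transitivity (((\row_j dotp x (e j)) *m (\row_j dotp y (e j))^T) 0 0).
  by rewrite !dE trmx_mul trmxK mulmxA -[X in _ = (X *m _) _ _]mulmxA EE' mulmx1.
by rewrite mxE; apply: eq_bigr => k _; rewrite !mxE.
Qed.

Lemma continuous_dotp v : continuous (fun y => dotp y v).
Proof.
under eq_fun do rewrite dotpE.
move=> y; apply: cvgD; [apply: cvgD|]; apply: cvgM; try exact: cvg_cst.
- exact: continuous_c11.
- exact: continuous_c12.
- exact: continuous_c2.
Qed.

Lemma continuous_enorm2B x : continuous (fun y => enorm (y - x) ^+ 2).
Proof.
rewrite (_ : (fun _ => _) = fun y => (y.1.1 - x.1.1) ^+ 2 + (y.1.2 - x.1.2) ^+ 2
    + (y.2 - x.2) ^+ 2); last by apply/funext => y; rewrite enorm2E.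
have sq (f : pt R -> R) (c : R) : continuous f -> continuous (fun y => (f y - c) ^+ 2).
  move=> cf y; have cB : f z - c @[z --> y] --> f y - c.
    by apply: cvgB; [exact: cf|exact: cvg_cst].
  exact: (cvgM cB cB).
move=> y; apply: cvgD; first apply: cvgD.
- exact: (sq (fun y => y.1.1) x.1.1 (@continuous_c11 R)).
- exact: (sq (fun y => y.1.2) x.1.2 (@continuous_c12 R)).
- exact: (sq (fun y => y.2) x.2 (@continuous_c2 R)).
Qed.

Lemma open_lt (f g : pt R -> R) : continuous f -> continuous g ->
  open [set y | f y < g y].
Proof.
move=> cf cg; rewrite (_ : [set y | _] = (fun y => g y - f y) @^-1` [set t | 0 < t]).
  apply: open_comp; last exact: open_gt.
  by move=> y _; apply: cvgB; [exact: cg|exact: cf].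
by apply/seteqP; split => y /=; rewrite subr_gt0.
Qed.

Lemma enorm_ltP x y (r : R) : 0 < r -> (enorm (y - x) < r) = (enorm (y - x) ^+ 2 < r ^+ 2).
Proof. by move=> r0; rewrite ltr_sqr ?nnegrE ?enorm_ge0// ltW. Qed.

Lemma open_eball x (r : R) : open [set y | enorm (y - x) < r].
Proof.
have [r0|r0] := ltP 0 r.
  rewrite (_ : [set y | _] = [set y | enorm (y - x) ^+ 2 < r ^+ 2]).
    by apply: open_lt; [exact: continuous_enorm2B|exact: cst_continuous].
  by apply/seteqP; split => y /=; rewrite enorm_ltP.
rewrite (_ : [set y | _] = set0); first exact: open0.
apply/seteqP; split => y //= h.
by have := le_lt_trans (enorm_ge0 _) h; rewrite ltNge r0.
Qed.

Lemma eball_center x (r : R) : 0 < r -> enorm (x - x) < r.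
Proof. by move=> r0; rewrite enorm_ltP// subrr enorm2E /= !expr0n !addr0 exprn_gt0. Qed.

Lemma open_eball_sub (U : set (pt R)) x : open U -> U x ->
  exists2 r : R, 0 < r & forall y, enorm (y - x) < r -> U y.
Proof.
rewrite openE => oU /oU /nbhs_ballP[r /= r0 rU]; exists r => // y yr; apply: rU.
have c k : `|coord x k - coord y k| < r.
  by rewrite distrC -coordB; apply: le_lt_trans yr; exact: coord_le_enorm.
have [[h0 h1] h2] := (c (inord 0), c (inord 1), c (inord 2)).
by move: h0 h1 h2; rewrite !coordE => ? ? ?; split; [split|].
Qed.

End Frames.

(** * Estimates for C^{1,1} functions of two variables *)

Section C11.
Variable R : realType.

Lemma mvt_bound (f f' : R -> R) (A B a b : R) : 0 <= B ->
  (forall x : R, is_derive x 1 f (f' x)) ->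
  (forall x, `|x - a| <= `|b - a| -> `|f' x - A| <= B) ->
  `|f b - f a - A * (b - a)| <= B * `|b - a|.
Proof.
move=> B0 df fB.
have cf : continuous f := is_derive_continuous df.
have mvt c d : c < d -> exists2 t, t \in `]c, d[ & f d - f c = f' t * (d - c).
  by move=> cd; apply: (MVT cd) => //; exact: continuous_subspaceT.
have key t : `|t - a| <= `|b - a| -> f b - f a = f' t * (b - a) ->
    `|f b - f a - A * (b - a)| <= B * `|b - a|.
  by move=> ta ->; rewrite -mulrBl normrM ler_wpM2r// fB.
have [ab|ba|->] := ltgtP a b.
- have [t] := mvt _ _ ab; rewrite in_itv/= => /andP[at_ tb]; apply: key.
  by rewrite !ger0_norm ?subr_ge0 ?ltW//; rewrite ltrD2r.
- have [t] := mvt _ _ ba; rewrite in_itv/= => /andP[bt ta] e; apply: (key t).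
    by rewrite !ltr0_norm ?subr_lt0// lerN2 lerD2r ltW.
  by rewrite -[LHS]opprB e -mulrN opprB.
- by rewrite !subrr mulr0 subrr normr0 mulr0.
Qed.

Variable h : R * R -> R.
Hypothesis C11h : C11_fun h.
Local Notation d1 := ('D_((1, 0) : R * R) h).
Local Notation d2 := ('D_((0, 1) : R * R) h).

Lemma is_derive_slice (p v : R * R) (t : R) :
  is_derive t 1 (fun s => h (s *: v + p)) ('D_v h (t *: v + p)).
Proof.
have [dh _] := C11h.
have /cvg_ex[l hl] := @diff_derivable _ _ _ h (t *: v + p) v (dh _).
have e : (fun s : R => s^-1 *: (((fun s => h (s *: v + p)) \o shift t) (s *: (1 : R))
      - h (t *: v + p))) =
    (fun s : R => s^-1 *: ((h \o shift (t *: v + p)) (s *: v) - h (t *: v + p))).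
  apply/funext => s /=; congr (_ *: (h _ - _)).
  have -> : s%:A = s :> R by rewrite /GRing.scale /= mulr1.
  by rewrite scalerDl -addrA.
split.
  by apply/cvg_ex; exists l; rewrite e.
by rewrite /derive e.
Qed.

Lemma is_derive_slice1 (c t : R) : is_derive t 1 (fun s => h (s, c)) (d1 (t, c)).
Proof.
have E (s : R) : (s, c) = s *: ((1, 0) : R * R) + (0, c).
  by congr (_, _); rewrite /= /GRing.scale /=; ring.
rewrite E (_ : (fun s => h (s, c)) = fun s => h (s *: ((1, 0) : R * R) + (0, c))).
  exact: is_derive_slice.
by apply/funext => s; rewrite E.
Qed.

Lemma is_derive_slice2 (c t : R) : is_derive t 1 (fun s => h (c, s)) (d2 (c, t)).
Proof.
have E (s : R) : (c, s) = s *: ((0, 1) : R * R) + (c, 0).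
  by congr (_, _); rewrite /= /GRing.scale /=; ring.
rewrite E (_ : (fun s => h (c, s)) = fun s => h (s *: ((0, 1) : R * R) + (c, 0))).
  exact: is_derive_slice.
by apply/funext => s; rewrite E.
Qed.

Lemma pair_norm_le (p : R * R) : `|p| <= `|p.1| + `|p.2|.
Proof. by rewrite prod_normE /= ge_max lerDl lerDr !normr_ge0. Qed.

Lemma C11_lip : exists2 L, 0 <= L & forall p q,
  `|d1 p - d1 q| <= L * (`|p.1 - q.1| + `|p.2 - q.2|) /\
  `|d2 p - d2 q| <= L * (`|p.1 - q.1| + `|p.2 - q.2|).
Proof.
have [_ [L HL]] := C11h; exists `|L| => // p q.
have [h1 h2] := HL p q.
have b : L * `|p - q| <= `|L| * (`|p.1 - q.1| + `|p.2 - q.2|).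
  apply: (@le_trans _ _ (`|L| * `|p - q|)); first by rewrite ler_wpM2r// ler_norm.
  by rewrite ler_wpM2l//; exact: pair_norm_le.
by split; [exact: le_trans h1 b|exact: le_trans h2 b].
Qed.

(** On the path from [p] to [q] through [(p.1, q.2)] each leg is an application of the mean value
    theorem in one variable; the Lipschitz bound compares the partial derivatives along it with
    those at [p]. *)
Lemma C11_taylor : exists2 L, 0 <= L & forall p q,
  `|h q - h p - (d1 p * (q.1 - p.1) + d2 p * (q.2 - p.2))| <=
  L * (`|q.1 - p.1| + `|q.2 - p.2|) ^+ 2.
Proof.
have [L L0 HL] := C11_lip; exists L => // -[p1 p2] [q1 q2] /=.
set a := `|q1 - p1|; set b := `|q2 - p2|.
have a0 : 0 <= a by exact: normr_ge0.
have b0 : 0 <= b by exact: normr_ge0.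
have B0 : 0 <= L * (a + b) by rewrite mulr_ge0// addr_ge0.
have s1 := mvt_bound (A := d1 (p1, p2)) (a := p1) (b := q1) B0 (is_derive_slice1 q2).
have {}s1 : `|h (q1, q2) - h (p1, q2) - d1 (p1, p2) * (q1 - p1)| <= L * (a + b) * a.
  apply: s1 => t ta; apply: le_trans (HL (t, q2) (p1, p2)).1 _.
  by rewrite ler_wpM2l// lerD2r.
have s2 := mvt_bound (A := d2 (p1, p2)) (a := p2) (b := q2) B0 (is_derive_slice2 p1).
have {}s2 : `|h (p1, q2) - h (p1, p2) - d2 (p1, p2) * (q2 - p2)| <= L * (a + b) * b.
  apply: s2 => t tb; apply: le_trans (HL (p1, t) (p1, p2)).2 _.
  by rewrite ler_wpM2l//= subrr normr0 add0r (le_trans tb)// lerDr.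
rewrite (_ : _ - _ - _ = (h (q1, q2) - h (p1, q2) - d1 (p1, p2) * (q1 - p1)) +
  (h (p1, q2) - h (p1, p2) - d2 (p1, p2) * (q2 - p2))); last by ring.
apply: le_trans (ler_normD _ _) _; apply: le_trans (lerD s1 s2) _.
by rewrite -mulrDr expr2 mulrA.
Qed.

(** On the square of half-side [M] both partial derivatives are at most [D], and the quadratic
    remainder is bounded linearly because [a + b <= 4 M]. *)
Lemma C11_lipschitz (M : R) : 0 <= M -> exists2 K, 0 <= K & forall p q,
  `|p.1| <= M -> `|p.2| <= M -> `|q.1| <= M -> `|q.2| <= M ->
  `|h q - h p| <= K * (`|q.1 - p.1| + `|q.2 - p.2|).
Proof.
move=> M0.
have aux1 (u v a b c : R) : v <= u + a -> u <= c -> 0 <= b -> v <= a + b + c.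
  by move=> *; lra.
have [L L0 HL] := C11_lip; have [L' L'0 HT] := C11_taylor.
pose D := `|d1 (0, 0)| + `|d2 (0, 0)| + L * (M + M).
have D0 : 0 <= D by rewrite !addr_ge0// mulr_ge0// addr_ge0.
exists (D + L' * (M *+ 4)); first by rewrite addr_ge0// mulr_ge0// mulrn_wge0.
move=> p q p1 p2 q1 q2; have := HT p q.
set a := `|q.1 - p.1|; set b := `|q.2 - p.2|; set T := _ + d2 p * _.
move=> hT.
have a0 : 0 <= a by exact: normr_ge0.
have b0 : 0 <= b by exact: normr_ge0.
have [l1 l2] := HL p (0, 0); rewrite /= !subr0 in l1 l2.
have LM : L * (`|p.1| + `|p.2|) <= L * (M + M) by rewrite ler_wpM2l// lerD.
have D1 : `|d1 p| <= D.
  have := ler_normD (d1 p - d1 (0, 0)) (d1 (0, 0)); rewrite subrK => t.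
  exact: aux1 t (le_trans l1 LM) (normr_ge0 _).
have D2 : `|d2 p| <= D.
  have := ler_normD (d2 p - d2 (0, 0)) (d2 (0, 0)); rewrite subrK => t.
  by rewrite /D [X in X + _]addrC; exact: aux1 t (le_trans l2 LM) (normr_ge0 _).
have hTn : `|T| <= D * (a + b).
  apply: le_trans (ler_normD _ _) _; rewrite !normrM mulrDr.
  by apply: lerD; [exact: (ler_wpM2r a0 D1)|exact: (ler_wpM2r b0 D2)].
have ab : a + b <= M *+ 4.
  have n1 := le_trans (ler_normB q.1 p.1) (lerD q1 p1).
  have n2 := le_trans (ler_normB q.2 p.2) (lerD q2 p2).
  by apply: le_trans (lerD n1 n2) _; rewrite -!mulr2n -mulrnA.
have : L' * (a + b) ^+ 2 <= L' * (M *+ 4) * (a + b).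
  by rewrite expr2 mulrA ler_wpM2r ?addr_ge0// ler_wpM2l.
move=> hT2; have := ler_normD (h q - h p - T) T; rewrite subrK mulrDl.
by move/le_trans; apply; rewrite addrC; apply: lerD => //; exact: le_trans hT hT2.
Qed.

Lemma continuous_C11 : continuous h.
Proof. by move=> p; apply: differentiable_continuous; have [dh _] := C11h. Qed.

Lemma lip_continuous (g : R * R -> R) (L : R) : 0 <= L ->
  (forall p q, `|g p - g q| <= L * (`|p.1 - q.1| + `|p.2 - q.2|)) -> continuous g.
Proof.
move=> L0 gL p; apply/cvgrPdist_le => eps e0.
pose d := eps / (L + L + 1).
have d0 : 0 < d by rewrite divr_gt0//; lra.
suff : \forall q \near nbhs (p : R * R), `|g p - g q| <= eps by [].
apply/nbhs_ballP; exists d => // q [/ltW /= q1 /ltW /= q2].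
apply: le_trans (gL p q) _.
apply: (@le_trans _ _ (L * (d + d))); first by rewrite ler_wpM2l// lerD.
rewrite (_ : L * (d + d) = eps * ((L + L) / (L + L + 1))); last first.
  by rewrite /d; field; lra.
apply: ler_piMr; first exact: ltW.
by rewrite ler_pdivrMr; lra.
Qed.

Lemma continuous_d1 : continuous d1.
Proof.
have [L L0 HL] := C11_lip; apply: (@lip_continuous _ L L0) => p q.
exact: (HL p q).1.
Qed.

Lemma continuous_d2 : continuous d2.
Proof.
have [L L0 HL] := C11_lip; apply: (@lip_continuous _ L L0) => p q.
exact: (HL p q).2.
Qed.

End C11.

(** * Charts and the outer normal *)

Section OuterNormal.
Variables (R : realType) (Om : set (pt R)).
Implicit Types (x y z v w : pt R).
Local Notation coord := Defs.coord.

(** For distinct unit vectors, [w = v' - v] satisfies [w . v < 0 < w . v']. A short step from [x]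
    along [w] would lead inside by the first normal and outside by the second. *)
Lemma outer_normal_unique x v v' :
  is_outer_normal Om x v -> is_outer_normal Om x v' -> v = v'.
Proof.
move=> [nv Hv] [nv' Hv']; apply/eqP; rewrite eq_sym -subr_eq0; apply/negPn/negP => wn0.
set w := v' - v in wn0.
have w0 : 0 < enorm w.
  by rewrite lt_def enorm_ge0 andbT; apply: contra_neq wn0; exact: enorm_eq0.
have dv : dotp v v = 1 by rewrite -enorm2_dotp nv expr1n.
have dv' : dotp v' v' = 1 by rewrite -enorm2_dotp nv' expr1n.
have w2 : enorm w ^+ 2 = 2 - 2 * dotp v v'.
  by rewrite enorm2_dotp dotpBl !(dotpC _ w) !dotpBl dv dv' (dotpC v' v); ring.
have wv : dotp w v = - (enorm w ^+ 2 / 2) by rewrite w2 dotpBl dv dotpC; field.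
have wv' : dotp w v' = enorm w ^+ 2 / 2 by rewrite w2 dotpBl dv'; field.
(* Since [w . v = - |w|^2 / 2] and [w . v' = |w|^2 / 2], any opening below [|w| / 2] will do. *)
have e0 : 0 < enorm w / 4 by rewrite divr_gt0.
have [d1 d10 H1] := Hv _ e0; have [d2 d20 H2] := Hv' _ e0.
pose t := Num.min d1 d2 / 2 / enorm w.
have t0 : 0 < t by rewrite !divr_gt0// lt_min d10.
have yx : (x + t *: w) - x = t *: w by rewrite addrC addKr.
have et : enorm (t *: w) = Num.min d1 d2 / 2.
  by rewrite enormZ gtr0_norm// /t divfK// gt_eqF.
have m0 : 0 < Num.min d1 d2 by rewrite lt_min d10.
have [l1 l2] : Num.min d1 d2 <= d1 /\ Num.min d1 d2 <= d2 by rewrite !ge_min !lexx orbT.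
have q0 : 0 < t * enorm w ^+ 2 by rewrite mulr_gt0// exprn_gt0.
have z1 : enorm ((x + t *: w) - x) < d1 by rewrite yx et; lra.
have z2 : enorm ((x + t *: w) - x) < d2 by rewrite yx et; lra.
have O := (H1 _ z1).1; have nO := (H2 _ z2).2.
rewrite yx enormZ gtr0_norm// dotpZl wv in O.
rewrite yx enormZ gtr0_norm// dotpZl wv' in nO.
have eqt : enorm w / 4 * (t * enorm w) = t * enorm w ^+ 2 / 4 by ring.
by apply: nO; [rewrite eqt; lra|apply: O; rewrite eqt; lra].
Qed.

Hypothesis oOm : open Om.

Section Chart.
Variables (x0 : pt R) (r : R) (e : 'I_3 -> pt R) (h : R * R -> R).
Hypothesis r0 : 0 < r.
Hypothesis ee : forall j k, dotp (e j) (e k) = (j == k)%:R.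
Hypothesis C11h : C11_fun h.
Local Notation c0 y := (dotp y (e (inord 0))).
Local Notation c1 y := (dotp y (e (inord 1))).
Local Notation c2 y := (dotp y (e (inord 2))).
Local Notation foot y := (c0 y, c1 y).
Local Notation d1 := ('D_((1, 0) : R * R) h).
Local Notation d2 := ('D_((0, 1) : R * R) h).
Hypothesis OmE : forall y, enorm (y - x0) < r -> (Om y <-> c2 y < h (foot y)).

Let continuous_foot : continuous (fun y : pt R => foot y).
Proof.
by move=> y; apply: (@cvg_pair _ _ _ _ (nbhs (c0 y)) (nbhs (c1 y)));
  exact: continuous_dotp.
Qed.

Let continuous_hfoot (g : R * R -> R) : continuous g -> continuous (fun y => g (foot y)).
Proof.
move=> cg y; apply: (@continuous_comp _ _ _ (fun y => foot y) g).
  exact: continuous_foot.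
exact: cg.
Qed.

Lemma chart_bdry y : bdry Om y -> enorm (y - x0) < r -> c2 y = h (foot y).
Proof.
move=> [cOm nI] yr.
have ch := continuous_hfoot (continuous_C11 C11h).
have [lt|gt|//] := ltgtP (c2 y) (h (foot y)).
- exfalso; apply: nI; move: oOm; rewrite openE; apply.
  exact/OmE.
- exfalso.
  have oV : open ([set z | enorm (z - x0) < r] `&` [set z | h (foot z) < c2 z]).
    by apply: openI; [exact: open_eball|exact: open_lt ch (@continuous_dotp _ _)].
  have [z [Omz [/= zr hz]]] := cOm _ (open_nbhs_nbhs (conj oV (conj yr gt))).
  by have := (OmE zr).1 Omz; rewrite ltNge (ltW hz).
Qed.

Let s y : R := Num.sqrt (1 + d1 (foot y) ^+ 2 + d2 (foot y) ^+ 2).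
(** The upward unit normal [(- grad h, 1) / sqrt (1 + |grad h|^2)] of the graph, in the coordinates
    of the frame. It makes sense at every point, not only on the boundary, so continuity can be
    stated globally. *)
Definition chart_normal y : pt R :=
  (s y)^-1 *: (- d1 (foot y) *: e (inord 0) - d2 (foot y) *: e (inord 1) + e (inord 2)).

Let s2 y : s y ^+ 2 = 1 + d1 (foot y) ^+ 2 + d2 (foot y) ^+ 2.
Proof. by rewrite sqr_sqrtr// !addr_ge0 ?sqr_ge0. Qed.

Let s_ge1 y : 1 <= s y.
Proof.
rewrite -[leLHS]sqrtr1 ler_sqrt; last by rewrite !addr_ge0 ?sqr_ge0.
by rewrite -addrA lerDl addr_ge0 ?sqr_ge0.
Qed.

Let dot_e (j k : nat) : (j < 3)%N -> (k < 3)%N ->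
  dotp (e (inord j)) (e (inord k)) = (j == k)%:R.
Proof.
move=> j3 k3; rewrite ee; congr (nat_of_bool _)%:R.
by apply/eqP/eqP => [/(congr1 val)/=|->//]; rewrite !inordK.
Qed.

Let dot_normal w y :
  s y * dotp w (chart_normal y) = c2 w - d1 (foot y) * c0 w - d2 (foot y) * c1 w.
Proof.
have sn0 : s y != 0 by rewrite gt_eqF// (lt_le_trans ltr01).
rewrite (dotpC w) /chart_normal dotpZl mulVKf// !dotpDl -scaleNr !dotpZl !(dotpC _ w).
by ring.
Qed.

Let frame_normal y : (c0 (chart_normal y) = (s y)^-1 * - d1 (foot y)) *
  (c1 (chart_normal y) = (s y)^-1 * - d2 (foot y)) * (c2 (chart_normal y) = (s y)^-1).
Proof.
rewrite /chart_normal -scaleNr.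
have E j : (j < 3)%N -> dotp (- d1 (foot y) *: e (inord 0) + - d2 (foot y) *: e (inord 1)
    + e (inord 2)) (e (inord j)) = - d1 (foot y) * (0 == j :> nat)%:R
    + - d2 (foot y) * (1 == j :> nat)%:R + (2 == j :> nat)%:R.
  by move=> j3; rewrite !dotpDl !dotpZl !dot_e.
rewrite !dotpZl !E//=; move: (d1 _) (d2 _) (_^-1) => a b c.
by rewrite !(mulr0, mulr1, addr0, add0r).
Qed.

Let enorm_normal y : enorm (chart_normal y) = 1.
Proof.
have s0 : 0 < s y by exact: lt_le_trans (s_ge1 y).
apply/eqP; rewrite -(@eqrXn2 _ 2) ?enorm_ge0// expr1n enorm2_dotp.
apply/eqP; apply: (mulfI (lt0r_neq0 s0)).
rewrite dot_normal !frame_normal mulr1; apply: (mulfI (lt0r_neq0 s0)).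
rewrite -expr2 s2; move: (d1 _) (d2 _) => a b; field; exact: lt0r_neq0.
Qed.

Let frame_le w j : `|dotp w (e j)| <= enorm w.
Proof.
rewrite -ler_sqr ?nnegrE ?enorm_ge0// enorm2_dotp (orthonormal_parseval w w ee).
rewrite real_normK ?num_real// (bigD1 j)//= -expr2 lerDl; apply: sumr_ge0 => i _.
by rewrite -expr2 sqr_ge0.
Qed.

(** [s y] times [dotp w (chart_normal y)] is the height of [z = y + w] over the tangent plane at
    [y], and the graph stays within [eps |w|] of that plane. As [s y >= 1], the factor preserves
    both strict inequalities. *)
Lemma chart_is_outer_normal y : bdry Om y -> enorm (y - x0) < r ->
  is_outer_normal Om y (chart_normal y).
Proof.
have negm (a t : R) : 1 <= a -> t <= 0 -> a * t <= t by move=> *; nra.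
move=> by_ yr; split; first exact: enorm_normal.
move=> eps eps0; have [L L0 HL] := C11_taylor C11h.
have [r' r'0 Hr'] := open_eball_sub (@open_eball R x0 r) yr.
have eL : 0 < eps / (4 * L + 1) by rewrite divr_gt0//; lra.
(* Frame coordinates of [w] are at most [|w|], so the Taylor remainder is at most [4 L |w|^2]; this
   radius brings it below [eps |w|]. *)
exists (Num.min r' (eps / (4 * L + 1))); first by rewrite lt_min r'0.
move=> z; rewrite lt_min => /andP[zr' zeps].
have zr := Hr' z zr'; have yh := chart_bdry by_ yr.
set w := z - y in zr' zeps *.
have Hs := dot_normal w y.
have n0 := enorm_ge0 w.
have rem : `|h (foot z) - h (foot y) - (d1 (foot y) * c0 w + d2 (foot y) * c1 w)| <=
    eps * enorm w.
  have := HL (foot y) (foot z); rewrite /= -!dotpBl -/w => /le_trans; apply.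
  apply: (@le_trans _ _ (L * (enorm w + enorm w) ^+ 2)).
    rewrite ler_wpM2l// lerXn2r ?nnegrE ?addr_ge0//.
    by rewrite lerD// frame_le.
  have -> : L * (enorm w + enorm w) ^+ 2 = (4 * L * enorm w) * enorm w by ring.
  rewrite ler_wpM2r//; move: zeps; rewrite ltr_pdivlMr; last lra.
  by nra.
have zc : c2 z = c2 w + c2 y by rewrite dotpBl subrK.
have sge := s_ge1 y.
move: rem; rewrite ler_norml => /andP[rem1 rem2].
split=> [neg|pos].
- apply/(OmE zr); rewrite zc yh.
  have : s y * dotp w (chart_normal y) < - (eps * enorm w).
    apply: (@le_lt_trans _ _ (dotp w (chart_normal y))) => //.
    apply: negm => //; rewrite (le_trans (ltW neg))// oppr_le0 mulr_ge0//; exact: ltW.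
  by rewrite Hs; move: rem1 rem2; move: (d1 _) (d2 _) => a b; lra.
- move=> /(OmE zr); rewrite zc yh.
  have : eps * enorm w < s y * dotp w (chart_normal y).
    apply: (@lt_le_trans _ _ (dotp w (chart_normal y))) => //.
    by rewrite ler_peMl// (le_trans _ (ltW pos))// mulr_ge0// ltW.
  by rewrite Hs; move: rem1 rem2; move: (d1 _) (d2 _) => a b; lra.
Qed.

Lemma chart_normal_continuous k : continuous (fun y => coord (chart_normal y) k).
Proof.
have cd1 := continuous_hfoot (continuous_d1 C11h).
have cd2 := continuous_hfoot (continuous_d2 C11h).
have -> : (fun y => coord (chart_normal y) k) = fun y => (s y)^-1 *
   (- d1 (foot y) * coord (e (inord 0)) k - d2 (foot y) * coord (e (inord 1)) k
    + coord (e (inord 2)) k).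
  by apply/funext => y; rewrite /chart_normal coordZ !coordD -scaleNr !coordZ !mulNr.
have cs : continuous s.
  move=> y; apply: (@continuous_comp _ _ _
    (fun y => 1 + d1 (foot y) ^+ 2 + d2 (foot y) ^+ 2) (@Num.sqrt R)); last exact: sqrt_continuous.
  apply: cvgD; first apply: cvgD; first exact: cvg_cst.
    exact: (cvgM (cd1 y) (cd1 y)).
  exact: (cvgM (cd2 y) (cd2 y)).
move=> y; apply: cvgM.
  by apply: cvgV; [rewrite gt_eqF// (lt_le_trans ltr01)|exact: cs].
apply: cvgD; last exact: cvg_cst.
apply: cvgB; (apply: cvgM; last exact: cvg_cst); last exact: cd2.
by apply: cvgN; exact: cd1.
Qed.

Let M := enorm x0 + r.

Let M0 : 0 < M.
Proof. by rewrite ltr_wpDl ?enorm_ge0. Qed.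

Let coord_foot y (j : 'I_3) : enorm (y - x0) < r -> `|dotp y (e j)| <= M.
Proof.
move=> yr; rewrite -(subrK x0 y) dotpDl; apply: le_trans (ler_normD _ _) _.
by rewrite /M addrC; apply: lerD; [exact: frame_le|apply: le_trans (ltW yr); exact: frame_le].
Qed.

(* The graph over a square of side [2 M] is cut into [(N + 2)^2] pieces over
   squares of side [2 M / (N + 1)], each of squared diameter at most
   [(2 + 4 K^2) (2 M / (N + 1))^2]. *)
Lemma hausdorff2_chart : (hausdorff2 (bdry Om `&` [set y | (enorm (y - x0) < r)%R]) < +oo)%E.
Proof.
have [K K0 HK] := C11_lipschitz C11h (ltW M0).
pose c := 2 + 4 * K ^+ 2.
have cge2 : 2 <= c by rewrite lerDl mulr_ge0// sqr_ge0.
(* The last factor 4 absorbs [(N + 2)^2 <= 4 (N + 1)^2], which makes the bound independent of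
   [del]. *)
pose B := pi / 4 * (c * (2 * M) ^+ 2) * 4.
suff : (hausdorff2 (bdry Om `&` [set y | (enorm (y - x0) < r)%R]) <= B%:E)%E.
  by move=> /le_lt_trans; apply; exact: ltry.
apply: ge_ereal_sup => _ [del /= del0 <-].
(* This choice gives [d (c + 1) < del], hence [c d^2 <= (c + 1)^2 d^2 <= del^2], without the square
   root of [c]. *)
pose N := Num.truncn (2 * M * (c + 1) / del).
pose d := 2 * M / N.+1%:R.
have N0 : 0 < N.+1%:R :> R by rewrite ltr0n.
have d0 : 0 < d by rewrite divr_gt0// mulr_gt0.
have ddel : d * (c + 1) < del.
  have := truncnS_gt (2 * M * (c + 1) / del); rewrite -/N ltr_pdivrMr// => H.
  by rewrite /d mulrAC ltr_pdivrMr// [ltRHS]mulrC.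
have cd : c * d ^+ 2 <= del ^+ 2.
  apply: (@le_trans _ _ ((d * (c + 1)) ^+ 2)).
    have -> : (d * (c + 1)) ^+ 2 = (c + 1) ^+ 2 * d ^+ 2 by ring.
    apply: ler_wpM2r; first exact: sqr_ge0.
    by move: cge2; move: (c) => b b2; nra.
  by rewrite ler_sqr ?nnegrE ?(ltW ddel)// ?(ltW del0)// mulr_ge0 ?ltW//; lra.
(* The endpoint [t = M] has index [N + 1], hence [N + 2] cells in each direction. *)
have cell t : `|t| <= M -> exists2 i : nat, (i < N.+2)%N &
    i%:R * d <= t + M /\ t + M < i.+1%:R * d.
  rewrite ler_norml => /andP[t1 t2].
  have tM : 0 <= (t + M) / d by rewrite divr_ge0 ?(ltW d0)//; lra.
  exists (Num.truncn ((t + M) / d)).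
    rewrite ltnS truncn_le_nat.
    rewrite ltr_pdivrMr// -[N.+1.+1]addn1 natrD mulrDl mul1r.
    by rewrite {1}/d mulrCA divff ?gt_eqF// mulr1; lra.
  have /andP[h1 h2] := truncn_itv tM.
  by rewrite -ler_pdivlMr// -ltr_pdivrMr//.
(* The quotient and the remainder of [k] by [N + 2] index the two directions; pieces with
   [k >= (N + 2)^2] are empty. *)
pose piece (k : nat) : set (pt R) := [set y |
  [/\ (k < N.+2 * N.+2)%N, bdry Om y, enorm (y - x0) < r,
  ((k %/ N.+2)%:R * d <= c0 y + M /\ c0 y + M < (k %/ N.+2).+1%:R * d) &
  ((k %% N.+2)%:R * d <= c1 y + M /\ c1 y + M < (k %% N.+2).+1%:R * d)]].
have near_ (u v b : R) (i : nat) : i%:R * d <= u + b /\ u + b < i.+1%:R * d ->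
    i%:R * d <= v + b /\ v + b < i.+1%:R * d -> `|u - v| <= d.
  rewrite -natr1 mulrDl mul1r; move: (_ * d) => id [? ?] [? ?].
  by rewrite ler_norml; apply/andP; split; lra.
have pdiam k : (sqdiam (piece k) <= (c * d ^+ 2)%:E)%E.
  apply: sqdiam_le => [|y z [_ by_ yr y1 y2] [_ bz zr z1 z2]].
    by rewrite mulr_ge0 ?sqr_ge0//; lra.
  rewrite enorm2_dotp (orthonormal_parseval _ _ ee) sum3 -!expr2 !dotpBl.
  rewrite (chart_bdry by_ yr) (chart_bdry bz zr).
  have n1 := near_ _ _ _ _ y1 z1; have n2 := near_ _ _ _ _ y2 z2.
  have sqle (a b : R) : `|a| <= b -> a ^+ 2 <= b ^+ 2.
    move=> ab; rewrite -(real_normK (num_real a)) ler_sqr ?nnegrE//.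
    exact: le_trans ab.
  have n3 : `|h (foot y) - h (foot z)| <= K * (d + d).
    apply: le_trans (HK (foot z) (foot y) _ _ _ _) _; rewrite /= ?coord_foot//.
    by rewrite ler_wpM2l// lerD.
  have -> : c * d ^+ 2 = d ^+ 2 + d ^+ 2 + (K * (d + d)) ^+ 2 by rewrite /c; ring.
  by rewrite !lerD// sqle.
have pi4 : (0 : R) <= pi / 4 by rewrite divr_ge0// pi_ge0.
have t0 k : (0 <= (pi / 4)%:E * sqdiam (piece k))%E.
  by rewrite mule_ge0 ?lee_fin// sqdiam_ge0.
apply: (@le_trans _ _ (\sum_(0 <= k <oo) (pi / 4)%:E * sqdiam (piece k))%E).
  apply: ereal_inf_lbound; exists piece => //; split; last first.
    by move=> k; apply: le_trans (pdiam k) _; rewrite lee_fin.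
  move=> y [by_ yr].
  have [i iN i1] := cell _ (coord_foot (inord 0) yr).
  have [j jN j1] := cell _ (coord_foot (inord 1) yr).
  exists (i * N.+2 + j)%N => //; rewrite /piece /=.
  by rewrite divnMDl// divn_small// addn0 modnMDl modn_small//; split => //;
    rewrite -ltn_divLR// divnMDl// divn_small// addn0.
have -> : (\sum_(0 <= k <oo) (pi / 4)%:E * sqdiam (piece k))%E =
    (\sum_(0 <= k < N.+2 * N.+2) (pi / 4)%:E * sqdiam (piece k))%E.
  rewrite (nneseries_split _ (N.+2 * N.+2)) => [|//].
  rewrite add0n eseries0 ?adde0// => k Nk _.
  rewrite (_ : piece k = set0) ?sqdiam0 ?mule0//.
  by apply/seteqP; split => // y []; rewrite ltnNge Nk.
apply: (@le_trans _ _ (\sum_(0 <= k < N.+2 * N.+2) (pi / 4 * (c * d ^+ 2))%:E)%E).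
  apply: lee_sum => k _; rewrite (EFinM (pi / 4) (c * d ^+ 2)).
  by apply: lee_wpmul2l; [rewrite lee_fin|exact: pdiam].
rewrite sumEFin lee_fin big_const_nat subn0 iter_addr_0 -[leLHS]mulr_natr /B.
have NN : N.+2%:R <= 2 * N.+1%:R :> R by rewrite -natrM ler_nat mul2n -addnn addSn ltnS leq_addl.
have dN : d ^+ 2 * (N.+2 * N.+2)%:R <= (2 * M) ^+ 2 * 4.
  apply: (@le_trans _ _ (d ^+ 2 * (2 * N.+1%:R) ^+ 2)).
    apply: ler_wpM2l; first exact: sqr_ge0.
    by rewrite natrM -expr2 lerXn2r ?nnegrE// mulr_ge0.
  by rewrite le_eqVlt; apply/orP; left; apply/eqP; rewrite /d; field; exact: lt0r_neq0.
have -> : pi / 4 * (c * d ^+ 2) * (N.+2 * N.+2)%:R =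
    (pi / 4 * c) * (d ^+ 2 * (N.+2 * N.+2)%:R) by rewrite !mulrA.
have -> : pi / 4 * (c * (2 * M) ^+ 2) * 4 = (pi / 4 * c) * ((2 * M) ^+ 2 * 4) by ring.
apply: ler_wpM2l => //; apply: mulr_ge0 => //.
by apply: le_trans cge2.
Qed.

End Chart.

(** * From charts to the whole boundary *)

Definition outer_normal y : pt R := xget 0 [set v | is_outer_normal Om y v].

Lemma outer_normalP y v : is_outer_normal Om y v -> outer_normal y = v.
Proof.
move=> yv; apply: (@outer_normal_unique y) => //.
exact: (xgetI (P := [set v | is_outer_normal Om y v]) 0 yv).
Qed.

Lemma closed_bdry : closed (bdry Om).
Proof.
by apply: closedI; [exact: closed_closure|exact/open_closedC/open_interior].
Qed.

Lemma measurable_bdry : measurable (bdry Om).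
Proof. by apply: closed_measurable3; exact: closed_bdry. Qed.

(** What surface integrals require of the boundary, stated for a piece of it: all three properties
    survive finite unions and hold in every chart. *)
Definition regular_piece (V : set (pt R)) : Prop :=
  [/\ (hausdorff2 (bdry Om `&` V) < +oo)%E,
      forall k, measurable_fun (bdry Om `&` V) (fun y => coord (outer_normal y) k) &
      forall y, (bdry Om `&` V) y -> is_outer_normal Om y (outer_normal y)].

Lemma regular_pieceU V W : measurable V -> measurable W ->
  regular_piece V -> regular_piece W -> regular_piece (V `|` W).
Proof.
have mb := measurable_bdry => mV mW [V1 V2 V3] [W1 W2 W3].
split; rewrite setIUr.
- apply: le_lt_trans (outer_measureU2 _ _ _) _; exact: lte_add_pinfty.
- by move=> k; apply/measurable_funU; [exact: measurableI|exact: measurableI|].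
- by move=> y [/V3|/W3].
Qed.

Lemma regular_piece0 : regular_piece set0.
Proof.
split; rewrite setI0 ?outer_measure0//.
by move=> k; exact: measurable_fun_set0.
Qed.

Hypothesis C11Om : C11_domain Om.

Lemma regular_piece_local x : bdry Om x -> exists V, [/\ open V, V x & regular_piece V].
Proof.
move=> /C11Om[r [e [h [r0 ee C11h OmE]]]]; exists [set y | enorm (y - x) < r]; split.
- exact: open_eball.
- exact: eball_center.
- have N y : (bdry Om `&` [set y | enorm (y - x) < r]) y ->
      is_outer_normal Om y (chart_normal e h y).
    by move=> [by_ yr]; exact: (chart_is_outer_normal ee C11h OmE by_ yr).
  split.
  + exact: (hausdorff2_chart r0 ee C11h OmE).
  + move=> k; have E : {in bdry Om `&` [set y | enorm (y - x) < r],
        (fun y => coord (chart_normal e h y) k) =1 (fun y => coord (outer_normal y) k)}.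
      by move=> y; rewrite inE => /N/outer_normalP->.
    apply: (iffLR (measurable_fun_eqP _ E)).
    apply: measurable_funTS; apply: continuous_measurable3.
    exact: chart_normal_continuous.
  + by move=> y /N Ny; rewrite (outer_normalP Ny).
Qed.

Hypothesis bOm : bounded_set Om.

Lemma bounded_cbox : exists M : R, Om `<=` cbox (- M, - M, - M) (M, M, M).
Proof.
have [M [Mr HM]] := bOm; exists (M + 1) => x Omx.
have := HM (M + 1) _ x Omx; rewrite ltrDl => /(_ ltr01) /=.
by rewrite !prod_normE /= !ge_max -andbA !ler_norml => /and3P[? ? ?].
Qed.

Lemma closed_cbox (a b : pt R) : closed (cbox a b).
Proof. by apply: compact_closed; [exact: norm_hausdorff|exact: compact_cbox]. Qed.

Lemma compact_bdry : compact (bdry Om).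
Proof.
have [M OmM] := bounded_cbox.
apply: (subclosed_compact closed_bdry (@compact_cbox R (- M, - M, - M) (M, M, M))).
move=> x [cx _]; have := closure_subset OmM cx.
by rewrite -(closure_id _).1//; exact: closed_cbox.
Qed.

(** Compactness in filter form. If no open regular piece covered the boundary, the complements of
    such pieces in it would generate a proper filter; near a cluster point a chart is itself such a
    piece, a contradiction. *)
Lemma regular_bdry : regular_piece setT.
Proof.
pose good := [set W | open W /\ regular_piece W].
suff [W [_ rW] bW] : exists2 W, good W & bdry Om `<=` W.
  by move: rW; rewrite /regular_piece setIT (setIidl bW).
apply: contrapT => nW.
pose F : set_system (pt R) := [set S | exists2 W, good W & bdry Om `\` W `<=` S].
have FF : ProperFilter F.
  split.
    move=> [W gW bW]; apply: nW; exists W => // x bx; apply: contrapT => nWx.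
    by have := bW x (conj bx nWx).
  split.
  - by exists set0 => //; split; [exact: open0|exact: regular_piece0].
  - move=> S S' [W [oW rW] WS] [W' [oW' rW'] WS']; exists (W `|` W').
      by split; [exact: openU|apply: regular_pieceU => //; exact: open_measurable3].
    by move=> x [bx nx]; split; [apply: WS|apply: WS']; split => // h; apply: nx;
      [left|right].
  - by move=> S S' SS' [W gW WS]; exists W => //; exact: subset_trans SS'.
have [|x [bx clx]] := compact_bdry FF.
  exists set0; last by move=> x [].
  by split; [exact: open0|exact: regular_piece0].
have [V [oV Vx rV]] := regular_piece_local bx.
have [|y [[_ nVy] Vy]] := clx (bdry Om `\` V) V _ (open_nbhs_nbhs (conj oV Vx)).
  by exists V.
exact: nVy.
Qed.

Lemma hausdorff2_bdry_lty : (hausdorff2 (bdry Om) < +oo)%E.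
Proof. by have [+ _ _] := regular_bdry; rewrite setIT. Qed.

Lemma measurable_outer_normal k :
  measurable_fun (bdry Om) (fun y => coord (outer_normal y) k).
Proof. by have [_ + _] := regular_bdry; rewrite setIT; apply. Qed.

Lemma enorm_outer_normal y : bdry Om y -> enorm (outer_normal y) = 1.
Proof. by have [_ _ +] := regular_bdry; rewrite setIT => H /H[]. Qed.

End OuterNormal.

(** * Square integrable vector fields and weak derivatives *)

Section ComplexLimits.
Variable R : realType.
Local Notation C := R[i].
Implicit Types (z w : nat -> C) (a b l : C).

(** The shape in which the convergence of a complex series occurs in [TH_acts]. *)
Definition cvgC z l : Prop := sqmod (z n - l) @[n --> \oo] --> (0 : R).

Lemma cvgC_ReIm z l : cvgC z l <->
  complex.Re (z n) @[n --> \oo] --> complex.Re l /\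
  complex.Im (z n) @[n --> \oo] --> complex.Im l.
Proof.
split=> [zl|[zr zi]]; last first.
  have := cvg_sqmodB (z := l) zr zi; rewrite subrr /cvgC.
  have -> : sqmod (0 : C) = 0 by rewrite /sqmod /= expr0n addr0.
  by under eq_fun do rewrite -sqmodN opprB.
have sqrt_cvg (u : nat -> R) (c : R) :
    (forall n, (u n - c) ^+ 2 <= sqmod (z n - l)) -> u @ \oo --> c.
  move=> ule; apply/cvgrPdist_le => e e0.
  have /cvgrPdist_le/(_ (e ^+ 2)) := zl; rewrite exprn_gt0// => /(_ isT).
  apply: filterS => n; rewrite sub0r normrN ger0_norm ?sqmod_ge0// => h.
  rewrite distrC -ler_sqr ?nnegrE ?(ltW e0)// real_normK ?num_real//.
  exact: le_trans (ule n) h.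
by split; apply: sqrt_cvg => n; rewrite /sqmod !ReImE ?lerDl ?lerDr sqr_ge0.
Qed.

Lemma cvgC_unique z l l' : cvgC z l -> cvgC z l' -> l = l'.
Proof.
move=> /cvgC_ReIm[r1 i1] /cvgC_ReIm[r2 i2].
by apply: eqC; [exact: cvg_unique r1 r2|exact: cvg_unique i1 i2].
Qed.

Lemma cvgC_cst l : cvgC (fun=> l) l.
Proof. by apply/cvgC_ReIm; split; exact: cvg_cst. Qed.

Lemma cvgCD z w l l' : cvgC z l -> cvgC w l' -> cvgC (fun n => z n + w n) (l + l').
Proof.
move=> /cvgC_ReIm[r1 i1] /cvgC_ReIm[r2 i2]; apply/cvgC_ReIm; rewrite !ReImE.
by split; under eq_fun do rewrite !ReImE; exact: cvgD.
Qed.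

Lemma cvgCM a z l : cvgC z l -> cvgC (fun n => a * z n) (a * l).
Proof.
move=> /cvgC_ReIm[r i]; apply/cvgC_ReIm; rewrite !ReImE.
by split; under eq_fun do rewrite !ReImE;
  [apply: cvgB|apply: cvgD]; (apply: cvgM => //; exact: cvg_cst).
Qed.

Lemma cvgCN z l : cvgC z l -> cvgC (fun n => - z n) (- l).
Proof.
move=> /(cvgCM (-1)); rewrite mulN1r.
by rewrite (_ : (fun n => -1 * z n) = fun n => - z n)//; apply/funext => n; rewrite mulN1r.
Qed.

Lemma cvgC_squeeze z l (u : nat -> R) : (forall n, sqmod (z n - l) <= u n) ->
  u @ \oo --> (0 : R) -> cvgC z l.
Proof.
move=> zu u0; apply: (@squeeze_cvgr _ _ _ _ (fun=> 0) u) => //; last exact: cvg_cst.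
by apply: nearW => n; rewrite sqmod_ge0 zu.
Qed.

End ComplexLimits.

Section VectorL2.
Variables (R : realType) (mu : {measure set (pt R) -> \bar R}) (D : set (pt R)).
Hypothesis mD : measurable D.
Local Notation C := R[i].
Local Notation vfield := (vfield R).
Implicit Types (u v w : vfield) (f g : pt R -> C).

Definition lin (a : C) u w : vfield := fun x => a *: u x + w x.

Lemma linE a u w x k : lin a u w x 0 k = a * u x 0 k + w x 0 k.
Proof. by rewrite !mxE. Qed.

Lemma conjfE u x k : conjf u x 0 k = conjc (u x 0 k).
Proof. by rewrite !mxE. Qed.

Lemma conjfK u : conjf (conjf u) = u.
Proof.
by apply/funext => x; apply/rowP => k; rewrite !conjfE conjcK.
Qed.

Lemma L2v_lin a u w : L2v mu D u -> L2v mu D w -> L2v mu D (lin a u w).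
Proof.
move=> Lu Lw k; rewrite (_ : (fun x => _) = fun x => a * u x 0 k + w x 0 k).
  by apply: L2D => //; exact: L2Z.
by apply/funext => x; rewrite linE.
Qed.

Lemma L2v_conj u : L2v mu D u -> L2v mu D (conjf u).
Proof.
move=> Lu k; rewrite (_ : (fun x => _) = fun x => conjc (u x 0 k)).
  exact: L2_conj.
by apply/funext => x; rewrite conjfE.
Qed.

Lemma cintg_cdot u w : L2v mu D u -> L2v mu D w ->
  cintg mu D (fun x => cdot (u x) (w x)).
Proof. by move=> Lu Lw; apply: cintg_sum => // k _; exact: L2_mul. Qed.

Lemma cint_cdot_lin a u v w : L2v mu D u -> L2v mu D v -> L2v mu D w ->
  cint mu D (fun x => cdot (lin a u v x) (w x)) =
  a * cint mu D (fun x => cdot (u x) (w x)) + cint mu D (fun x => cdot (v x) (w x)).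
Proof.
move=> Lu Lv Lw; rewrite -cintZ//; last exact: cintg_cdot.
rewrite -cintD//; [|by apply: cintgZ => //; exact: cintg_cdot|exact: cintg_cdot].
congr (cint _ _ _); apply/funext => x; rewrite /cdot mulr_sumr -big_split/=.
by apply: eq_bigr => k _; rewrite linE; ring.
Qed.

Lemma cdotC (p q : 'rV[C]_3) : cdot p q = cdot q p.
Proof. by apply: eq_bigr => k _; rewrite mulrC. Qed.

Lemma cdot_conj u w x : cdot (conjf u x) (conjf w x) = conjc (cdot (u x) (w x)).
Proof.
by rewrite /cdot rmorph_sum; apply: eq_bigr => k _; rewrite !conjfE rmorphM.
Qed.

Lemma cint_cdot_conj u w : L2v mu D u -> L2v mu D w ->
  cint mu D (fun x => cdot (conjf u x) (conjf w x)) =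
  conjc (cint mu D (fun x => cdot (u x) (w x))).
Proof.
move=> Lu Lw; rewrite -cint_conj//; last exact: cintg_cdot.
by congr (cint _ _ _); apply/funext => x; exact: cdot_conj.
Qed.

Lemma cint_cdot_ae u u' w : L2v mu D u -> L2v mu D u' -> L2v mu D w ->
  {ae mu, forall x, D x -> u x = u' x} ->
  cint mu D (fun x => cdot (u x) (w x)) = cint mu D (fun x => cdot (u' x) (w x)).
Proof.
move=> Lu Lu' Lw e; apply: ae_cint => //.
- by apply: cintg_meas; exact: cintg_cdot.
- by apply: cintg_meas; exact: cintg_cdot.
- by apply: filterS e => x /[swap] Dx ->.
Qed.

Lemma sqnorm_ge0 (p : 'rV[C]_3) : 0 <= sqnorm p.
Proof. by apply: sumr_ge0 => k _; exact: sqmod_ge0. Qed.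

Lemma intg_sqnorm u : L2v mu D u -> intg mu D (fun x => sqnorm (u x)).
Proof. by move=> Lu; apply: intg_sum => // k _; exact: L2_sq. Qed.

Lemma rint_sqnorm u : L2v mu D u -> rint mu D (fun x => sqnorm (u x)) =
  \sum_k rint mu D (fun x => sqmod (u x 0 k)).
Proof. by move=> Lu; rewrite rint_sum// => k _; exact: L2_sq. Qed.

Lemma rint_sqnorm_ge0 u : 0 <= rint mu D (fun x => sqnorm (u x)).
Proof. by apply: rint_ge0 => x _; exact: sqnorm_ge0. Qed.

Lemma rint_sqmod_ge0 f : 0 <= rint mu D (fun x => sqmod (f x)).
Proof. by apply: rint_ge0 => x _; exact: sqmod_ge0. Qed.

Lemma rint_sqnorm_ae u u' : L2v mu D u -> L2v mu D u' ->
  {ae mu, forall x, D x -> u x = u' x} ->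
  rint mu D (fun x => sqnorm (u x)) = rint mu D (fun x => sqnorm (u' x)).
Proof.
move=> Lu Lu' e; apply: ae_rint => //.
- by apply: intg_meas; exact: intg_sqnorm.
- by apply: intg_meas; exact: intg_sqnorm.
- by apply: filterS e => x /[swap] Dx ->.
Qed.

Lemma sqmod_sum3 (F : 'I_3 -> C) : sqmod (\sum_k F k) <= 3 * \sum_k sqmod (F k).
Proof.
rewrite !sum3; move: (F _) (F _) (F _) => [a b] [c d] [e f]; rewrite /sqmod /=.
have h (p q r : R) : (p + q + r) ^+ 2 <= 3 * (p ^+ 2 + q ^+ 2 + r ^+ 2).
  have := sqr_ge0 (p - q); have := sqr_ge0 (p - r); have := sqr_ge0 (q - r); nra.
by have := h a c e; have := h b d f; lra.
Qed.

(** The three components are estimated one by one, at the cost of a factor 3. It is harmless, for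
    only the continuity of forms is drawn from it. *)
Lemma cauchy_schwarz_cdot u w : L2v mu D u -> L2v mu D w ->
  sqmod (cint mu D (fun x => cdot (u x) (w x))) <=
  3 * (rint mu D (fun x => sqnorm (u x)) * rint mu D (fun x => sqnorm (w x))).
Proof.
move=> Lu Lw; rewrite /cdot cint_sum//; last by move=> k _; exact: L2_mul.
apply: le_trans (sqmod_sum3 _) _; rewrite ler_wpM2l//.
rewrite !rint_sqnorm// mulr_suml; apply: ler_sum => k _.
apply: le_trans (cauchy_schwarz mD (Lu k) (Lw k)) _.
rewrite ler_wpM2l ?rint_sqmod_ge0//.
by rewrite (bigD1 k)//= lerDl; apply: sumr_ge0 => j _; exact: rint_sqmod_ge0.
Qed.

Lemma L2v_complete (s : nat -> vfield) : (forall n, L2v mu D (s n)) ->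
  (forall e, 0 < e -> exists N, forall m n, (N <= m)%N -> (N <= n)%N ->
     rint mu D (fun x => sqnorm (s m x - s n x)) <= e) ->
  exists2 v, L2v mu D v & rint mu D (fun x => sqnorm (s n x - v x)) @[n --> \oo] --> (0 : R).
Proof.
move=> Ls cauchy.
have Lsub p q : L2v mu D p -> L2v mu D q -> L2v mu D (fun x => p x - q x).
  by move=> Lp Lq k; under eq_fun do rewrite !mxE; exact: L2B.
have /choice[g gP] (k : 'I_3) : exists g, L2 mu D g /\
    rint mu D (fun x => sqmod (s n x 0 k - g x)) @[n --> \oo] --> (0 : R).
  have [e e0|g Lg gs] := L2_complete (f := fun n x => s n x 0 k) mD (fun n => Ls n k).
    have [N NP] := cauchy e e0; exists N => m n Nm Nn; apply: le_trans (NP m n Nm Nn).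
    rewrite rint_sqnorm; last exact: Lsub.
    rewrite (bigD1 k)//=.
    rewrite [X in _ <= X + _](_ : _ = rint mu D (fun x => sqmod (s m x 0 k - s n x 0 k))).
      by rewrite lerDl; apply: sumr_ge0 => j _; exact: rint_sqmod_ge0.
    by congr (rint _ _ _); apply/funext => x; rewrite !mxE.
  by exists g.
pose v : vfield := fun x => \row_k g k x.
have vE x k : v x 0 k = g k x by rewrite mxE.
have Lv : L2v mu D v.
  by move=> k; under eq_fun do rewrite vE; exact: (gP k).1.
exists v => //.
rewrite (_ : (fun n => _) = fun n => \sum_k rint mu D (fun x => sqmod (s n x 0 k - g k x))).
  under eq_fun do rewrite sum3.
  have := cvgD (cvgD (gP (inord 0)).2 (gP (inord 1)).2) (gP (inord 2)).2.
  by rewrite (addr0 0) (addr0 0); apply.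
apply/funext => n; rewrite rint_sqnorm; last exact: Lsub.
apply: eq_bigr => k _; congr (rint _ _ _); apply/funext => x.
by rewrite mxE [(- v x) 0 k]mxE vE.
Qed.

End VectorL2.

Section FiniteMeasure.
Variables (R : realType) (mu : {measure set (pt R) -> \bar R}) (D : set (pt R)).
Hypothesis mD : measurable D.
Hypothesis finD : (mu D < +oo)%E.
Variables a b : pt R.
Hypothesis Dab : D `<=` cbox a b.
Local Notation C := R[i].
Implicit Types (f : pt R -> C) (g : pt R -> R).

Lemma bounded_L2 f (M : R) : cmeas D f -> (forall x, D x -> sqmod (f x) <= M) -> L2 mu D f.
Proof.
move=> mf fM; apply/L2P; split => //.
apply: (@intg_le _ mu D mD _ (fun=> M)).
- exact: measurable_sqmod.
- by move=> x Dx; rewrite ger0_norm ?sqmod_ge0// fM.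
- apply/integrableP; split; first exact: measurable_cst.
  under eq_integral do rewrite /=.
  by rewrite integral_cst// lte_mul_pinfty// fin_numE.
Qed.

Lemma continuous_L2 g : continuous g -> L2 mu D (fun x => (g x)%:C).
Proof.
move=> cg; have [M HM] := continuous_bounded_cbox a b cg.
apply: (@bounded_L2 _ (M ^+ 2)).
  split=> /=; last exact: measurable_cst.
  by apply: measurable_funTS; exact: continuous_measurable3.
move=> x /Dab/HM gM; rewrite /sqmod /= expr0n addr0 -(real_normK (num_real (g x))).
by rewrite ler_sqr ?nnegrE// (le_trans _ gM).
Qed.

Lemma continuous_cintg g f : continuous g -> L2 mu D f ->
  cintg mu D (fun x => (g x)%:C * f x).
Proof. by move=> cg Lf; apply: L2_mul => //; exact: continuous_L2. Qed.

Lemma L2_cintg f : L2 mu D f -> cintg mu D f.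
Proof.
move=> Lf; have c1 : continuous (fun _ : pt R => 1 : R) by move=> x; exact: cvg_cst.
have := continuous_cintg c1 Lf.
by rewrite (_ : (fun x => _) = f)//; apply/funext => x; rewrite mul1r.
Qed.

(** This lets weak identities pass to L^2 limits: [g] is a test function or one of its partial
    derivatives. *)
Lemma cint_continuous_cvg g (f_ : nat -> pt R -> C) f : continuous g ->
  (forall n, L2 mu D (f_ n)) -> L2 mu D f ->
  rint mu D (fun x => sqmod (f_ n x - f x)) @[n --> \oo] --> (0 : R) ->
  cvgC (fun n => cint mu D (fun x => (g x)%:C * f_ n x)) (cint mu D (fun x => (g x)%:C * f x)).
Proof.
move=> cg Lf_ Lf f0.
apply: (cvgC_squeeze (u := fun n => rint mu D (fun x => sqmod (g x)%:C) *
    rint mu D (fun x => sqmod (f_ n x - f x)))).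
  move=> n; rewrite -cintB//; try exact: continuous_cintg.
  rewrite (_ : (fun x => _ - _) = fun x => (g x)%:C * (f_ n x - f x)).
    by apply: cauchy_schwarz => //; [exact: continuous_L2|exact: L2B].
  by apply/funext => x; rewrite mulrBr.
by rewrite -(mulr0 (rint mu D (fun x => sqmod (g x)%:C))); apply: cvgM => //; exact: cvg_cst.
Qed.

End FiniteMeasure.

Section Lebesgue3.
Variable R : realType.

Let leb3_0 : @leb3 R set0 = 0%E. Proof. by rewrite /leb3 measure0. Qed.
Let leb3_ge0 (A : set (pt R)) : (0 <= @leb3 R A)%E.
Proof. by rewrite /leb3 measure_ge0. Qed.
Let leb3_sigma_additive : semi_sigma_additive (@leb3 R).
Proof. exact: (@measure_semi_sigma_additive _ _ _ ((@leb1 R \x @leb1 R) \x @leb1 R)%E). Qed.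

HB.instance Definition _ := isMeasure.Build _ (pt R) R (@leb3 R)
  leb3_0 leb3_ge0 leb3_sigma_additive.

Lemma leb3_cbox_lty (a b : pt R) : (@leb3 R (cbox a b) < +oo)%E.
Proof.
have l1 (c d : R) : (@leb1 R `[c, d]%classic < +oo)%E.
  by rewrite /leb1 lebesgue_measure_itv; case: ifP => // _; rewrite -EFinD ltry.
have m (c d : R) : measurable (`[c, d]%classic : set R) by [].
have l2 (c d c' d' : R) :
    ((@leb1 R \x @leb1 R) (`[c, d]%classic `*` `[c', d']%classic) < +oo)%E.
  rewrite product_measure1E//; apply: lte_mul_pinfty => //; last exact: l1.
  by rewrite ge0_fin_numE ?measure_ge0//; exact: l1.
rewrite cboxE /leb3 product_measure1E//; last exact: measurableX.
apply: lte_mul_pinfty; [exact: measure_ge0| |exact: l1].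
by rewrite ge0_fin_numE ?measure_ge0//; exact: l2.
Qed.

Lemma leb3_lty (D : set (pt R)) (a b : pt R) : measurable D -> D `<=` cbox a b ->
  (@leb3 R D < +oo)%E.
Proof.
move=> mD Dab; apply: le_lt_trans (leb3_cbox_lty a b).
apply: le_measure; rewrite ?inE//.
by apply: closed_measurable3; exact: closed_cbox.
Qed.

End Lebesgue3.

(** * Uniqueness and linearity of weak derivatives *)

Section WeakDerivatives.
Variables (R : realType) (Om : set (pt R)) (a b : pt R).
Hypothesis oOm : open Om.
Hypothesis Omab : Om `<=` cbox a b.
Local Notation C := R[i].
Local Notation vfield := (vfield R).
Local Notation mu := (@leb3 R).
Implicit Types (u v w : vfield) (f g d : pt R -> C) (psi : pt R -> R).

Let mOm : measurable Om. Proof. exact: open_measurable3. Qed.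
Let finOm : (mu Om < +oo)%E. Proof. exact: leb3_lty Omab. Qed.

Lemma cintg_test psi f : test_fun setT psi -> L2 mu Om f ->
  cintg mu Om (fun x => (psi x)%:C * f x).
Proof.
by move=> t Lf; apply: (continuous_cintg mOm finOm Omab) => //; exact: test_fun_continuous t.
Qed.

Lemma cintg_partial k psi f : test_fun setT psi -> L2 mu Om f ->
  cintg mu Om (fun x => (partial k psi x)%:C * f x).
Proof.
move=> t Lf; apply: (continuous_cintg mOm finOm Omab) => //.
exact: test_fun_partial_continuous t.
Qed.

Lemma test_funT psi : test_fun Om psi -> test_fun setT psi.
Proof. exact: test_funS. Qed.

Lemma test_unique g g' : L2 mu Om g -> L2 mu Om g' ->
  (forall psi, test_fun Om psi -> cint mu Om (fun x => (psi x)%:C * g x) =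
    cint mu Om (fun x => (psi x)%:C * g' x)) ->
  {ae mu, forall x, Om x -> g x = g' x}.
Proof.
move=> Lg Lg' e.
have L : L2 mu Om (fun x => g x - g' x) by exact: L2B.
have := @du_bois_reymondC R mu Om Om (fun x => g x - g' x) mOm oOm (@subset_refl _ _).
move=> /(_ (L2_cintg mOm finOm Omab L))H; have {}H := H _.
have : {ae mu, forall x, Om x -> g x - g' x = 0}.
  apply: H => psi t; have tT := test_funT t.
  rewrite (_ : (fun x => _) = fun x => (psi x)%:C * g x - (psi x)%:C * g' x).
    by rewrite cintB//; [rewrite e// subrr|exact: cintg_test|exact: cintg_test].
  by apply/funext => x; rewrite mulrBr.
by apply: filterS => x h Omx; apply/eqP; rewrite -subr_eq0 h.
Qed.

Lemma weak_partial_unique k f g g' : L2 mu Om g -> L2 mu Om g' ->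
  is_weak_partial Om k f g -> is_weak_partial Om k f g' ->
  {ae mu, forall x, Om x -> g x = g' x}.
Proof. by move=> Lg Lg' h h'; apply: test_unique => // psi t; rewrite h// h'. Qed.

Lemma weak_div_unique u d d' : L2 mu Om d -> L2 mu Om d' ->
  is_weak_div Om u d -> is_weak_div Om u d' ->
  {ae mu, forall x, Om x -> d x = d' x}.
Proof. by move=> Lg Lg' h h'; apply: test_unique => // psi t; rewrite h// h'. Qed.

Lemma weak_curl_unique u w w' : L2v mu Om w -> L2v mu Om w' ->
  is_weak_curl Om u w -> is_weak_curl Om u w' ->
  {ae mu, forall x, Om x -> w x = w' x}.
Proof.
move=> Lw Lw' h h'.
have H k : {ae mu, forall x, Om x -> w x 0 k = w' x 0 k}.
  by apply: test_unique => // psi t; rewrite h// h'.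
apply: filterS2 (H (inord 0)) (filterI (H (inord 1)) (H (inord 2))) => x h0 [h1 h2] Omx.
apply/rowP => k.
have -> : k = inord (val k) :> 'I_3 by rewrite inord_val.
by case: k => -[|[|[|//]]] k3 /=; [exact: h0|exact: h1|exact: h2].
Qed.

Lemma cint_test_lin (c : C) psi f f' : continuous psi -> L2 mu Om f -> L2 mu Om f' ->
  cint mu Om (fun x => (psi x)%:C * (c * f x + f' x)) =
  c * cint mu Om (fun x => (psi x)%:C * f x) + cint mu Om (fun x => (psi x)%:C * f' x).
Proof.
move=> cg Lf Lf'; have i1 := continuous_cintg mOm finOm Omab cg Lf.
have i2 := continuous_cintg mOm finOm Omab cg Lf'.
rewrite -cintZ// -cintD//; last exact: cintgZ.
by congr (cint _ _ _); apply/funext => x; ring.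
Qed.

Lemma cint_test_conj psi f : continuous psi -> L2 mu Om f ->
  cint mu Om (fun x => (psi x)%:C * conjc (f x)) =
  conjc (cint mu Om (fun x => (psi x)%:C * f x)).
Proof.
move=> cg Lf; have i1 := continuous_cintg mOm finOm Omab cg Lf.
rewrite -cint_conj//; congr (cint _ _ _); apply/funext => x.
by rewrite rmorphM; congr (_ * _); apply: eqC; rewrite ?ReImE /= ?oppr0.
Qed.

Lemma weak_partial_lin k (c : C) f f' g g' :
  L2 mu Om f -> L2 mu Om f' -> L2 mu Om g -> L2 mu Om g' ->
  is_weak_partial Om k f g -> is_weak_partial Om k f' g' ->
  is_weak_partial Om k (fun x => c * f x + f' x) (fun x => c * g x + g' x).
Proof.
move=> Lf Lf' Lg Lg' h h' psi t; have tT := test_funT t.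
rewrite !cint_test_lin//; first by rewrite h// h'//; ring.
- exact: test_fun_partial_continuous tT.
- exact: test_fun_continuous tT.
Qed.

Lemma weak_partial_conj k f g : L2 mu Om f -> L2 mu Om g ->
  is_weak_partial Om k f g ->
  is_weak_partial Om k (fun x => conjc (f x)) (fun x => conjc (g x)).
Proof.
move=> Lf Lg h psi t; have tT := test_funT t.
rewrite !cint_test_conj//; first by rewrite h// rmorphN.
- exact: test_fun_partial_continuous tT.
- exact: test_fun_continuous tT.
Qed.

Lemma cint_curl_split u psi k : test_fun setT psi -> L2v mu Om u ->
  cint mu Om (fun x => (partial (ordS k) psi x)%:C * u x 0 (ordS (ordS k))
        - (partial (ordS (ordS k)) psi x)%:C * u x 0 (ordS k)) =
  cint mu Om (fun x => (partial (ordS k) psi x)%:C * u x 0 (ordS (ordS k)))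
  - cint mu Om (fun x => (partial (ordS (ordS k)) psi x)%:C * u x 0 (ordS k)).
Proof. by move=> t Lu; rewrite cintB//; exact: cintg_partial. Qed.

Lemma cint_div_split u psi : test_fun setT psi -> L2v mu Om u ->
  cint mu Om (fun x => \sum_k (partial k psi x)%:C * u x 0 k) =
  \sum_k cint mu Om (fun x => (partial k psi x)%:C * u x 0 k).
Proof. by move=> t Lu; rewrite cint_sum// => k _; exact: cintg_partial. Qed.

Lemma weak_curl_lin (c : C) u u' w w' :
  L2v mu Om u -> L2v mu Om u' -> L2v mu Om w -> L2v mu Om w' ->
  is_weak_curl Om u w -> is_weak_curl Om u' w' ->
  is_weak_curl Om (lin c u u') (lin c w w').
Proof.
have alg (A B A' B' : C) :
  c * - (A - B) - (A' - B') = - (c * A + A' - (c * B + B')) by ring.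
move=> Lu Lu' Lw Lw' h h' psi t k; have tT := test_funT t.
rewrite cint_curl_split//; last exact: L2v_lin.
under eq_fun do rewrite linE.
rewrite cint_test_lin//; last exact: test_fun_continuous tT.
rewrite h// h'// !cint_curl_split//.
under [in X in _ = - (_ - X)]eq_fun do rewrite linE.
under [in X in _ = - (X - _)]eq_fun do rewrite linE.
rewrite !cint_test_lin//; try exact: test_fun_partial_continuous tT.
Qed.

Lemma weak_curl_conj u w : L2v mu Om u -> L2v mu Om w ->
  is_weak_curl Om u w -> is_weak_curl Om (conjf u) (conjf w).
Proof.
move=> Lu Lw h psi t k; have tT := test_funT t.
rewrite cint_curl_split//; last exact: L2v_conj.
under eq_fun do rewrite conjfE.
rewrite cint_test_conj//; last exact: test_fun_continuous tT.
rewrite h// !cint_curl_split//.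
under [in X in _ = - (_ - X)]eq_fun do rewrite conjfE.
under [in X in _ = - (X - _)]eq_fun do rewrite conjfE.
rewrite !cint_test_conj//; try exact: test_fun_partial_continuous tT.
by rewrite rmorphN rmorphB.
Qed.

Lemma weak_div_lin (c : C) u u' d d' :
  L2v mu Om u -> L2v mu Om u' -> L2 mu Om d -> L2 mu Om d' ->
  is_weak_div Om u d -> is_weak_div Om u' d' ->
  is_weak_div Om (lin c u u') (fun x => c * d x + d' x).
Proof.
move=> Lu Lu' Ld Ld' h h' psi t; have tT := test_funT t.
rewrite cint_div_split//; last exact: L2v_lin.
rewrite cint_test_lin//; last exact: test_fun_continuous tT.
rewrite h// h'// !cint_div_split// mulrN -opprD mulr_sumr -big_split/=.
congr (- _); apply: eq_bigr => k _; under [in RHS]eq_fun do rewrite linE.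
by rewrite cint_test_lin//; exact: test_fun_partial_continuous tT.
Qed.

Lemma weak_div_conj u d : L2v mu Om u -> L2 mu Om d ->
  is_weak_div Om u d -> is_weak_div Om (conjf u) (fun x => conjc (d x)).
Proof.
move=> Lu Ld h psi t; have tT := test_funT t.
rewrite cint_div_split//; last exact: L2v_conj.
rewrite cint_test_conj//; last exact: test_fun_continuous tT.
rewrite h// !cint_div_split// rmorphN rmorph_sum/=.
congr (- _); apply: eq_bigr => k _; under [in RHS]eq_fun do rewrite conjfE.
by rewrite cint_test_conj//; exact: test_fun_partial_continuous tT.
Qed.

End WeakDerivatives.

(** * The space X_T *)

Section XTSpace.
Variables (R : realType) (Om : set (pt R)) (a b : pt R).
Hypothesis oOm : open Om.
Hypothesis Omab : Om `<=` cbox a b.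
Local Notation C := R[i].
Local Notation vfield := (vfield R).
Local Notation mu := (@leb3 R).
Implicit Types (u v w phi : vfield) (f g d : pt R -> C) (psi : pt R -> R).

Let mOm : measurable Om. Proof. exact: open_measurable3. Qed.
Let finOm : (mu Om < +oo)%E. Proof. exact: leb3_lty Omab. Qed.

Lemma curlP u : (exists w, L2v mu Om w /\ is_weak_curl Om u w) ->
  L2v mu Om (curl Om u) /\ is_weak_curl Om u (curl Om u).
Proof. by move=> h; exact: (xgetPex (fun=> 0) h). Qed.

Lemma divP u : (exists d, L2 mu Om d /\ is_weak_div Om u d) ->
  L2 mu Om (div Om u) /\ is_weak_div Om u (div Om u).
Proof. by move=> h; exact: (xgetPex (fun=> 0) h). Qed.

Local Opaque curl div.

Lemma curl_ae u w : L2v mu Om w -> is_weak_curl Om u w ->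
  {ae mu, forall x, Om x -> curl Om u x = w x}.
Proof.
move=> Lw h; have [Lc hc] := curlP (ex_intro _ w (conj Lw h)).
exact: (weak_curl_unique oOm Omab Lc Lw hc h).
Qed.

Lemma div_ae u d : L2 mu Om d -> is_weak_div Om u d ->
  {ae mu, forall x, Om x -> div Om u x = d x}.
Proof.
move=> Ld h; have [Lc hc] := divP (ex_intro _ d (conj Ld h)).
exact: (weak_div_unique oOm Omab Lc Ld hc h).
Qed.

Lemma XT_L2 u : XT Om u -> L2v mu Om u. Proof. by case. Qed.
Lemma XT_curl u : XT Om u -> L2v mu Om (curl Om u). Proof. by case=> _ /curlP[]. Qed.
Lemma XT_div u : XT Om u -> L2 mu Om (div Om u). Proof. by case=> _ _ /divP[]. Qed.
Lemma XT_weak_curl u : XT Om u -> is_weak_curl Om u (curl Om u).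
Proof. by case=> _ /curlP[]. Qed.
Lemma XT_weak_div u : XT Om u -> is_weak_div Om u (div Om u).
Proof. by case=> _ _ /divP[]. Qed.

(** The representatives of the three curls are selected independently, so they are related only
    through uniqueness of weak curls. *)
Lemma curl_lin (c : C) u w : XT Om u -> XT Om w ->
  {ae mu, forall x, Om x -> curl Om (lin c u w) x = lin c (curl Om u) (curl Om w) x}.
Proof.
move=> Xu Xw; have Lcu := XT_curl Xu; have Lcw := XT_curl Xw.
apply: curl_ae; first exact: (L2v_lin mOm c Lcu Lcw).
exact: (weak_curl_lin oOm Omab c (XT_L2 Xu) (XT_L2 Xw) Lcu Lcw
  (XT_weak_curl Xu) (XT_weak_curl Xw)).
Qed.

Lemma div_lin (c : C) u w : XT Om u -> XT Om w ->
  {ae mu, forall x, Om x -> div Om (lin c u w) x = c * div Om u x + div Om w x}.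
Proof.
move=> Xu Xw; have Ldu := XT_div Xu; have Ldw := XT_div Xw.
apply: div_ae; first exact: (L2D mOm (L2Z mOm c Ldu) Ldw).
exact: (weak_div_lin oOm Omab c (XT_L2 Xu) (XT_L2 Xw) Ldu Ldw
  (XT_weak_div Xu) (XT_weak_div Xw)).
Qed.

Lemma curl_conj u : XT Om u ->
  {ae mu, forall x, Om x -> curl Om (conjf u) x = conjf (curl Om u) x}.
Proof.
move=> Xu; have Lcu := XT_curl Xu.
apply: curl_ae; first exact: L2v_conj.
by apply: (weak_curl_conj oOm Omab _ Lcu); [exact: XT_L2|exact: XT_weak_curl].
Qed.

Lemma div_conj u : XT Om u ->
  {ae mu, forall x, Om x -> div Om (conjf u) x = conjc (div Om u x)}.
Proof.
move=> Xu; have Ldu := XT_div Xu.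
apply: div_ae; first exact: L2_conj.
by apply: (weak_div_conj oOm Omab _ Ldu); [exact: XT_L2|exact: XT_weak_div].
Qed.

(** The divergence is a separate argument, so that [div Om u] can be exchanged for a representative
    that is linear in [u] or is a limit. *)
Definition normal_trace_test psi u d : C :=
  \sum_k cint mu Om (fun x => (partial k psi x)%:C * u x 0 k)
  + cint mu Om (fun x => (psi x)%:C * d x).

Lemma normal_traceE psi u d : test_fun setT psi -> L2v mu Om u -> L2 mu Om d ->
  cint mu Om (fun x => \sum_k (partial k psi x)%:C * u x 0 k + (psi x)%:C * d x) =
  normal_trace_test psi u d.
Proof.
move=> t Lu Ld; rewrite cintD//.
- by rewrite cint_sum// => k _; exact: (cintg_partial oOm Omab).
- by apply: cintg_sum => // k _; exact: (cintg_partial oOm Omab).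
- exact: (cintg_test oOm Omab).
Qed.

Lemma zero_normal_traceP u : L2v mu Om u -> L2 mu Om (div Om u) ->
  zero_normal_trace Om u <->
  forall psi, test_fun setT psi -> normal_trace_test psi u (div Om u) = 0.
Proof.
by move=> Lu Ld; split=> h psi t; have := h psi t; rewrite normal_traceE.
Qed.

Lemma cint_test_ae psi d d' : test_fun setT psi -> L2 mu Om d -> L2 mu Om d' ->
  {ae mu, forall x, Om x -> d x = d' x} ->
  cint mu Om (fun x => (psi x)%:C * d x) = cint mu Om (fun x => (psi x)%:C * d' x).
Proof.
move=> t Ld Ld' e; apply: ae_cint => //.
- by apply: cintg_meas; exact: (cintg_test oOm Omab).
- by apply: cintg_meas; exact: (cintg_test oOm Omab).
- by apply: filterS e => x /[swap] Omx ->.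
Qed.

Lemma XT_lin (c : C) u w : XT Om u -> XT Om w -> XT Om (lin c u w).
Proof.
move=> Xu Xw; have [Lu Lw] := (XT_L2 Xu, XT_L2 Xw).
have [Lcu Lcw] := (XT_curl Xu, XT_curl Xw); have [Ldu Ldw] := (XT_div Xu, XT_div Xw).
have ed := div_lin c Xu Xw.
have hd : exists d, L2 mu Om d /\ is_weak_div Om (lin c u w) d.
  exists (fun x => c * div Om u x + div Om w x); split.
    exact: (L2D mOm (L2Z mOm c Ldu) Ldw).
  exact: (weak_div_lin oOm Omab c Lu Lw Ldu Ldw (XT_weak_div Xu) (XT_weak_div Xw)).
have [Ld _] := divP hd.
split=> //; first exact: L2v_lin.
  exists (lin c (curl Om u) (curl Om w)); split; first exact: (L2v_lin mOm c Lcu Lcw).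
  exact: (weak_curl_lin oOm Omab c Lu Lw Lcu Lcw (XT_weak_curl Xu) (XT_weak_curl Xw)).
apply/zero_normal_traceP => //; first exact: L2v_lin.
move=> psi t; rewrite /normal_trace_test.
have L := L2D mOm (L2Z mOm c Ldu) Ldw.
rewrite (cint_test_ae t Ld L ed) (cint_test_lin oOm Omab)//; last exact: test_fun_continuous t.
have -> : \sum_k cint mu Om (fun x => (partial k psi x)%:C * lin c u w x 0 k) =
    c * (\sum_k cint mu Om (fun x => (partial k psi x)%:C * u x 0 k)) +
    \sum_k cint mu Om (fun x => (partial k psi x)%:C * w x 0 k).
  rewrite mulr_sumr -big_split/=; apply: eq_bigr => k _.
  under [in LHS]eq_fun do rewrite linE.
  by rewrite (cint_test_lin oOm Omab)//; exact: test_fun_partial_continuous t.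
have [_ _ _ /(zero_normal_traceP Lu Ldu)/(_ _ t)] := Xu.
have [_ _ _ /(zero_normal_traceP Lw Ldw)/(_ _ t)] := Xw.
rewrite /normal_trace_test.
have alg (p q p' q' : C) : p' + q' = 0 -> p + q = 0 -> c * p + p' + (c * q + q') = 0.
  by move=> h h'; rewrite addrACA -mulrDr h h' mulr0 addr0.
exact: alg.
Qed.

Lemma XT_conj u : XT Om u -> XT Om (conjf u).
Proof.
move=> Xu; have Lu := XT_L2 Xu; have Lcu := XT_curl Xu; have Ldu := XT_div Xu.
have ed := div_conj Xu.
have hd : exists d, L2 mu Om d /\ is_weak_div Om (conjf u) d.
  exists (fun x => conjc (div Om u x)); split; first exact: L2_conj.
  by apply: (weak_div_conj oOm Omab) => //; exact: XT_weak_div.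
have [Ld _] := divP hd.
split=> //; first exact: L2v_conj.
  exists (conjf (curl Om u)); split; first exact: L2v_conj.
  by apply: (weak_curl_conj oOm Omab) => //; exact: XT_weak_curl.
apply/zero_normal_traceP => //; first exact: L2v_conj.
move=> psi t; rewrite /normal_trace_test.
rewrite (cint_test_ae t Ld (L2_conj Ldu) ed) (cint_test_conj oOm Omab)//;
  last exact: test_fun_continuous t.
have -> : \sum_k cint mu Om (fun x => (partial k psi x)%:C * conjf u x 0 k) =
    conjc (\sum_k cint mu Om (fun x => (partial k psi x)%:C * u x 0 k)).
  rewrite rmorph_sum; apply: eq_bigr => k _.
  under [in LHS]eq_fun do rewrite conjfE.
  by rewrite (cint_test_conj oOm Omab)//; exact: test_fun_partial_continuous t.
have [_ _ _ /(zero_normal_traceP Lu Ldu)/(_ _ t)] := Xu.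
by rewrite /normal_trace_test -rmorphD => ->; rewrite rmorph0.
Qed.

Definition XTsq u : R := rint mu Om (fun x => sqnorm (u x))
  + rint mu Om (fun x => sqnorm (curl Om u x))
  + rint mu Om (fun x => sqmod (div Om u x)).

Lemma XTsq_ge0 u : 0 <= XTsq u.
Proof. by rewrite !addr_ge0 ?rint_sqnorm_ge0 ?rint_sqmod_ge0. Qed.

Lemma XTnorm2 u : XTnorm Om u ^+ 2 = XTsq u.
Proof. by rewrite sqr_sqrtr// XTsq_ge0. Qed.

Lemma subE u w : (fun x => u x - w x) = lin (-1) w u.
Proof. by apply/funext => x; rewrite /lin scaleN1r addrC. Qed.

Lemma rint_subE u w : rint mu Om (fun x => sqnorm (u x - w x)) =
  rint mu Om (fun x => sqnorm (lin (-1) w u x)).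
Proof. by congr (rint _ _ _); apply/funext => x; rewrite -[in RHS]subE. Qed.

Lemma XTsq_sub u w : XT Om u -> XT Om w -> XTsq (fun x => u x - w x) =
  rint mu Om (fun x => sqnorm (u x - w x))
  + rint mu Om (fun x => sqnorm (curl Om u x - curl Om w x))
  + rint mu Om (fun x => sqmod (div Om u x - div Om w x)).
Proof.
move=> Xu Xw; rewrite /XTsq subE; have Xuw := XT_lin (-1) Xw Xu.
congr (_ + _ + _).
- rewrite (rint_sqnorm_ae mOm (XT_curl Xuw) _ (curl_lin (-1) Xw Xu)).
    by rewrite -subE.
  by apply: L2v_lin => //; exact: XT_curl.
- apply: ae_rint => //.
  + by apply: intg_meas; exact: (L2_sq (XT_div Xuw)).
  + by apply: intg_meas; apply: L2_sq; apply: L2B => //; exact: XT_div.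
  + apply: filterS (div_lin (-1) Xw Xu) => x /[swap] Omx ->//.
    by rewrite mulN1r addrC.
Qed.

Lemma XT_cvgE (s : nat -> vfield) v : XT_cvg Om s v <->
  XTsq (fun x => s N x - v x) @[N --> \oo] --> (0 : R).
Proof.
rewrite /XT_cvg; split=> h.
- under eq_fun do rewrite -XTnorm2 expr2.
  by rewrite -(mulr0 0); exact: cvgM.
- rewrite -(sqrtr0 R).
  rewrite (_ : (fun N => _) = fun N => Num.sqrt (XTsq (fun x => s N x - v x)))//.
  exact: (continuous_cvg _ (@sqrt_continuous R 0) h).
Qed.

Lemma L2v_cvg_coord (s : nat -> vfield) v k : (forall n, L2v mu Om (s n)) -> L2v mu Om v ->
  rint mu Om (fun x => sqnorm (s n x - v x)) @[n --> \oo] --> (0 : R) ->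
  rint mu Om (fun x => sqmod (s n x 0 k - v x 0 k)) @[n --> \oo] --> (0 : R).
Proof.
move=> Ls Lv h; apply: (@squeeze_cvgr _ _ _ _ (fun=> 0) _ _ _ _ (cvg_cst _) h).
apply: nearW => n /=; rewrite rint_sqmod_ge0/= rint_subE (rint_sqnorm mOm (L2v_lin mOm (-1) Lv (Ls n))).
rewrite (bigD1 k)//= -[leLHS]addr0; apply: lerD; last first.
  by apply: sumr_ge0 => j _; exact: rint_sqmod_ge0.
rewrite le_eqVlt; apply/orP; left; apply/eqP; congr (rint _ _ _).
by apply/funext => x; rewrite linE mulN1r addrC.
Qed.

(** Weak curl, weak divergence and vanishing normal trace are identities against test functions,
    each continuous for L^2 convergence of the field, its curl and its divergence. The limits [w]
    and [d] are then traded for the selected representatives. *)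
Lemma XT_closed (s : nat -> vfield) v w d :
  (forall n, XT Om (s n)) -> L2v mu Om v -> L2v mu Om w -> L2 mu Om d ->
  rint mu Om (fun x => sqnorm (s n x - v x)) @[n --> \oo] --> (0 : R) ->
  rint mu Om (fun x => sqnorm (curl Om (s n) x - w x)) @[n --> \oo] --> (0 : R) ->
  rint mu Om (fun x => sqmod (div Om (s n) x - d x)) @[n --> \oo] --> (0 : R) ->
  XT Om v /\ XT_cvg Om s v.
Proof.
move=> Xs Lv Lw Ld cv cw cd.
have Ls n := XT_L2 (Xs n); have Lcs n := XT_curl (Xs n); have Lds n := XT_div (Xs n).
have cvp psi k j : test_fun setT psi ->
    cvgC (fun n => cint mu Om (fun x => (partial k psi x)%:C * s n x 0 j))
         (cint mu Om (fun x => (partial k psi x)%:C * v x 0 j)).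
  move=> t; apply: (cint_continuous_cvg mOm finOm Omab) => //.
  - exact: test_fun_partial_continuous t.
  - by move=> n; exact: Ls.
  - exact: L2v_cvg_coord.
have wcurl : is_weak_curl Om v w.
  move=> psi t k; have tT := test_funT t.
  have c1 : cvgC (fun n => cint mu Om (fun x => (psi x)%:C * curl Om (s n) x 0 k))
      (cint mu Om (fun x => (psi x)%:C * w x 0 k)).
    apply: (cint_continuous_cvg mOm finOm Omab) => //.
    - exact: test_fun_continuous tT.
    - by move=> n; exact: Lcs.
    - exact: L2v_cvg_coord.
  apply: cvgC_unique c1 _; rewrite (cint_curl_split oOm Omab)//.
  under eq_fun do rewrite (XT_weak_curl (Xs _) t) (cint_curl_split oOm Omab)//.
  by apply: cvgCN; apply: cvgCD; [exact: cvp|apply: cvgCN; exact: cvp].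
have cpd psi : test_fun setT psi ->
    cvgC (fun n => cint mu Om (fun x => (psi x)%:C * div Om (s n) x))
      (cint mu Om (fun x => (psi x)%:C * d x)).
  move=> t; apply: (cint_continuous_cvg mOm finOm Omab) => //.
  exact: test_fun_continuous t.
have csum psi : test_fun setT psi ->
    cvgC (fun n => \sum_k cint mu Om (fun x => (partial k psi x)%:C * s n x 0 k))
      (\sum_k cint mu Om (fun x => (partial k psi x)%:C * v x 0 k)).
  move=> t; rewrite sum3; under eq_fun do rewrite sum3.
  by apply: cvgCD; [apply: cvgCD|]; exact: cvp.
have wdiv : is_weak_div Om v d.
  move=> psi t; have tT := test_funT t.
  apply: cvgC_unique (cpd _ tT) _; rewrite (cint_div_split oOm Omab)//.
  under eq_fun do rewrite (XT_weak_div (Xs _) t) (cint_div_split oOm Omab)//.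
  by apply: cvgCN; exact: csum.
have [Ldv _] : L2 mu Om (div Om v) /\ is_weak_div Om v (div Om v) by apply: divP; exists d.
have ev := div_ae Ld wdiv; have ec := curl_ae Lw wcurl.
have Xv : XT Om v.
  split=> //; [by exists w|by exists d|].
  apply/zero_normal_traceP => // psi t; rewrite /normal_trace_test (cint_test_ae t Ldv Ld ev).
  apply: cvgC_unique (cvgCD (csum _ t) (cpd _ t)) _.
  rewrite (_ : (fun n => _) = fun=> 0); first exact: cvgC_cst.
  apply/funext => n; have [_ _ _ /(zero_normal_traceP (Ls n) (Lds n))] := Xs n.
  exact.
split; first exact: Xv.
apply/XT_cvgE; under eq_fun do rewrite (XTsq_sub (Xs _) Xv).
have {}cw : rint mu Om (fun x => sqnorm (curl Om (s n) x - curl Om v x)) @[n --> \oo] --> (0 : R).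
  rewrite (_ : (fun n => _) = fun n => rint mu Om (fun x => sqnorm (curl Om (s n) x - w x)))//.
  apply/funext => n; rewrite !rint_subE.
  apply: (rint_sqnorm_ae mOm (L2v_lin mOm (-1) (XT_curl Xv) (Lcs n)) (L2v_lin mOm (-1) Lw (Lcs n))).
  by apply: filterS ec => x /[swap] Omx; rewrite /lin => ->.
have {}cd : rint mu Om (fun x => sqmod (div Om (s n) x - div Om v x)) @[n --> \oo] --> (0 : R).
  rewrite (_ : (fun n => _) = fun n => rint mu Om (fun x => sqmod (div Om (s n) x - d x)))//.
  apply/funext => n; apply: (ae_rint mOm).
  + exact: intg_meas (L2_sq (L2B mOm (Lds n) Ldv)).
  + exact: intg_meas (L2_sq (L2B mOm (Lds n) Ld)).
  + by apply: filterS ev => x /[swap] Omx ->.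
have := cvgD (cvgD cv cw) cd; rewrite !addr0.
exact.
Qed.

Lemma XT_complete (s : nat -> vfield) : (forall n, XT Om (s n)) ->
  (forall e, 0 < e -> exists N, forall m n, (N <= m)%N -> (N <= n)%N ->
     XTsq (fun x => s m x - s n x) <= e) ->
  exists2 v, XT Om v & XT_cvg Om s v.
Proof.
move=> Xs cauchy.
have [e e0|v Lv cv] := L2v_complete mOm (fun n => XT_L2 (Xs n)).
  have [N NP] := cauchy e e0; exists N => m n Nm Nn; apply: le_trans (NP m n Nm Nn).
  by rewrite XTsq_sub// -addrA lerDl addr_ge0// ?rint_sqnorm_ge0 ?rint_sqmod_ge0.
have [e e0|w Lw cw] := L2v_complete mOm (fun n => XT_curl (Xs n)).
  have [N NP] := cauchy e e0; exists N => m n Nm Nn; apply: le_trans (NP m n Nm Nn).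
  by rewrite XTsq_sub// addrAC lerDr addr_ge0// ?rint_sqnorm_ge0 ?rint_sqmod_ge0.
have [e e0|d Ld cd] := L2_complete mOm (fun n => XT_div (Xs n)).
  have [N NP] := cauchy e e0; exists N => m n Nm Nn; apply: le_trans (NP m n Nm Nn).
  by rewrite XTsq_sub// lerDr addr_ge0// ?rint_sqnorm_ge0 ?rint_sqmod_ge0.
by have [? ?] := XT_closed Xs Lv Lw Ld cv cw cd; exists v.
Qed.

(** * The volume form on X_T *)

Variables alpha theta : R.
Local Notation vol := (vol_form Om alpha theta).

(** [vol_form] with curl and divergence as free arguments: bilinearity and conjugation are exact
    identities here, and the passage to the selected representatives is left to [vol_triple_ae]. *)
Definition vol_triple (w : vfield) d u (w' : vfield) d' u' : C :=
  cint mu Om (fun x => cdot (w x) (w' x)) - alpha%:C * cint mu Om (fun x => cdot (u x) (u' x))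
  + theta%:C * cint mu Om (fun x => d x * d' x).

Lemma volE u phi : vol u phi = vol_triple (curl Om u) (div Om u) u (curl Om phi) (div Om phi) phi.
Proof. by []. Qed.

Lemma vol_triple_sym w d u w' d' u' : vol_triple w d u w' d' u' = vol_triple w' d' u' w d u.
Proof.
rewrite /vol_triple; congr (cint _ _ _ - _ * cint _ _ _ + _ * cint _ _ _); apply/funext => x.
- exact: cdotC.
- exact: cdotC.
- exact: mulrC.
Qed.

Lemma vol_triple_lin (c : C) w1 d1 u1 w2 d2 u2 w d u :
  L2v mu Om w1 -> L2 mu Om d1 -> L2v mu Om u1 ->
  L2v mu Om w2 -> L2 mu Om d2 -> L2v mu Om u2 ->
  L2v mu Om w -> L2 mu Om d -> L2v mu Om u ->
  vol_triple (lin c w1 w2) (fun x => c * d1 x + d2 x) (lin c u1 u2) w d u =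
  c * vol_triple w1 d1 u1 w d u + vol_triple w2 d2 u2 w d u.
Proof.
move=> Lw1 Ld1 Lu1 Lw2 Ld2 Lu2 Lw Ld Lu; rewrite /vol_triple.
have e1 := cint_cdot_lin mOm c Lw1 Lw2 Lw; have e2 := cint_cdot_lin mOm c Lu1 Lu2 Lu.
have e3 : cint mu Om (fun x => (c * d1 x + d2 x) * d x) =
    c * cint mu Om (fun x => d1 x * d x) + cint mu Om (fun x => d2 x * d x).
  have i1 := L2_mul mOm Ld1 Ld; have i2 := L2_mul mOm Ld2 Ld.
  rewrite -(cintZ mOm c i1) -(cintD mOm (cintgZ mOm c i1) i2).
  by congr (cint _ _ _); apply/funext => x; rewrite mulrDl mulrA.
move: e1 e2 e3; set p := cint _ _ _; set p1 := cint _ _ _; set p2 := cint _ _ _.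
set q := cint _ _ _; set q1 := cint _ _ _; set q2 := cint _ _ _.
set r := cint _ _ _; set r1 := cint _ _ _; set r2 := cint _ _ _.
rewrite -/p -/q -/r -/p1 -/q1 -/r1 -/p2 -/q2 -/r2 => -> -> ->.
by ring.
Qed.

Lemma vol_triple_ae w1 d1 u w2 d2 w d v :
  L2v mu Om w1 -> L2 mu Om d1 -> L2v mu Om w2 -> L2 mu Om d2 -> L2v mu Om w -> L2 mu Om d ->
  {ae mu, forall x, Om x -> w1 x = w2 x} -> {ae mu, forall x, Om x -> d1 x = d2 x} ->
  vol_triple w1 d1 u w d v = vol_triple w2 d2 u w d v.
Proof.
move=> Lw1 Ld1 Lw2 Ld2 Lw Ld ew ed; rewrite /vol_triple (cint_cdot_ae mOm Lw1 Lw2 Lw ew).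
congr (_ + _ * _); apply: (ae_cint mOm).
- exact: cintg_meas (L2_mul mOm Ld1 Ld).
- exact: cintg_meas (L2_mul mOm Ld2 Ld).
- by apply: filterS ed => x /[swap] Omx ->.
Qed.

Lemma vol_triple_conj w1 d1 u1 w d u :
  L2v mu Om w1 -> L2 mu Om d1 -> L2v mu Om u1 ->
  L2v mu Om w -> L2 mu Om d -> L2v mu Om u ->
  vol_triple (conjf w1) (fun x => conjc (d1 x)) (conjf u1) (conjf w) (fun x => conjc (d x)) (conjf u) =
  conjc (vol_triple w1 d1 u1 w d u).
Proof.
move=> Lw1 Ld1 Lu1 Lw Ld Lu; rewrite /vol_triple.
have e1 := cint_cdot_conj mOm Lw1 Lw; have e2 := cint_cdot_conj mOm Lu1 Lu.
have e3 : cint mu Om (fun x => conjc (d1 x) * conjc (d x)) =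
    conjc (cint mu Om (fun x => d1 x * d x)).
  rewrite -(cint_conj mOm (L2_mul mOm Ld1 Ld)).
  by congr (cint _ _ _); apply/funext => x; rewrite rmorphM.
have alg (p q r p' q' r' : C) : p = conjc p' -> q = conjc q' -> r = conjc r' ->
    p - alpha%:C * q + theta%:C * r = conjc (p' - alpha%:C * q' + theta%:C * r').
  by move=> -> -> ->; apply: eqC; rewrite !ReImE /=; ring.
exact: alg e1 e2 e3.
Qed.

Lemma vol_sym u phi : vol u phi = vol phi u.
Proof. by rewrite !volE vol_triple_sym. Qed.

Lemma vol_lin (c : C) u w phi : XT Om u -> XT Om w -> XT Om phi ->
  vol (lin c u w) phi = c * vol u phi + vol w phi.
Proof.
move=> Xu Xw Xp; have Xl := XT_lin c Xu Xw; rewrite !volE.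
rewrite -(vol_triple_lin c (XT_curl Xu) (XT_div Xu) (XT_L2 Xu) (XT_curl Xw) (XT_div Xw) (XT_L2 Xw)
  (XT_curl Xp) (XT_div Xp) (XT_L2 Xp)).
exact: (vol_triple_ae _ _ (XT_curl Xl) (XT_div Xl) (L2v_lin mOm c (XT_curl Xu) (XT_curl Xw))
  (L2D mOm (L2Z mOm c (XT_div Xu)) (XT_div Xw)) (XT_curl Xp) (XT_div Xp)
  (curl_lin c Xu Xw) (div_lin c Xu Xw)).
Qed.

Lemma vol_conj u phi : XT Om u -> XT Om phi ->
  vol (conjf u) (conjf phi) = conjc (vol u phi).
Proof.
move=> Xu Xp; have Xcu := XT_conj Xu; have Xcp := XT_conj Xp; rewrite !volE.
rewrite -(vol_triple_conj (XT_curl Xu) (XT_div Xu) (XT_L2 Xu) (XT_curl Xp) (XT_div Xp) (XT_L2 Xp)).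
have Lw := L2v_conj (XT_curl Xu); have Ld := L2_conj (XT_div Xu).
have Lw' := L2v_conj (XT_curl Xp); have Ld' := L2_conj (XT_div Xp).
rewrite (vol_triple_ae _ _ (XT_curl Xcu) (XT_div Xcu) Lw Ld (XT_curl Xcp) (XT_div Xcp)
  (curl_conj Xu) (div_conj Xu)) vol_triple_sym [RHS]vol_triple_sym.
exact: (vol_triple_ae _ _ (XT_curl Xcp) (XT_div Xcp) Lw' Ld' Lw Ld (curl_conj Xp) (div_conj Xp)).
Qed.

(** The factor 4 comes from [|p + q|^2 <= 2 (|p|^2 + |q|^2)] used twice, each 3 from
    [cauchy_schwarz_cdot]. *)
Lemma vol_bound : exists2 K, 0 <= K & forall u phi, XT Om u -> XT Om phi ->
  sqmod (vol u phi) <= K * (XTsq u * XTsq phi).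
Proof.
exists (4 * (3 + sqmod alpha%:C * 3 + sqmod theta%:C)).
  by have := sqmod_ge0 alpha%:C; have := sqmod_ge0 theta%:C; lra.
have alg (K x y A T q p r : R) : x <= 2 * (r + A * q) -> A * q <= A * (3 * K) ->
    T * p <= T * K -> 0 <= T * K -> r <= 3 * K ->
    2 * (x + T * p) <= 4 * (3 + A * 3 + T) * K.
  have -> : 4 * (3 + A * 3 + T) * K = 12 * K + 12 * (A * K) + 4 * (T * K) by ring.
  have -> : A * (3 * K) = 3 * (A * K) by ring.
  move: (A * q) (A * K) (T * p) (T * K) => *; lra.
move=> u phi Xu Xp; rewrite /vol_form.
have := cauchy_schwarz_cdot mOm (XT_curl Xu) (XT_curl Xp).
have := cauchy_schwarz_cdot mOm (XT_L2 Xu) (XT_L2 Xp).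
have := cauchy_schwarz mOm (XT_div Xu) (XT_div Xp).
set p := cint _ _ _; set q := cint _ _ _; set r := cint _ _ _.
have aux (A B A' B' : R) : 0 <= A -> A <= B -> 0 <= A' -> A' <= B' -> A * A' <= B * B'.
  by move=> *; exact: ler_pM.
have Qp : rint mu Om (fun x => sqmod (div Om u x)) * rint mu Om (fun x => sqmod (div Om phi x))
    <= XTsq u * XTsq phi.
  by apply: aux; rewrite ?rint_sqmod_ge0 /XTsq ?lerDr ?addr_ge0 ?rint_sqnorm_ge0.
have Qq : rint mu Om (fun x => sqnorm (u x)) * rint mu Om (fun x => sqnorm (phi x)) <= XTsq u * XTsq phi.
  by apply: aux; rewrite ?rint_sqnorm_ge0 /XTsq// -addrA lerDl addr_ge0
    ?rint_sqnorm_ge0 ?rint_sqmod_ge0.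
have Qr : rint mu Om (fun x => sqnorm (curl Om u x)) *
    rint mu Om (fun x => sqnorm (curl Om phi x)) <= XTsq u * XTsq phi.
  by apply: aux; rewrite ?rint_sqnorm_ge0 /XTsq// addrAC lerDr addr_ge0
    ?rint_sqnorm_ge0 ?rint_sqmod_ge0.
move: Qp Qq Qr; move: (XTsq u * XTsq phi) => K Qp Qq Qr hp hq hr.
have {}hp := le_trans hp Qp.
have {}hq : sqmod q <= 3 * K by apply: le_trans hq _; rewrite ler_wpM2l.
have {}hr : sqmod r <= 3 * K by apply: le_trans hr _; rewrite ler_wpM2l.
apply: le_trans (sqmodD_le _ _) _; rewrite sqmodM.
have := sqmodD_le r (- (alpha%:C * q)); rewrite sqmodN sqmodM => h1.
have h2 : sqmod alpha%:C * sqmod q <= sqmod alpha%:C * (3 * K).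
  by rewrite ler_wpM2l ?sqmod_ge0.
have h3 : sqmod theta%:C * sqmod p <= sqmod theta%:C * K.
  by rewrite ler_wpM2l ?sqmod_ge0.
have K0 : 0 <= K by exact: le_trans (sqmod_ge0 p) hp.
have h4 : 0 <= sqmod theta%:C * K by rewrite mulr_ge0 ?sqmod_ge0.
exact: alg h1 h2 h3 h4 hr.
Qed.

Lemma vol_cvg (s : nat -> vfield) v phi : (forall n, XT Om (s n)) -> XT Om v ->
  XT Om phi -> XT_cvg Om s v -> cvgC (fun n => vol (s n) phi) (vol v phi).
Proof.
move=> Xs Xv Xp /XT_cvgE cv; have [K K0 HK] := vol_bound.
apply: (cvgC_squeeze (u := fun n => K * (XTsq (fun x => s n x - v x) * XTsq phi))).
  move=> n; have := HK _ _ (XT_lin (-1) Xv (Xs n)) Xp.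
  by rewrite (vol_lin (-1) Xv (Xs n) Xp) mulN1r addrC -subE.
rewrite -(mulr0 K) -[in X in _ --> X](mul0r (XTsq phi)).
by apply: cvgM; [exact: cvg_cst|apply: cvgM => //; exact: cvg_cst].
Qed.

End XTSpace.

(** * Traces *)

Section Traces.
Variables (R : realType) (Om : set (pt R)) (a b : pt R).
Hypothesis oOm : open Om.
Hypothesis bOm : bounded_set Om.
Hypothesis C11Om : C11_domain Om.
Hypothesis Omab : Om `<=` cbox a b.
Local Notation C := R[i].
Local Notation vfield := (vfield R).
Local Notation mu := (@leb3 R).
Local Notation nu := (@hausdorff2 R).
Local Notation B := (bdry Om).
Implicit Types (u v w g h phi : vfield) (f d : pt R -> C) (psi : pt R -> R).

Let mOm : measurable Om. Proof. exact: open_measurable3. Qed.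
Let mB : measurable B. Proof. exact: measurable_bdry. Qed.
Let finB : (nu B < +oo)%E. Proof. exact: hausdorff2_bdry_lty. Qed.
Lemma bdry_cbox : B `<=` cbox a b.
Proof.
move=> x [cx _]; have := closure_subset Omab cx.
by rewrite -(closure_id _).1//; exact: closed_cbox.
Qed.

Lemma normalE x k : normal Om x 0 k = (Defs.coord (outer_normal Om x) k)%:C.
Proof. by rewrite mxE. Qed.

Lemma normal_sq x : B x -> \sum_k normal Om x 0 k * normal Om x 0 k = 1.
Proof.
move=> Bx; have := enorm_outer_normal oOm C11Om bOm Bx.
rewrite /enorm => /(congr1 (fun r => r ^+ 2)); rewrite sqr_sqrtr; last first.
  by rewrite /dotp sumr_ge0// => k _; rewrite -expr2 sqr_ge0.
rewrite expr1n => e; transitivity ((dotp (outer_normal Om x) (outer_normal Om x))%:C).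
  by rewrite /dotp rmorph_sum; apply: eq_bigr => k _; rewrite normalE rmorphM.
by rewrite e.
Qed.

Lemma sqmod_normal_le x k : B x -> sqmod (normal Om x 0 k) <= 1.
Proof.
move=> Bx; rewrite normalE /sqmod /= expr0n addr0 -real_normK ?num_real// expr_le1//.
by rewrite -(enorm_outer_normal oOm C11Om bOm Bx) coord_le_enorm.
Qed.

Lemma cmeas_normal k : cmeas B (fun x => normal Om x 0 k).
Proof.
under eq_fun do rewrite normalE.
by split=> /=; [exact: measurable_outer_normal|exact: measurable_cst].
Qed.

Lemma L2_normal_mul k f : L2 nu B f -> L2 nu B (fun x => normal Om x 0 k * f x).
Proof.
move=> /L2P[mf fi]; apply/L2P; split.
  exact: cmeasM (cmeas_normal k) mf.
apply: (intg_le mB _ _ fi).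
  exact: measurable_sqmod (cmeasM (cmeas_normal k) mf).
move=> x Bx; rewrite ger0_norm ?sqmod_ge0// sqmodM -[leRHS]mul1r.
by rewrite ler_wpM2r ?sqmod_ge0// sqmod_normal_le.
Qed.

Definition flux psi k f : C := cint nu B (fun x => (psi x)%:C * (normal Om x 0 k * f x)).

Lemma flux_lin psi k (c : C) f d : continuous psi -> L2 nu B f -> L2 nu B d ->
  flux psi k (fun x => c * f x + d x) = c * flux psi k f + flux psi k d.
Proof.
move=> cp Lf Ld.
have i1 := continuous_cintg mB finB bdry_cbox cp (L2_normal_mul k Lf).
have i2 := continuous_cintg mB finB bdry_cbox cp (L2_normal_mul k Ld).
rewrite /flux -(cintZ mB c i1) -(cintD mB (cintgZ mB c i1) i2).
by congr (cint _ _ _); apply/funext => x; ring.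
Qed.

Lemma flux_conj psi k f : continuous psi -> L2 nu B f ->
  flux psi k (fun x => conjc (f x)) = conjc (flux psi k f).
Proof.
move=> cp Lf.
have i1 := continuous_cintg mB finB bdry_cbox cp (L2_normal_mul k Lf).
rewrite /flux -(cint_conj mB i1).
congr (cint _ _ _); apply/funext => x; rewrite normalE.
by apply: eqC; rewrite !ReImE /=; ring.
Qed.

Lemma fluxE psi k g j :
  cint nu B (fun x => (psi x)%:C * normal Om x 0 k * g x 0 j) = flux psi k (fun x => g x 0 j).
Proof. by congr (cint _ _ _); apply/funext => x; rewrite mulrA. Qed.

Lemma forall_ord3 (P : 'I_3 -> Prop) : P (inord 0) -> P (inord 1) -> P (inord 2) -> forall k, P k.
Proof.
move=> p0 p1 p2 [[|[|[|//]]] k3].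
- by rewrite (_ : Ordinal k3 = inord 0)//; apply: val_inj; rewrite /= inordK.
- by rewrite (_ : Ordinal k3 = inord 1)//; apply: val_inj; rewrite /= inordK.
- by rewrite (_ : Ordinal k3 = inord 2)//; apply: val_inj; rewrite /= inordK.
Qed.

Lemma ae_forall3 (P : 'I_3 -> pt R -> Prop) : (forall k, {ae nu, forall x, B x -> P k x}) ->
  {ae nu, forall x, B x -> forall k, P k x}.
Proof.
move=> H; apply: filterS3 (H (inord 0)) (H (inord 1)) (H (inord 2)) => x h0 h1 h2 Bx.
by apply: forall_ord3; [exact: h0|exact: h1|exact: h2].
Qed.

Definition green u (G : 'I_3 -> vfield) g : Prop :=
  forall psi, test_fun setT psi -> forall j k,
    cint mu Om (fun x => (partial k psi x)%:C * u x 0 j)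
    + cint mu Om (fun x => (psi x)%:C * G k x 0 j) = flux psi k (fun x => g x 0 j).

Definition weak_gradient u (G : 'I_3 -> vfield) : Prop :=
  forall k, L2v mu Om (G k) /\
    forall j, is_weak_partial Om k (fun x => u x 0 j) (fun x => G k x 0 j).

Lemma is_traceP u g : is_trace Om u g <->
  L2v nu B g /\ exists2 G, L2v mu Om u /\ weak_gradient u G & green u G g.
Proof.
split=> -[Lg [G [Lu wG] gr]]; (split; first by []); exists G; try by [split];
  move=> psi t j k; [rewrite -fluxE -gr//|rewrite fluxE -gr//]; rewrite (cintD mOm)//;
  try exact: (cintg_partial oOm Omab k t (Lu j)); exact: (cintg_test oOm Omab t ((wG k).1 j)).
Qed.

Lemma lin_coord (c : C) u w j : (fun x => lin c u w x 0 j) = fun x => c * u x 0 j + w x 0 j.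
Proof. by apply/funext => x; rewrite linE. Qed.

Lemma conjf_coord u j : (fun x => conjf u x 0 j) = fun x => conjc (u x 0 j).
Proof. by apply/funext => x; rewrite conjfE. Qed.

Lemma is_trace_lin (c : C) u w g h : is_trace Om u g -> is_trace Om w h ->
  is_trace Om (lin c u w) (lin c g h).
Proof.
move=> /is_traceP[Lg [G [Lu wG] grG]] /is_traceP[Lh [H [Lw wH] grH]].
apply/is_traceP; split; first exact: (L2v_lin mB c Lg Lh).
exists (fun k => lin c (G k) (H k)).
  split; first exact: (L2v_lin mOm c Lu Lw).
  move=> k; split; first exact: (L2v_lin mOm c (wG k).1 (wH k).1).
  move=> j; rewrite !lin_coord.
  exact: (weak_partial_lin oOm Omab c (Lu j) (Lw j) ((wG k).1 j) ((wH k).1 j)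
    ((wG k).2 j) ((wH k).2 j)).
move=> psi t j k; rewrite lin_coord.
have cp := test_fun_continuous t.
rewrite (flux_lin k c cp (Lg j) (Lh j)) -grG// -grH//.
have e1 := cint_test_lin oOm Omab c (test_fun_partial_continuous t (k := k)) (Lu j) (Lw j).
have e2 := cint_test_lin oOm Omab c cp ((wG k).1 j) ((wH k).1 j).
under eq_fun do rewrite linE.
under [in X in _ + X]eq_fun do rewrite linE.
by rewrite e1 e2; ring.
Qed.

Lemma is_trace_conj u g : is_trace Om u g -> is_trace Om (conjf u) (conjf g).
Proof.
move=> /is_traceP[Lg [G [Lu wG] grG]].
apply/is_traceP; split; first exact: L2v_conj.
exists (fun k => conjf (G k)).
  split; first exact: L2v_conj.
  move=> k; split; first exact: L2v_conj (wG k).1.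
  move=> j; rewrite !conjf_coord.
  exact: (weak_partial_conj oOm Omab (Lu j) ((wG k).1 j) ((wG k).2 j)).
move=> psi t j k; rewrite conjf_coord.
have cp := test_fun_continuous t.
rewrite (flux_conj k cp (Lg j)) -grG//.
have e1 := cint_test_conj oOm Omab (test_fun_partial_continuous t (k := k)) (Lu j).
have e2 := cint_test_conj oOm Omab cp ((wG k).1 j).
under eq_fun do rewrite conjfE.
under [in X in _ + X]eq_fun do rewrite conjfE.
by rewrite e1 e2 rmorphD.
Qed.

Lemma flux_zero f : L2 nu B f ->
  (forall psi, test_fun setT psi -> cint nu B (fun x => (psi x)%:C * f x) = 0) ->
  {ae nu, forall x, B x -> f x = 0}.
Proof.
move=> Lf H; apply: (du_bois_reymondC mB (@openT _) (@subsetT _ B) _ H).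
exact: (L2_cintg mB finB bdry_cbox Lf).
Qed.

(** The weak gradients agree almost everywhere, so Green's formula gives [nu_k (g_j - h_j) = 0] for
    every [k]. Multiplying by [nu_k] and summing over [k] isolates [g_j - h_j]. *)
Lemma is_trace_unique u g h : is_trace Om u g -> is_trace Om u h ->
  {ae nu, forall x, B x -> g x = h x}.
Proof.
move=> /is_traceP[Lg [G [Lu wG] grG]] /is_traceP[Lh [H [_ wH] grH]].
have fluxe psi k j : test_fun setT psi -> flux psi k (fun x => g x 0 j) = flux psi k (fun x => h x 0 j).
  move=> t; rewrite -grG// -grH//; congr (_ + _).
  apply: (cint_test_ae oOm Omab t ((wG k).1 j) ((wH k).1 j)).
  exact: (weak_partial_unique oOm Omab ((wG k).1 j) ((wH k).1 j) ((wG k).2 j) ((wH k).2 j)).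
have z k j : {ae nu, forall x, B x -> normal Om x 0 k * (- 1 * h x 0 j + g x 0 j) = 0}.
  have Ld := L2D mB (L2Z mB (- 1) (Lh j)) (Lg j).
  apply: flux_zero (L2_normal_mul k Ld) _ => psi t.
  have := flux_lin k (- 1) (test_fun_continuous t) (Lh j) (Lg j).
  by rewrite fluxe// mulN1r addNr.
have zj j : {ae nu, forall x, B x -> g x 0 j = h x 0 j}.
  apply: filterS (ae_forall3 (fun k => z k j)) => x zx Bx; have {}zx := zx Bx.
  apply/eqP; rewrite eq_sym -subr_eq0; apply/eqP.
  rewrite -opprB -[g x 0 j - _]mul1r -(normal_sq Bx) mulr_suml big1 ?oppr0// => k _.
  by rewrite -mulrA [X in _ * (_ * X)]addrC -[X in - X]mul1r -mulNr zx mulr0.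
apply: filterS (ae_forall3 zj) => x zx Bx.
by apply/rowP => k; exact: zx.
Qed.

Lemma traceP u : (exists g, is_trace Om u g) -> is_trace Om u (trace Om u).
Proof. by move=> h; exact: (xgetPex (fun=> 0) h). Qed.

Local Opaque trace.

Lemma trace_ae u g : is_trace Om u g -> {ae nu, forall x, B x -> trace Om u x = g x}.
Proof. by move=> ug; exact: is_trace_unique (traceP (ex_intro _ g ug)) ug. Qed.

(** The diagonal cases [j = k] of Green's formula add up to the normal trace pairing, the trace of
    the weak gradient being a weak divergence. That pairing vanishes on X_T, and it equals the
    integral of [psi (nu . g)]. *)
Lemma trace_tangential u g : XT Om u -> is_trace Om u g -> TL2 Om g.
Proof.
move=> Xu /is_traceP[Lg [G [Lu wG] grG]]; split=> //.
have Ld := XT_div Xu.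
have LG : L2 mu Om (fun x => \sum_k G k x 0 k).
  rewrite (_ : (fun x => _) = fun x => G (inord 0) x 0 (inord 0) + G (inord 1) x 0 (inord 1)
      + G (inord 2) x 0 (inord 2)); last by apply/funext => x; rewrite sum3.
  exact: (L2D mOm (L2D mOm ((wG _).1 _) ((wG _).1 _)) ((wG _).1 _)).
have sumG psi : test_fun setT psi ->
    cint mu Om (fun x => (psi x)%:C * \sum_k G k x 0 k) =
    \sum_k cint mu Om (fun x => (psi x)%:C * G k x 0 k).
  move=> t; under eq_fun do rewrite mulr_sumr.
  by rewrite (cint_sum mOm)// => k _; exact: (cintg_test oOm Omab t ((wG k).1 k)).
have wdiv : is_weak_div Om u (fun x => \sum_k G k x 0 k).
  move=> psi t; have tT := test_funT t.
  rewrite sumG// (cint_div_split oOm Omab tT Lu) -sumrN; apply: eq_bigr => k _.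
  exact: (wG k).2.
have Lf : L2 nu B (fun x => cdot (normal Om x) (g x)).
  rewrite (_ : (fun x => _) = fun x => normal Om x 0 (inord 0) * g x 0 (inord 0)
      + normal Om x 0 (inord 1) * g x 0 (inord 1)
      + normal Om x 0 (inord 2) * g x 0 (inord 2)); last by apply/funext => x; rewrite /cdot sum3.
  exact: (L2D mB (L2D mB (L2_normal_mul _ (Lg _)) (L2_normal_mul _ (Lg _))) (L2_normal_mul _ (Lg _))).
apply: flux_zero Lf _ => psi t.
have -> : cint nu B (fun x => (psi x)%:C * cdot (normal Om x) (g x)) =
    \sum_k flux psi k (fun x => g x 0 k).
  rewrite /cdot; under eq_fun do rewrite mulr_sumr.
  rewrite (cint_sum mB)// => k _.
  exact: (continuous_cintg mB finB bdry_cbox (test_fun_continuous t) (L2_normal_mul k (Lg k))).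
have [_ _ _ /(zero_normal_traceP oOm Omab Lu Ld)/(_ _ t) h0] := Xu.
rewrite -[RHS]h0 /normal_trace_test (cint_test_ae oOm Omab t Ld LG (div_ae oOm Omab LG wdiv)) sumG//.
rewrite -big_split /=; apply: eq_bigr => k _; exact/esym/grG.
Qed.

Lemma cross_cross (p q : 'rV[C]_3) :
  cross p (cross q p) = cdot p p *: q - cdot p q *: p.
Proof.
have o0 : ordS (inord 0 : 'I_3) = inord 1 by apply: val_inj; rewrite /= !inordK.
have o1 : ordS (inord 1 : 'I_3) = inord 2 by apply: val_inj; rewrite /= !inordK.
have o2 : ordS (inord 2 : 'I_3) = inord 0 by apply: val_inj; rewrite /= !inordK.
apply/rowP; apply: forall_ord3; rewrite /cross /cdot !mxE !sum3 ?(o0, o1, o2); ring.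
Qed.

(** [nu x (g x nu) = |nu|^2 g - (nu . g) nu], where the second term vanishes for tangential [g]. *)
Lemma piT_ae u g : is_trace Om u g -> XT Om u ->
  {ae nu, forall x, B x -> piT Om u x = g x}.
Proof.
move=> ug Xu; have [_ tg] := trace_tangential Xu ug.
apply: filterS2 (trace_ae ug) tg => x e tx Bx.
rewrite /piT (e Bx) cross_cross (tx Bx) scale0r subr0.
by rewrite /cdot (normal_sq Bx) scale1r.
Qed.

(* On fields without a trace in the sense of [is_trace], [trace] is the junk value 0;
   [XT_has_trace] rules these out. *)
Hypothesis has_trace : forall u, XT Om u -> exists g, is_trace Om u g.

Lemma XT_is_trace u : XT Om u -> is_trace Om u (trace Om u).
Proof. by move=> Xu; exact/traceP/has_trace. Qed.

Lemma XT_TL2 u : XT Om u -> TL2 Om (trace Om u).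
Proof. by move=> Xu; exact: trace_tangential Xu (XT_is_trace Xu). Qed.

Lemma XT_trace_L2 u : XT Om u -> L2v nu B (trace Om u).
Proof. by move=> /XT_TL2[]. Qed.

Lemma trace_lin (c : C) u w : XT Om u -> XT Om w ->
  {ae nu, forall x, B x -> trace Om (lin c u w) x = lin c (trace Om u) (trace Om w) x}.
Proof. by move=> Xu Xw; apply: trace_ae; exact: is_trace_lin (XT_is_trace Xu) (XT_is_trace Xw). Qed.

Lemma trace_conj u : XT Om u ->
  {ae nu, forall x, B x -> trace Om (conjf u) x = conjf (trace Om u) x}.
Proof. by move=> Xu; apply: trace_ae; exact: is_trace_conj (XT_is_trace Xu). Qed.

Local Notation bf := (bdry_form Om).

Lemma bdry_sym u w : bf u w = bf w u.
Proof. by congr (cint _ _ _); apply/funext => x; exact: cdotC. Qed.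

Lemma bdry_lin (c : C) u w phi : XT Om u -> XT Om w -> XT Om phi ->
  bf (lin c u w) phi = c * bf u phi + bf w phi.
Proof.
move=> Xu Xw Xp; have Xl := XT_lin oOm Omab c Xu Xw.
have [Tu Tw Tp] := And3 (XT_trace_L2 Xu) (XT_trace_L2 Xw) (XT_trace_L2 Xp).
rewrite /bdry_form -(cint_cdot_lin mB c Tu Tw Tp).
exact: (cint_cdot_ae mB (XT_trace_L2 Xl) (L2v_lin mB c Tu Tw) Tp (trace_lin c Xu Xw)).
Qed.

Lemma bdry_conj u phi : XT Om u -> XT Om phi -> bf (conjf u) (conjf phi) = conjc (bf u phi).
Proof.
move=> Xu Xp; have Xcu := XT_conj oOm Omab Xu; have Xcp := XT_conj oOm Omab Xp.
have [Tu Tp] := (XT_trace_L2 Xu, XT_trace_L2 Xp).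
have [Tcu Tcp] := (XT_trace_L2 Xcu, XT_trace_L2 Xcp).
have [Cu Cp] := (L2v_conj Tu, L2v_conj Tp).
rewrite /bdry_form -(cint_cdot_conj mB Tu Tp) (cint_cdot_ae mB Tcu Cu Tcp (trace_conj Xu)).
have sw (p q : vfield) : cint nu B (fun x => cdot (p x) (q x)) = cint nu B (fun x => cdot (q x) (p x)).
  by congr (cint _ _ _); apply/funext => x; exact: cdotC.
rewrite sw [RHS]sw.
exact: (cint_cdot_ae mB Tcp Cp Cu (trace_conj Xp)).
Qed.

End Traces.

(** * Expansions in Steklov eigenfunctions *)

Lemma ell2_tail (R : realType) (be : nat -> R[i]) : ell2 be -> forall e, 0 < e ->
  exists N, forall n j, (N <= n)%N -> \sum_(0 <= k < j) sqmod (be (n + k)%N) <= e.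
Proof.
move=> /cvg_cauchy/cauchy_seriesP H e /H[[A A'] [/= [N1 _ HA] [N2 _ HA']] AA'].
exists (maxn N1 N2) => n j; rewrite geq_max => /andP[n1 n2].
have /= := AA' (n, (n + j)%N) (conj (HA n n1) (HA' (n + j)%N (leq_trans n2 (leq_addr _ _)))).
move=> /ltW; apply: le_trans; apply: le_trans (ler_norm _).
rewrite -[in leRHS](add0n n) [in leRHS]big_addn addKn; rewrite le_eqVlt; apply/orP; left; apply/eqP.
by apply: eq_bigr => k _; rewrite addnC.
Qed.

Section Steklov.
Variables (R : realType) (Om : set (pt R)) (a b : pt R) (alpha theta eta : R)
  (lam : nat -> R) (u : nat -> vfield R).
Hypothesis oOm : open Om.
Hypothesis bOm : bounded_set Om.
Hypothesis C11Om : C11_domain Om.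
Hypothesis Omab : Om `<=` cbox a b.
Hypothesis coe : coercive Om alpha theta eta.
Hypothesis stek : steklov_basis Om alpha theta eta lam u.
Hypothesis lam0 : forall n, lam n <> 0.
Local Notation C := R[i].
Local Notation vfield := (vfield R).
Local Notation mu := (@leb3 R).
Local Notation nu := (@hausdorff2 R).
Local Notation B := (bdry Om).
Local Notation vol := (vol_form Om alpha theta).
Local Notation bf := (bdry_form Om).
Local Notation sf := (sform Om alpha theta eta).
Implicit Types (v w g h phi psi : vfield).

Local Opaque curl div.

Let mOm : measurable Om. Proof. exact: open_measurable3. Qed.
Let mB : measurable B. Proof. exact: measurable_bdry. Qed.

Lemma eigen_XT n : XT Om (u n).
Proof. by have [/(_ n)[]] := stek. Qed.

Lemma eigen_vol n phi : XT Om phi -> vol (u n) phi = - (lam n)%:C * bf (u n) phi.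
Proof. by have [/(_ n)[_ _ h] _ _ _ _] := stek; exact: h. Qed.

Lemma eigen_orth n m : sf (u n) (u m) = (n == m)%:R.
Proof. by have [_ _ _ _ [_ h _]] := stek; exact: h. Qed.

Lemma gap_gt0 n : 0 < eta - lam n.
Proof. by have [_ _ h _ _] := stek; rewrite subr_gt0. Qed.

Lemma XT_conjf v : XT Om v -> XT Om (conjf v).
Proof. exact: (XT_conj oOm Omab). Qed.

Lemma eigen_sform n phi : XT Om phi -> sf (u n) phi = (eta - lam n)%:C * bf (u n) (conjf phi).
Proof.
move=> Xp; rewrite /sform (eigen_vol n (XT_conjf Xp)) rmorphB /=; ring.
Qed.

Lemma eigen_bdry_neq0 n : bf (u n) (conjf (u n)) <> 0.
Proof.
move=> e; have := eigen_orth n n; rewrite (eigen_sform n (eigen_XT n)) e mulr0 eqxx.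
by move/eqP; rewrite eq_sym oner_eq0.
Qed.

(** The default value 0 of [trace] makes the boundary form blind to such a field. *)
Lemma no_trace v w : ~ (exists g, is_trace Om w g) -> bf v w = 0.
Proof.
move=> nw; rewrite /bdry_form.
have -> : trace Om w = fun=> 0.
  by rewrite [LHS]xgetPN// => g wg; apply: nw; exists g.
rewrite -[RHS](cint0 (@hausdorff2 R) B); congr (cint _ _ _); apply/funext => x.
by rewrite /cdot big1// => k _; rewrite mxE mulr0.
Qed.

Local Opaque trace.

Lemma lin_linN (c : C) v w : lin (- c) v (lin c v w) = w.
Proof. by apply/funext => x; rewrite /lin addrA -scalerDl addNr scale0r add0r. Qed.

(* The first eigenfunction has a nonzero trace.  A field w in X_T without a trace, and
   then also w + conj u_0, would have zero boundary form with u_0, so the eigenvalue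
   equation would give vol (u_0, conj u_0) = 0. *)
Lemma XT_has_trace w : XT Om w -> exists g, is_trace Om w g.
Proof.
move=> Xw; apply: contrapT => nw.
have Xu := XT_conjf (eigen_XT 0).
have tcu : exists g, is_trace Om (conjf (u 0)) g.
  apply: contrapT => /(no_trace (u 0)); exact: eigen_bdry_neq0.
have nl : ~ exists g, is_trace Om (lin 1 (conjf (u 0)) w) g.
  move=> [g tg]; have [h th] := tcu; apply: nw; exists (lin (- 1) h g).
  rewrite -(lin_linN 1 (conjf (u 0)) w).
  exact: (is_trace_lin oOm bOm C11Om Omab (- 1) th tg).
have e1 := eigen_vol 0 Xw; have e2 := eigen_vol 0 (XT_lin oOm Omab 1 Xu Xw).
rewrite (no_trace _ nw) mulr0 in e1; rewrite (no_trace _ nl) mulr0 in e2.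
move: e2; rewrite vol_sym (vol_lin oOm Omab alpha theta 1 Xu Xw (eigen_XT 0)).
rewrite ![vol _ (u 0)]vol_sym e1 addr0 mul1r (eigen_vol 0 Xu) => /eqP.
rewrite mulf_eq0 oppr_eq0 => /orP[/eqP/(congr1 (@complex.Re R)) /=|/eqP]; first exact: lam0.
exact: eigen_bdry_neq0.
Qed.

Local Opaque XT vol_form bdry_form.

Lemma bform_lin (c : C) v w phi : XT Om v -> XT Om w -> XT Om phi ->
  bf (lin c v w) phi = c * bf v phi + bf w phi.
Proof. exact: (bdry_lin oOm bOm C11Om Omab XT_has_trace). Qed.

Lemma sform_lin (c : C) v w phi : XT Om v -> XT Om w -> XT Om phi ->
  sf (lin c v w) phi = c * sf v phi + sf w phi.
Proof.
move=> Xv Xw Xp; have Xcp := XT_conjf Xp; rewrite /sform.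
rewrite (vol_lin oOm Omab alpha theta c Xv Xw Xcp) (bform_lin c Xv Xw Xcp).
by move: (vol v _) (vol w _) (bf v _) (bf w _) => p q r s; ring.
Qed.

Lemma sform_conj v w : XT Om v -> XT Om w -> sf (conjf v) (conjf w) = conjc (sf v w).
Proof.
move=> Xv Xw; rewrite /sform; have Xcw := XT_conjf Xw.
rewrite (vol_conj oOm Omab alpha theta Xv Xcw).
rewrite (bdry_conj oOm bOm C11Om Omab XT_has_trace Xv Xcw).
by apply: eqC; rewrite !ReImE /=; ring.
Qed.

Lemma sform_sym v w : sf v w = sf (conjf w) (conjf v).
Proof. by rewrite /sform conjfK vol_sym bdry_sym. Qed.

Lemma sform_herm v w : XT Om v -> XT Om w -> sf w v = conjc (sf v w).
Proof. by move=> Xv Xw; rewrite -(sform_conj Xv Xw) -sform_sym. Qed.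

Lemma sform_linr (c : C) v w phi : XT Om v -> XT Om w -> XT Om phi ->
  sf phi (lin c v w) = conjc c * sf phi v + sf phi w.
Proof.
move=> Xv Xw Xp; rewrite (sform_herm (XT_lin oOm Omab c Xv Xw) Xp) (sform_lin c Xv Xw Xp).
rewrite (sform_herm Xp Xv) (sform_herm Xp Xw).
by move: (sf phi v) (sf phi w) => p q; apply: eqC; rewrite !ReImE /=; ring.
Qed.

Lemma sform_ge0 v : XT Om v -> 0 <= complex.Re (sf v v).
Proof.
move=> Xv; have [k k0 /(_ v Xv)] := coe; apply: le_trans.
by rewrite XTnorm2 mulr_ge0 ?XTsq_ge0// ltW.
Qed.

(** The components of [w] are subtracted one at a time. The residual [r] keeps the coefficients of
    [w] at later eigenfunctions, which carries the induction, and coercivity makes its square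
    nonnegative. *)
Lemma bessel w : XT Om w -> forall N,
  \sum_(0 <= n < N) sqmod (sf w (u n)) <= complex.Re (sf w w).
Proof.
move=> Xw N; have [r [Xr _ e]] : exists r, [/\ XT Om r,
    forall m, (N <= m)%N -> sf r (u m) = sf w (u m) &
    complex.Re (sf r r) = complex.Re (sf w w) - \sum_(0 <= n < N) sqmod (sf w (u n))].
  have alg (p q : C) (W S T : R) : T = S + sqmod p -> complex.Re q = W - S ->
      complex.Re (- p * (conjc (- p) * true%:R + conjc p) + (conjc (- p) * p + q)) = W - T.
    by move=> -> e; rewrite !ReImE e /sqmod /=; ring.
  elim: N => [|N [r [Xr rm e]]].
    by exists w; split=> //; rewrite big_geq// subr0.
  have Xu := eigen_XT N; have Xl := XT_lin oOm Omab (- sf w (u N)) Xu Xr.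
  exists (lin (- sf w (u N)) (u N) r); split; first exact: Xl.
    move=> m Nm; rewrite (sform_lin _ Xu Xr (eigen_XT m)) eigen_orth (ltn_eqF Nm) mulr0 add0r.
    exact/rm/ltnW.
  rewrite (sform_lin _ Xu Xr Xl) (sform_linr _ Xu Xr Xu) (sform_linr _ Xu Xr Xr).
  rewrite (sform_herm Xr Xu) eigen_orth eqxx (rm N (leqnn N)).
  have eS : \sum_(0 <= n < N.+1) sqmod (sf w (u n)) =
      \sum_(0 <= n < N) sqmod (sf w (u n)) + sqmod (sf w (u N)) by exact: big_nat_recr.
  exact: alg eS e.
by rewrite -subr_ge0 -e sform_ge0.
Qed.

(** The solution is expanded in these because [vol] is bilinear while the coefficients of a trace
    are taken against conjugates: [vol (cu n) psi] is a multiple of the [n]-th coefficient of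
    [psi]. *)
Definition conj_eigen n : vfield := conjf (u n).
Local Notation cu := conj_eigen.

Lemma conj_eigen_XT n : XT Om (cu n). Proof. exact/XT_conjf/eigen_XT. Qed.

Lemma conj_eigen_orth n m : sf (cu n) (cu m) = (n == m)%:R.
Proof.
by rewrite (sform_conj (eigen_XT n) (eigen_XT m)) eigen_orth rmorph_nat.
Qed.

(** Writing the zero field as a combination of members of the family lets the linearity lemmas
    handle the base case of inductions. *)
Lemma psum0 (be : nat -> C) (s : nat -> vfield) : psum be s 0 = lin (- 1) (s 0) (s 0).
Proof. by apply/funext => x; rewrite /psum big_ord0 /lin scaleN1r addNr. Qed.

Lemma psumS (be : nat -> C) (s : nat -> vfield) N :
  psum be s N.+1 = lin (be N) (s N) (psum be s N).
Proof. by apply/funext => x; rewrite /psum /lin big_ord_recr addrC. Qed.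

Lemma psum_XT (be : nat -> C) (s : nat -> vfield) N : (forall n, XT Om (s n)) ->
  XT Om (psum be s N).
Proof.
move=> Xs; elim: N => [|N IH]; first by rewrite psum0; exact: (XT_lin oOm Omab (- 1) (Xs 0) (Xs 0)).
by rewrite psumS; exact: (XT_lin oOm Omab (be N) (Xs N) IH).
Qed.

Lemma vol_psum (be : nat -> C) (s : nat -> vfield) N phi : (forall n, XT Om (s n)) -> XT Om phi ->
  vol (psum be s N) phi = \sum_(n < N) be n * vol (s n) phi.
Proof.
move=> Xs Xp; elim: N => [|N IH].
  by rewrite psum0 (vol_lin oOm Omab alpha theta (- 1) (Xs 0) (Xs 0) Xp) big_ord0 mulN1r addNr.
by rewrite psumS (vol_lin oOm Omab alpha theta _ (Xs N) (psum_XT be N Xs) Xp) IH big_ord_recr addrC.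
Qed.

Lemma psum_sform (be : nat -> C) (s : nat -> vfield) N : (forall n, XT Om (s n)) ->
  (forall n m, sf (s n) (s m) = (n == m)%:R) ->
  complex.Re (sf (psum be s N) (psum be s N)) = \sum_(0 <= n < N) sqmod (be n).
Proof.
(* The statement is strengthened by the orthogonality of the partial sum to later members, which
   removes the cross terms. *)
move=> Xs orth; suff [_ ->//] : (forall m, (N <= m)%N -> sf (psum be s N) (s m) = 0) /\
   complex.Re (sf (psum be s N) (psum be s N)) = \sum_(0 <= n < N) sqmod (be n).
elim: N => [|N [IH1 IH2]].
  have z phi : XT Om phi -> sf (psum be s 0) phi = 0.
    by move=> Xp; rewrite psum0 (sform_lin (- 1) (Xs 0) (Xs 0) Xp) mulN1r addNr.
  split=> [m _|]; first exact: z.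
  by rewrite (z _ (psum_XT be 0 Xs)) big_geq.
have [Xp Xp'] := (psum_XT be N Xs, psum_XT be N.+1 Xs).
rewrite psumS in Xp' *; split.
  move=> m Nm; rewrite (sform_lin _ (Xs N) Xp (Xs m)) orth (ltn_eqF Nm) mulr0 add0r.
  exact/IH1/ltnW.
rewrite (sform_lin _ (Xs N) Xp Xp') (sform_linr _ (Xs N) Xp (Xs N)) (sform_linr _ (Xs N) Xp Xp).
rewrite (sform_herm Xp (Xs N)) (IH1 N (leqnn N)) orth eqxx big_nat_recr//= -IH2.
by rewrite !ReImE /sqmod /=; ring.
Qed.

Lemma psum_add (be : nat -> C) (s : nat -> vfield) n j :
  (fun x => psum be s (n + j) x - psum be s n x) =
  psum (fun k => be (n + k)%N) (fun k => s (n + k)%N) j.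
Proof.
apply/funext => x; by rewrite /psum big_split_ord /= addrAC subrr add0r.
Qed.

Lemma XTsq_subC v w : XT Om v -> XT Om w ->
  XTsq Om (fun x => v x - w x) = XTsq Om (fun x => w x - v x).
Proof.
move=> Xv Xw; rewrite (XTsq_sub oOm Omab Xv Xw) (XTsq_sub oOm Omab Xw Xv).
have sN (p q : 'rV[C]_3) : sqnorm (p - q) = sqnorm (q - p).
  by apply: eq_bigr => k _; rewrite -opprB mxE sqmodN.
have sN' (p q : C) : sqmod (p - q) = sqmod (q - p) by rewrite -opprB sqmodN.
have e1 : (fun x => sqnorm (v x - w x)) = fun x => sqnorm (w x - v x).
  by apply/funext => x; exact: sN.
have e2 : (fun x => sqnorm (curl Om v x - curl Om w x)) = fun x => sqnorm (curl Om w x - curl Om v x).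
  by apply/funext => x; exact: sN.
have e3 : (fun x => sqmod (div Om v x - div Om w x)) = fun x => sqmod (div Om w x - div Om v x).
  by apply/funext => x; exact: sN'.
exact: (f_equal3 (fun p q r => rint mu Om p + rint mu Om q + rint mu Om r) e1 e2 e3).
Qed.

(** A difference of partial sums is a partial sum of the shifted series. By Pythagoras its square
    for [sf] is a piece of the tail, taken below [k e], and the coercivity constant [k] turns this
    into [e] for the norm of X_T. *)
Lemma psum_cauchy (be : nat -> C) : ell2 be ->
  forall e, 0 < e -> exists N, forall m n, (N <= m)%N -> (N <= n)%N ->
    XTsq Om (fun x => psum be cu m x - psum be cu n x) <= e.
Proof.
move=> l2 e e0; have [k k0 Hk] := coe.
have [N HN] := ell2_tail l2 (mulr_gt0 k0 e0); exists N.
have Xcu n := conj_eigen_XT n.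
suff main n j : (N <= n)%N -> XTsq Om (fun x => psum be cu (n + j) x - psum be cu n x) <= e.
  move=> m n Nm Nn; have [mn|/ltnW nm] := leqP m n.
    rewrite (XTsq_subC (psum_XT be m Xcu) (psum_XT be n Xcu)) -(subnKC mn); exact: main.
  rewrite -(subnKC nm); exact: main.
move=> Nn; rewrite psum_add.
have Xs i : XT Om (cu (n + i)) by exact: Xcu.
have := Hk _ (psum_XT (fun i => be (n + i)%N) j Xs); rewrite XTnorm2 psum_sform//; last first.
  by move=> p q; rewrite conj_eigen_orth eqn_add2l.
by move=> /le_trans/(_ (HN n j Nn)); rewrite ler_pM2l.
Qed.

(** * Coefficients on the boundary and the series of the solution *)

Local Notation uG := (uGamma Om eta lam u).
Hypothesis onb : TL2_orthonormal_basis Om uG.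

(** This is the square root of [eta - lam n], in the form that occurs in [uGamma]. *)
Definition gap n : R := Num.sqrt `|lam n - eta|.

Lemma gap_sq n : gap n ^+ 2 = eta - lam n.
Proof. by rewrite /gap distrC sqr_sqrtr// gtr0_norm// gap_gt0. Qed.

Lemma gap_neq0 n : gap n != 0.
Proof.
by have := gap_gt0 n; rewrite -gap_sq; apply: contraTneq => ->; rewrite expr0n ltxx.
Qed.

(** Stated for the conjugate, since [TL2_inner] conjugates its second argument. *)
Lemma uGammaE n : {ae nu, forall x, B x ->
  conjf (uG n) x = (gap n)%:C *: trace Om (cu n) x}.
Proof.
have Xu := eigen_XT n; have tu := XT_is_trace XT_has_trace Xu.
have e1 := piT_ae oOm bOm C11Om Omab tu Xu.
have e2 := trace_conj oOm bOm C11Om Omab XT_has_trace Xu.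
apply: filterS2 e1 e2 => x e1 e2 Bx; rewrite /cu (e2 Bx); apply/rowP => k.
rewrite conjfE [uG n x]/uGamma (e1 Bx) [in LHS]mxE [RHS]mxE conjfE -/(gap n).
by move: (trace Om (u n) x 0 k) => p; apply: eqC; rewrite !ReImE /=; ring.
Qed.

Lemma uGamma_L2 n : L2v nu B (uG n).
Proof. by have [/(_ n)[]] := onb. Qed.

Lemma trace_L2 v : XT Om v -> L2v nu B (trace Om v).
Proof. exact: (XT_trace_L2 oOm bOm C11Om Omab XT_has_trace). Qed.

Lemma inner_uGamma n psi : XT Om psi ->
  TL2_inner Om (trace Om psi) (uG n) = (gap n)%:C * bf psi (cu n).
Proof.
move=> Xp; have [Tp Tc] := (trace_L2 Xp, trace_L2 (conj_eigen_XT n)).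
rewrite bdry_sym -(cintZ mB (gap n)%:C (cintg_cdot mB Tc Tp)) /TL2_inner.
under eq_fun do rewrite cdotC.
have Lg : L2v nu B (fun x => (gap n)%:C *: trace Om (cu n) x).
  move=> k; under eq_fun do rewrite mxE.
  exact: (L2Z mB _ (Tc k)).
rewrite (cint_cdot_ae mB (L2v_conj (uGamma_L2 n)) Lg Tp (uGammaE n)).
congr (cint _ _ _); apply/funext => x; rewrite /cdot mulr_sumr.
by apply: eq_bigr => k _; rewrite mxE mulrA.
Qed.

Lemma conj_eigen_vol n psi : XT Om psi -> vol (cu n) psi = - (lam n)%:C * bf (cu n) psi.
Proof.
move=> Xp; have Xc := XT_conjf Xp; have Xu := eigen_XT n; rewrite -(conjfK psi).
rewrite (vol_conj oOm Omab alpha theta Xu Xc) (eigen_vol n Xc).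
rewrite (bdry_conj oOm bOm C11Om Omab XT_has_trace Xu Xc).
by move: (bf _ _) => p; apply: eqC; rewrite !ReImE /=; ring.
Qed.

Lemma sform_eigen n psi : XT Om psi ->
  sf psi (u n) = (gap n)%:C * TL2_inner Om (trace Om psi) (uG n).
Proof.
move=> Xp; rewrite (inner_uGamma n Xp) mulrA -rmorphM -expr2 gap_sq /sform -/(cu n).
rewrite vol_sym (conj_eigen_vol n Xp) [bf (cu n) _]bdry_sym rmorphB /=.
by move: (bf _ _) => p; ring.
Qed.

Lemma vol_conj_eigen n psi : XT Om psi ->
  (gap n / lam n)%:C * vol (cu n) psi = - TL2_inner Om (trace Om psi) (uG n).
Proof.
move=> Xp; rewrite (conj_eigen_vol n Xp) (inner_uGamma n Xp) [bf psi _]bdry_sym.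
move: (bf _ _) => p; rewrite mulrA mulrN -rmorphM /= mulfVK ?mulNr//.
exact/eqP/lam0.
Qed.

Lemma TH_coef_trace psi : XT Om psi ->
  TH_coef eta lam 2^-1 (fun n => TL2_inner Om (trace Om psi) (uG n)).
Proof.
move=> Xp; rewrite /TH_coef /ell2.
under eq_fun do rewrite powR12_sqrt// mulrC -/(gap _) -(sform_eigen _ Xp).
apply: nondecreasing_is_cvgn.
  by apply: nondecreasing_series => n _ _; exact: sqmod_ge0.
by exists (complex.Re (sf psi psi)) => _ [n _ <-]; exact: bessel.
Qed.

Variable c : nat -> C.
Hypothesis cTH : TH_coef eta lam (- 2^-1) c.

Definition sol_coef n : C := (gap n / lam n)%:C * c n.

Lemma ell2_sol_coef : ell2 sol_coef.
Proof.
have [_ _ _ lamoo _] := stek.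
have [N _ HN] := cvgrNy_le lamoo (- (1 + `|eta|)).
pose t n := (gap n ^+ 2 / lam n) ^+ 2.
(* From [N] on, [lam n <= - (1 + |eta|)] gives [0 < eta - lam n <= - 2 lam n], hence [t n <= 4]; the
   sum takes care of the finitely many earlier indices. *)
pose K := 4 + \sum_(k < N) t k.
have t0 n : 0 <= t n by exact: sqr_ge0.
have tK n : t n <= K.
  have [nN|Nn] := ltnP n N.
    rewrite /K (bigD1 (Ordinal nN))//= addrCA lerDl addr_ge0// sumr_ge0// => i _; exact: t0.
  have := HN n Nn; rewrite /= => ln; apply: (@le_trans _ _ 4); last first.
    by rewrite lerDl sumr_ge0// => i _; exact: t0.
  have e0 := normr_ge0 eta; have l0 : lam n < 0 by lra.
  rewrite /t gap_sq exprMn exprVn ler_pdivrMr ?exprn_even_gt0//= ?lt_eqF//.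
  have h1 := ler_norm eta; have h2 : - eta <= `|eta| by rewrite -normrN ler_norm.
  have : 0 <= (- (2 * lam n) - (eta - lam n)) * (- (2 * lam n) + (eta - lam n)).
    by apply: mulr_ge0; lra.
  by rewrite !expr2; move=> h; lra.
apply: (@series_le_cvg _ _ (fun n => K * sqmod (c n * (`|lam n - eta| `^ (- 2^-1))%:C))).
- by move=> n; exact: sqmod_ge0.
- by move=> n; rewrite mulr_ge0 ?sqmod_ge0// (le_trans (t0 0)).
(* [sol_coef n] factors as [(gap n ^ 2 / lam n) * (c n / gap n)]. *)
- move=> n; rewrite powRN powR12_sqrt// -/(gap n).
  apply: le_trans (_ : t n * sqmod (c n * ((gap n)^-1)%:C) <= _); last first.
    by rewrite ler_wpM2r ?sqmod_ge0.
  rewrite le_eqVlt; apply/orP; left; apply/eqP; rewrite /sol_coef !sqmodM /t.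
  have g0 := gap_neq0 n; have /eqP l0 := @lam0 n.
  by move: (sqmod (c n)) => q; rewrite /sqmod /= expr0n !addr0; field; rewrite g0 l0.
- have cs : cvgn (series (fun n => sqmod (c n * (`|lam n - eta| `^ (- 2^-1))%:C))) := cTH.
  exact: (is_cvg_seriesZ (k := K) cs).
Qed.

(** The convergence of the series [c_n d_n] is part of the conclusion: up to sign its partial sums
    are the values of the continuous functional [vol _ psi] at the partial sums of the solution. *)
Lemma solution_exists : exists v, [/\ XT Om v, XT_cvg Om (psum sol_coef cu) v &
  forall psi, XT Om psi ->
    cvgC (fun N => \sum_(n < N) c n * TL2_inner Om (trace Om psi) (uG n)) (- vol v psi)].
Proof.
have Xcu n := conj_eigen_XT n; have Xp N := psum_XT sol_coef N Xcu.
have [v Xv cv] := XT_complete oOm Omab Xp (psum_cauchy ell2_sol_coef).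
exists v; split=> // psi Xpsi.
have := cvgCN (vol_cvg oOm Omab alpha theta Xp Xv Xpsi cv).
rewrite (_ : (fun n => _) = fun N => \sum_(n < N) c n * TL2_inner Om (trace Om psi) (uG n))//.
apply/funext => N; rewrite vol_psum// -sumrN; apply: eq_bigr => n _.
rewrite -[TL2_inner _ _ _]opprK -(vol_conj_eigen n Xpsi) /sol_coef.
by move: (vol _ _) => p; ring.
Qed.

Lemma inner_lin (q : C) g h w : L2v nu B g -> L2v nu B h -> L2v nu B w ->
  TL2_inner Om (lin q g h) w = q * TL2_inner Om g w + TL2_inner Om h w.
Proof. by move=> Lg Lh Lw; exact: (cint_cdot_lin mB q Lg Lh (L2v_conj Lw)). Qed.

Lemma psum_L2 (d : nat -> C) N : L2v nu B (psum d uG N).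
Proof.
elim: N => [|N IH]; first by rewrite psum0; exact: (L2v_lin mB (- 1) (uGamma_L2 0) (uGamma_L2 0)).
by rewrite psumS; exact: (L2v_lin mB (d N) (uGamma_L2 N) IH).
Qed.

Lemma inner_psum (d : nat -> C) m N : (m < N)%N -> TL2_inner Om (psum d uG N) (uG m) = d m.
Proof.
have orth n k : TL2_inner Om (uG n) (uG k) = (n == k)%:R by have [_ h _] := onb; exact: h.
have Lu := uGamma_L2.
have e k : TL2_inner Om (psum d uG k) (uG m) = if (m < k)%N then d m else 0.
  elim: k => [|k IH].
    by rewrite psum0 (inner_lin (- 1) (Lu 0) (Lu 0) (Lu m)) mulN1r addNr.
  rewrite psumS (inner_lin _ (Lu k) (psum_L2 d k) (Lu m)) IH orth ltnS.
  by case: (ltngtP m k) => [mk|km|->] /=; rewrite ?mulr0 ?mulr1 ?add0r ?addr0.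
by move=> mN; rewrite e mN.
Qed.

Lemma inner_cvg (s : nat -> vfield) g w : (forall n, L2v nu B (s n)) -> L2v nu B g -> L2v nu B w ->
  L2v_cvg nu B s g -> cvgC (fun n => TL2_inner Om (s n) w) (TL2_inner Om g w).
Proof.
move=> Ls Lg Lw cv.
pose W : R := rint nu B (fun x => sqnorm (conjf w x)).
apply: (cvgC_squeeze (u := fun n => 3 * (rint nu B (fun x => sqnorm (s n x - g x)) * W))).
  move=> n; have := cauchy_schwarz_cdot mB (L2v_lin mB (- 1) Lg (Ls n)) (L2v_conj Lw).
  have := inner_lin (- 1) Lg (Ls n) Lw; rewrite mulN1r addrC => <-.
  rewrite -(subE (s n) g); exact.
rewrite -(mulr0 3) -[in X in _ --> X](mul0r W).
by apply: cvgM; [exact: cvg_cst|apply: cvgM => //; exact: cvg_cst].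
Qed.

(** [TH_acts] asserts only that some coefficients exist. Pairing the expansion with [uG m] forces
    them to be the inner products, so two solutions are tested on the same series. *)
Lemma coef_unique (d : nat -> C) g : L2v nu B g -> L2v_cvg nu B (psum d uG) g ->
  forall m, d m = TL2_inner Om g (uG m).
Proof.
move=> Lg cv m; have h := inner_cvg (psum_L2 d) Lg (uGamma_L2 m) cv.
apply: cvgC_unique _ h; rewrite /cvgC; apply: cvg_near_cst.
(* From [m + 1] terms on, the pairing is constantly [d m]. *)
exists m.+1 => // N /= mN; rewrite inner_psum//.
by rewrite subrr /sqmod /= expr0n addr0.
Qed.

Lemma sform0E v phi : sform Om alpha theta 0 v phi = vol v (conjf phi).
Proof. by rewrite /sform mul0r addr0. Qed.

Lemma vol_eq0_unique v : XT Om v -> (forall phi, XT Om phi -> vol v phi = 0) ->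
  ae_eq_on Om v (fun=> 0).
Proof.
move=> Xv v0; apply: contrapT => nv; apply: (nv).
have [_ /(_ 0 v) h _ _ _] := stek.
have [|N [d]] := h.
  by split=> // phi Xp; rewrite oppr0 mul0r v0.
rewrite /ae_eq_on; apply: filterS => x e Omx; rewrite (e Omx).
(* The expansion of an eigenfunction for 0 runs over the indices with [lam n = 0], of which there
   are none. *)
by rewrite big_pred0// => n; apply/negP => /eqP; exact: lam0.
Qed.

Lemma solution_unique v w : XT Om v ->
  (forall psi, XT Om psi ->
    cvgC (fun N => \sum_(n < N) c n * TL2_inner Om (trace Om psi) (uG n)) (- vol v psi)) ->
  is_solution Om alpha theta eta lam u c w -> ae_eq_on Om w v.
Proof.
move=> Xv cv [Xw sw].
have Xz := XT_lin oOm Omab (- 1) Xv Xw.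
have : ae_eq_on Om (lin (- 1) v w) (fun=> 0).
  apply: (vol_eq0_unique Xz) => psi Xp.
  (* Testing with the conjugate of [psi] cancels the conjugations in both the functional and the
     form. *)
  have := sw _ (XT_conjf Xp); rewrite conjfK sform0E conjfK => -[d [_ dcv wcv]].
  have de := coef_unique (trace_L2 Xp) dcv.
  have wcv' : cvgC (fun N => \sum_(n < N) c n * TL2_inner Om (trace Om psi) (uG n)) (- vol w psi).
    rewrite (_ : (fun N => _) = fun N => \sum_(n < N) c n * d n); first exact: wcv.
    by apply/funext => N; apply: eq_bigr => n _; rewrite de.
  have /oppr_inj e := cvgC_unique (cv psi Xp) wcv'.
  by rewrite (vol_lin oOm Omab alpha theta (- 1) Xv Xw Xp) e mulN1r addNr.
apply: filterS => x h Omx; have := h Omx; rewrite /lin scaleN1r addrC => /eqP.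
by rewrite subr_eq0 => /eqP.
Qed.

Lemma solution_is_solution v : XT Om v ->
  (forall psi, XT Om psi ->
    cvgC (fun N => \sum_(n < N) c n * TL2_inner Om (trace Om psi) (uG n)) (- vol v psi)) ->
  is_solution Om alpha theta eta lam u c v.
Proof.
move=> Xv cv; split=> // phi /XT_conjf Xp; rewrite sform0E.
exists (fun n => TL2_inner Om (trace Om (conjf phi)) (uG n)); split.
- exact: TH_coef_trace.
- have [_ _] := onb; apply.
  exact: (XT_TL2 oOm bOm C11Om Omab XT_has_trace Xp).
- exact: cv.
Qed.

End Steklov.

Theorem theorem4p20 (R : realType) (Om : set (pt R))
    (alpha theta c0 eta : R)
    (lam : nat -> R) (u : nat -> vfield R) (c : nat -> R[i]) :
  open Om -> bounded_set Om -> connected Om -> C11_domain Om ->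
  0 < theta -> alpha < A1 Om theta ->
  0 <= c0 ->
  (forall eta', c0 <= eta' -> coercive Om alpha theta eta') ->
  c0 <= eta ->
  steklov_basis Om alpha theta eta lam u ->
  TL2_orthonormal_basis Om (uGamma Om eta lam u) ->
  (forall n, lam n <> 0) ->
  TH_coef eta lam (- 2^-1) c ->
  exists v : vfield R,
    [/\ is_solution Om alpha theta eta lam u c v,
        (forall w, is_solution Om alpha theta eta lam u c w ->
           ae_eq_on Om w v) &
        XT_cvg Om
          (psum (fun n => (Num.sqrt `|lam n - eta| / lam n)%:C * c n)
                (fun n => conjf (u n))) v].
Proof.
move=> oOm bOm _ C11Om _ _ _ coe c0eta stek onb lam0 cTH.
have [M OmM] := bounded_cbox bOm; have coeta := coe eta c0eta.
have [v [Xv cv vol_v]] :=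
  solution_exists oOm bOm C11Om OmM coeta stek lam0 onb cTH.
exists v; split; last exact: cv.
- exact: (solution_is_solution oOm bOm C11Om OmM coeta stek lam0 onb Xv vol_v).
- move=> w sw.
  exact: (solution_unique oOm bOm C11Om OmM stek lam0 onb Xv vol_v sw).
Qed.
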